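(* (a) Let $n\ge1$, let $\omega_n$ be an $n$-th root of unity and $q:=\omega_n\exp(\hbar)$. The assignment $$D\mapsto \sum_{a=1}^n E_{a,a}\otimes q^{n-a}e^{n\partial},\qquad Z\mapsto \sum_{a=1}^{n-1}E_{a,a+1}\otimes 1+E_{n,1}\otimes x$$ gives rise to a $\mathbb C[[\hbar]]$-algebra homomorphism $\Upsilon^{\omega_n}_{1,n}\colon\widehat{\mathfrak d}^{(1)}_{\omega_n\exp(\hbar)}\to\widehat{\mathfrak D}^{(n)}_\hbar$. (b) Combining $\Upsilon^{\omega_n}_{1,n}$ with the identification $\mathrm{Mat}_m\otimes\mathrm{Mat}_n\simeq\mathrm{Mat}_{mn}$, $E_{a,b}\otimes E_{k,l}\mapsto E_{m(k-1)+a,m(l-1)+b}$ ($1\le a,b\le m$, $1\le k,l\le n$), one gets a $\mathbb C[[\hbar]]$-algebra homomorphism $\Upsilon^{\omega_n}_{m,n}\colon\widehat{\mathfrak d}^{(m)}_{\omega_n\exp(\hbar)}\to\widehat{\mathfrak D}^{(mn)}_\hbar$ for any $m,n\in\mathbb Z_{>0}$. (c) The assignment $c_{\mathfrak d}\mapsto c_{\mathfrak D}$, $A\mapsto\Upsilon^{\omega_n}_{m,n}(A)$ for $A\in\mathfrak d^{(m)}_{\omega_n\exp(\hbar)}$ gives rise to a homomorphism of $\mathbb C[[\hbar]]$-Lie algebras $\bar\Upsilon^{\omega_n}_{m,n}\colon\widehat{\bar{\mathfrak d}}^{(m)}_{\omega_n\exp(\hbar)}\to\widehat{\bar{\mathfrak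 D}}^{(mn)}_\hbar$. (d) If $\omega_n$ is a primitive $n$-th root of unity, then $\Upsilon^{\omega_n}_{m,n}$ and $\bar\Upsilon^{\omega_n}_{m,n}$ are isomorphisms.
   Context: $\hbar$ is a formal variable; $\mathrm{Mat}_n$ is the algebra of $n\times n$ complex matrices with matrix units $E_{a,b}$. For $q\in\mathbb C[[\hbar]]^\times$, $\mathfrak d_q$ is the unital associative $\mathbb C[[\hbar]]$-algebra topologically generated by $Z^{\pm1},D^{\pm1}$ with $Z^{\pm1}Z^{\mp1}=1=D^{\pm1}D^{\mp1}$, $DZ=q\,ZD$. Put $\mathfrak d^{(n)}_q=\mathrm{Mat}_n\otimes\mathfrak d_q$, also viewed as a Lie algebra with the commutator. $\bar{\mathfrak d}^{(n)}_q=\mathfrak d^{(n)}_q\oplus\mathbb C[[\hbar]]c_{\mathfrak d}$ is its central extension with bracket $[X+\lambda c_{\mathfrak d},Y+\mu c_{\mathfrak d}]=XY-YX+\phi(X,Y)c_{\mathfrak d}$, where $$\phi(M_1\otimes D^{k_1}Z^{l_1},M_2\otimes D^{k_2}Z^{-l_2})=\delta_{l_1,l_2}\,\mathrm{tr}(M_1M_2)\,q^{-l_1k_2}\frac{1-q^{l_1(k_1+k_2)}}{1-q^{k_1+k_2}},$$ the fraction being the value of $\frac{1-x^{l_1}}{1-x}\in\mathbb C[x^{\pm1}]$ at $x=q^{k_1+k_2}$. $\mathfrak D_\hbar$ is the unital associative $\mathbb C[[\hbar]]$-algebra topologically generated by $\partial,x^{\pm1}$ with $x^{\pm1}x^{\mp1}=1$,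 $\partial x=x(\partial+\hbar)$. Put $\mathfrak D^{(n)}_\hbar=\mathrm{Mat}_n\otimes\mathfrak D_\hbar$, also viewed as a Lie algebra with the commutator. $\bar{\mathfrak D}^{(n)}_\hbar=\mathfrak D^{(n)}_\hbar\oplus\mathbb C[[\hbar]]c_{\mathfrak D}$ is its central extension by the 2-cocycle $\phi(M_1\otimes f_1(\partial)x^k,M_2\otimes f_2(\partial)x^l)$ equal to $\mathrm{tr}(M_1M_2)\sum_{a=0}^{k-1}f_1(a\hbar)f_2((a-k)\hbar)$ if $k=-l>0$; $-\mathrm{tr}(M_1M_2)\sum_{a=0}^{-k-1}f_2(a\hbar)f_1((a+k)\hbar)$ if $k=-l<0$; $0$ otherwise ($f_1,f_2$ polynomials). Completions: for $q=\omega_n\exp(\hbar)$ and any $m$, $\widehat{\mathfrak d}^{(m)}_q=\varprojlim_r\mathfrak d^{(m)}_q/\mathfrak d^{(m)}_q\cdot(D^n-1,q-\omega_n)^r$ and $\widehat{\mathfrak D}^{(m)}_\hbar=\varprojlim_r\mathfrak D^{(m)}_\hbar/\mathfrak D^{(m)}_\hbar\cdot(\partial,\hbar)^r$, where $(\cdot)$ denotes the two-sided ideals of $\mathfrak d_q$, $\mathfrak D_\hbar$. $\widehat{\bar{\mathfrak d}}^{(m)}_q$ and $\widehat{\bar{\mathfrak D}}^{(m)}_\hbar$ denote the analogous completions of the central extensions; equivalently they are the central extensions $\widehat{\mathfrak d}^{(m)}_q\oplus\mathbb C[[\hbar]]c_{\mathfrak d}$, $\widehat{\mathfrak D}^{(m)}_\hbar\oplus\mathbb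 C[[\hbar]]c_{\mathfrak D}$ by the (continuously extended) cocycles above. *)

(* Defs.v *)
From HB Require Import structures.
From mathcomp Require Import all_boot all_order all_algebra.
From mathcomp Require Import all_classical.
From mathcomp Require Import reals complex finmap.
From mathcomp.multinomials Require Import monalg.
Set Implicit Arguments.
Unset Strict Implicit.
Unset Printing Implicit Defensive.
Import Order.TTheory GRing.Theory Num.Theory.
Local Open Scope classical_set_scope.
Local Open Scope ring_scope.

Record fps (C : Type) := Fps { fcoef : nat -> C }.

Lemma fpsP (C : Type) (f g : fps C) : fcoef f =1 fcoef g <-> f = g.
Proof.
by split=> [|-> //]; case: f g => [f] [g] /= e; congr Fps; apply/funext.
Qed.

HB.instance Definition _ (C : Type) := gen_eqMixin (fps C).
HB.instance Definition _ (C : Type) := gen_choiceMixin (fps C).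

Section FpsRing.
Variable C : comNzRingType.
Implicit Types f g h : fps C.

Let zero : fps C := Fps (fun=> 0).
Let opp f : fps C := Fps (fun i => - fcoef f i).
Let add f g : fps C := Fps (fun i => fcoef f i + fcoef g i).

Fact fps_addA : associative add.
Proof. by move=> f g h; apply/fpsP=> i /=; rewrite addrA. Qed.
Fact fps_addC : commutative add.
Proof. by move=> f g; apply/fpsP=> i /=; rewrite addrC. Qed.
Fact fps_add0 : left_id zero add.
Proof. by move=> f; apply/fpsP=> i /=; rewrite add0r. Qed.
Fact fps_addN : left_inverse zero opp add.
Proof. by move=> f; apply/fpsP=> i /=; rewrite addNr. Qed.
HB.instance Definition _ :=
  GRing.isZmodule.Build (fps C) fps_addA fps_addC fps_add0 fps_addN.

Definition fpsC (c : C) : fps C := Fps (fun i => if i == 0%N then c else 0).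
Definition fps_mul f g : fps C :=
  Fps (fun i => \sum_(j < i.+1) fcoef f j * fcoef g (i - j)).

Let trunc N f : {poly C} := \poly_(i < N) fcoef f i.

Let mulE N f g i : (i < N)%N ->
  fcoef (fps_mul f g) i = (trunc N f * trunc N g)`_i.
Proof.
move=> iN /=; rewrite coefM; apply: eq_bigr => j _; rewrite !coef_poly.
by rewrite (leq_ltn_trans _ iN) ?leq_ord // (leq_ltn_trans (leq_subr _ _) iN).
Qed.

Fact fps_mulA : associative fps_mul.
Proof.
move=> f g h; apply/fpsP=> i /=.
transitivity ((trunc i.+1 f * (trunc i.+1 g * trunc i.+1 h))`_i).
  rewrite coefM; apply: eq_bigr => j _; rewrite coef_poly ltn_ord.
  by congr (_ * _); apply: (@mulE i.+1 g h (i - j)); rewrite ltnS leq_subr.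
rewrite mulrA coefM; apply: eq_bigr => j _; rewrite [in LHS]coef_poly.
rewrite ltnS leq_subr; congr (_ * _).
by rewrite -mulE.
Qed.
Fact fps_mulC : commutative fps_mul.
Proof.
by move=> f g; apply/fpsP=> i; rewrite !(@mulE i.+1) // mulrC.
Qed.
Fact fps_mul1 : left_id (fpsC 1) fps_mul.
Proof.
move=> f; apply/fpsP=> i /=; rewrite big_ord_recl /= mul1r subn0.
by rewrite big1 ?addr0 // => j _; rewrite mul0r.
Qed.
Fact fps_mulDl : left_distributive fps_mul +%R.
Proof.
move=> f g h; apply/fpsP=> i /=; rewrite -big_split /=.
by apply: eq_bigr => j _; rewrite mulrDl.
Qed.
Fact fps_1neq0 : fpsC 1 != 0.
Proof.
apply/eqP=> /(congr1 (fun f : fps C => fcoef f 0)) /= /eqP.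
by rewrite oner_eq0.
Qed.
HB.instance Definition _ := GRing.Zmodule_isComNzRing.Build (fps C)
  fps_mulA fps_mulC fps_mul1 fps_mulDl fps_1neq0.

Let unit : {pred fps C} := fun f => `[< exists g, g * f = 1 >].
Let inv f : fps C := xget f [set g | g * f = 1].

Fact fps_mulV : {in unit, left_inverse 1 inv *%R}.
Proof. by move=> f /asboolP [g fg]; exact: (xgetI f (fg : [set _ | _] g)). Qed.
Fact fps_unitP f g : g * f = 1 -> unit f.
Proof. by move=> gf; apply/asboolP; exists g. Qed.
Fact fps_invN : {in [predC unit], inv =1 id}.
Proof.
move=> f /= /negP nu; rewrite /inv; case: xgetP => // g _ gf.
by case: nu; exact: fps_unitP gf.
Qed.
HB.instance Definition _ := GRing.ComNzRing_hasMulInverse.Build (fps C)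
  fps_mulV fps_unitP fps_invN.

Lemma fcoefD f g i : fcoef (f + g) i = fcoef f i + fcoef g i.
Proof. by []. Qed.
Lemma fcoefN f i : fcoef (- f) i = - fcoef f i.
Proof. by []. Qed.
Lemma fcoef0 i : fcoef (0 : fps C) i = 0.
Proof. by []. Qed.
Lemma fcoef1 i : fcoef (1 : fps C) i = (i == 0%N)%:R.
Proof. by rewrite /=; case: (i == 0%N). Qed.
Lemma fcoefM f g i :
  fcoef (f * g) i = \sum_(j < i.+1) fcoef f j * fcoef g (i - j).
Proof. by []. Qed.

Definition hbar : fps C := Fps (fun i => (i == 1%N)%:R).

Definition fps_cong (N : nat) f g := forall i, (i < N)%N -> fcoef f i = fcoef g i.

End FpsRing.

Arguments hbar {C}.

Section FpsExp.
Variable C : numFieldType.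

Definition exp_hbar : fps C := Fps (fun i => (i`!%:R)^-1).

Lemma fpsCM (a b : C) : fpsC (a * b) = fpsC a * fpsC b.
Proof.
apply/fpsP=> i; rewrite fcoefM big_ord_recl /= subn0 big1 ?addr0.
  by case: eqP => //; rewrite mulr0.
by move=> j _; rewrite mul0r.
Qed.

Lemma exp_hbar_unit : exp_hbar \is a GRing.unit.
Proof.
pose e : fps C := Fps (fun i => (-1) ^+ i * (i`!%:R)^-1).
suff ee : e * exp_hbar = 1.
  by apply/unitrPr; exists e; rewrite mulrC.
apply/fpsP=> i; rewrite fcoefM fcoef1 /=.
have fact_neq0 k : k`!%:R != 0 :> C by rewrite pnatr_eq0 -lt0n fact_gt0.
transitivity ((i`!%:R)^-1 * (1 - 1 : C) ^+ i); last first.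
  rewrite subrr expr0n; case: i => [|i] /=; first by rewrite fact0 invr1 mulr1.
  by rewrite mulr0.
rewrite exprBn mulr_sumr; apply: eq_bigr => j _.
have ji : (j <= i)%N by rewrite -ltnS.
have -> : (i`!%:R)^-1 = (j`!%:R)^-1 * ((i - j)`!%:R)^-1 / ('C(i, j)%:R : C).
  by rewrite -(bin_fact ji) !natrM !invfM mulrC.
have C0 : 'C(i, j)%:R != 0 :> C by rewrite pnatr_eq0 -lt0n bin_gt0.
rewrite !expr1n !mulr1 -[X in _ = _ * X]mulr_natr.
by rewrite [X in _ = _ * X]mulrC mulrA divfK // [RHS]mulrC mulrA.
Qed.

Lemma root_exp_unit (n : nat) (w : C) : (0 < n)%N -> w ^+ n = 1 ->
  fpsC w * exp_hbar \is a GRing.unit.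
Proof.
move=> n0 wn; rewrite unitrM exp_hbar_unit andbT; apply/unitrPr.
by exists (fpsC (w ^+ n.-1)); rewrite -fpsCM -exprS prednK // wn.
Qed.

End FpsExp.

(* A possibly trivial unital associative algebra, given by its structure map
   into the centre: the library's algType requires 1 != 0, which cannot be
   asked of quotients and matrix algebras of arbitrary size. *)
HB.mixin Record isPzAlg (K : comNzRingType) A of GRing.PzRing A := {
  alg : K -> A;
  alg_zmod_morphism : zmod_morphism alg;
  alg_monoid_morphism : monoid_morphism alg;
  alg_central : forall (k : K) (x : A), alg k * x = x * alg k }.

#[short(type="pzAlgType")]
HB.structure Definition PzAlg (K : comNzRingType) :=
  { A of GRing.PzRing A & isPzAlg K A }.

Section AlgTheory.
Variables (K : comNzRingType) (A : pzAlgType K).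

HB.instance Definition _ :=
  GRing.isZmodMorphism.Build K A (@alg K A) (@alg_zmod_morphism K A).
HB.instance Definition _ :=
  GRing.isMonoidMorphism.Build K A (@alg K A) (@alg_monoid_morphism K A).

Definition ascale (k : K) (x : A) : A := alg k * x.

Lemma ascaleA a b x : ascale a (ascale b x) = ascale (a * b) x.
Proof. by rewrite /ascale rmorphM mulrA. Qed.
Lemma ascale1 : left_id 1 ascale.
Proof. by move=> x; rewrite /ascale rmorph1 mul1r. Qed.
Lemma ascaleDr : right_distributive ascale +%R.
Proof. by move=> k x y; rewrite /ascale mulrDr. Qed.
Lemma ascaleDl x : {morph ascale^~ x : a b / a + b}.
Proof. by move=> a b; rewrite /ascale rmorphD mulrDl. Qed.
Lemma ascaleAl k x y : ascale k (x * y) = ascale k x * y.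
Proof. by rewrite /ascale mulrA. Qed.
Lemma ascaleAr k x y : ascale k (x * y) = x * ascale k y.
Proof. by rewrite /ascale mulrA alg_central mulrA. Qed.

End AlgTheory.

Notation "k *~: x" := (ascale k x)
  (at level 40, left associativity) : ring_scope.

Definition alg_hom (K : comNzRingType) (A B : pzAlgType K) (f : A -> B) : Prop :=
  (forall (k : K) (x y : A), f (k *~: x + y) = k *~: f x + f y)
  /\ monoid_morphism f.

Section Ideals.
Variable A : pzRingType.

Record ideal := Ideal {
  ideal_set :> A -> Prop;
  ideal0 : ideal_set 0;
  idealD : forall x y, ideal_set x -> ideal_set y -> ideal_set (x + y);
  idealMl : forall a x, ideal_set x -> ideal_set (a * x);
  idealMr : forall a x, ideal_set x -> ideal_set (x * a) }.

Lemma idealN (I : ideal) x : I x -> I (- x).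
Proof. by move=> Ix; rewrite -mulN1r; apply: idealMl. Qed.

Lemma idealB (I : ideal) x y : I x -> I y -> I (x - y).
Proof. by move=> Ix Iy; apply: idealD => //; apply: idealN. Qed.

Lemma ideal_sum (I : ideal) (J : Type) (r : seq J) (P : pred J) (f : J -> A) :
  (forall i, P i -> I (f i)) -> I (\sum_(i <- r | P i) f i).
Proof.
by move=> If; apply: (big_ind (fun x => I x)) => //;
  [exact: ideal0|exact: idealD].
Qed.

Definition gen_set (S : set A) : set A :=
  [set x | forall I : ideal, (forall y, S y -> I y) -> I x].

Fact gen0 S : gen_set S 0.
Proof. by move=> I _; exact: ideal0. Qed.
Fact genD S x y : gen_set S x -> gen_set S y -> gen_set S (x + y).
Proof. by move=> Sx Sy I SI; apply: idealD; [exact: Sx|exact: Sy]. Qed.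
Fact genMl S a x : gen_set S x -> gen_set S (a * x).
Proof. by move=> Sx I SI; apply: idealMl; exact: Sx. Qed.
Fact genMr S a x : gen_set S x -> gen_set S (x * a).
Proof. by move=> Sx I SI; apply: idealMr; exact: Sx. Qed.

Definition gen (S : set A) : ideal :=
  Ideal (@gen0 S) (@genD S) (@genMl S) (@genMr S).

Lemma sub_gen (S : set A) x : S x -> gen S x.
Proof. by move=> Sx I; apply. Qed.

Lemma gen_sub (S : set A) (I : ideal) :
  (forall x, S x -> I x) -> forall x, gen S x -> I x.
Proof. by move=> SI x; apply. Qed.

Definition idealT : ideal :=
  @Ideal (fun=> True) I (fun _ _ _ _ => I) (fun _ _ _ => I) (fun _ _ _ => I).

Fixpoint ideal_pow (I : ideal) (r : nat) : ideal :=
  if r is r'.+1 then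
    gen [set z | exists x y, [/\ ideal_pow I r' x, I y & z = x * y]]
  else idealT.

Record filtration := Filtration {
  fil :> nat -> ideal;
  fil_sub : forall r x, fil r.+1 x -> fil r x }.

Lemma fil_le (F : filtration) r s : (r <= s)%N -> forall x, F s x -> F r x.
Proof.
move=> /subnK <-; elim: (s - r)%N => [//|d IH] x.
by rewrite addSn => /fil_sub; exact: IH.
Qed.

Fact adic_sub (I : ideal) r x : ideal_pow I r.+1 x -> ideal_pow I r x.
Proof. by apply: gen_sub => _ [y [z [Iy _ ->]]]; exact: idealMr. Qed.

Definition adic (I : ideal) : filtration := Filtration (@adic_sub I).

Lemma ideal_pow_expr (I : ideal) x r : I x -> ideal_pow I r (x ^+ r).
Proof.
move=> Ix; elim: r => [//|r IH]; rewrite exprSr; apply: sub_gen.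
by exists (x ^+ r), x.
Qed.

End Ideals.

Section Quotient.
Variables (K : comNzRingType) (A : pzAlgType K) (I : ideal A).

Definition ideal_eq (x y : A) : bool := `[< I (x - y) >].

Fact ideal_eq_class : equiv_class_of ideal_eq.
Proof.
split=> [x|x y|y x z].
- by apply/asboolP; rewrite subrr; exact: ideal0.
- by apply/asboolP/asboolP => /idealN; rewrite opprB.
- move=> /asboolP xy /asboolP yz; apply/asboolP.
  by rewrite -(subrKA y); exact: idealD.
Qed.
Canonical ideal_eq_equiv := EquivRelPack ideal_eq_class.

Definition quot := {eq_quot ideal_eq_equiv}%qT.
HB.instance Definition _ : EqQuotient A ideal_eq_equiv quot :=
  EqQuotient.on quot.
HB.instance Definition _ := Choice.on quot.

Definition qpi (x : A) : quot := (\pi_quot x)%qT.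
Definition qrepr (x : quot) : A := repr x.

Lemma qreprK : cancel qrepr qpi.
Proof. exact: reprK. Qed.

Lemma qpiP x y : qpi x = qpi y <-> I (x - y).
Proof.
split; first by move=> /eqquotP/asboolP.
by move=> xy; apply/eqquotP/asboolP.
Qed.

Lemma qrepr_pi x : I (qrepr (qpi x) - x).
Proof. by apply/qpiP; rewrite qreprK. Qed.

Let zero : quot := qpi 0.
Let one : quot := qpi 1.
Let opp (x : quot) : quot := qpi (- qrepr x).
Let add (x y : quot) : quot := qpi (qrepr x + qrepr y).
Let mul (x y : quot) : quot := qpi (qrepr x * qrepr y).

Let qoppE x : opp (qpi x) = qpi (- x).
Proof. by apply/qpiP; rewrite -opprD; apply: idealN; exact: qrepr_pi. Qed.
Let qaddE x y : add (qpi x) (qpi y) = qpi (x + y).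
Proof.
by apply/qpiP; rewrite opprD addrACA; apply: idealD; exact: qrepr_pi.
Qed.
Let qmulE x y : mul (qpi x) (qpi y) = qpi (x * y).
Proof.
apply/qpiP; have -> : forall a b : A, a * b - x * y = (a - x) * b + x * (b - y).
  by move=> a b; rewrite mulrBl mulrBr addrA subrK.
by apply: idealD; [apply: idealMr|apply: idealMl]; exact: qrepr_pi.
Qed.
Lemma quotP (P : quot -> Prop) : (forall x, P (qpi x)) -> forall x, P x.
Proof. by move=> Px x; rewrite -[x]qreprK; exact: Px. Qed.

Fact quot_addA : associative add.
Proof.
by elim/quotP=> x; elim/quotP=> y; elim/quotP=> z; rewrite !qaddE addrA.
Qed.
Fact quot_addC : commutative add.
Proof. by elim/quotP=> x; elim/quotP=> y; rewrite !qaddE addrC. Qed.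
Fact quot_add0 : left_id zero add.
Proof. by elim/quotP=> x; rewrite !qaddE add0r. Qed.
Fact quot_addN : left_inverse zero opp add.
Proof. by elim/quotP=> x; rewrite qoppE qaddE addNr. Qed.
HB.instance Definition _ :=
  GRing.isZmodule.Build quot quot_addA quot_addC quot_add0 quot_addN.

Fact quot_mulA : associative mul.
Proof.
by elim/quotP=> x; elim/quotP=> y; elim/quotP=> z; rewrite !qmulE mulrA.
Qed.
Fact quot_mul1l : left_id one mul.
Proof. by elim/quotP=> x; rewrite qmulE mul1r. Qed.
Fact quot_mul1r : right_id one mul.
Proof. by elim/quotP=> x; rewrite qmulE mulr1. Qed.
Fact quot_mulDl : left_distributive mul +%R.
Proof.
elim/quotP=> x; elim/quotP=> y; elim/quotP=> z.
by rewrite /GRing.add /= !(qaddE, qmulE) mulrDl.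
Qed.
Fact quot_mulDr : right_distributive mul +%R.
Proof.
elim/quotP=> x; elim/quotP=> y; elim/quotP=> z.
by rewrite /GRing.add /= !(qaddE, qmulE) mulrDr.
Qed.
HB.instance Definition _ := GRing.Zmodule_isPzRing.Build quot
  quot_mulA quot_mul1l quot_mul1r quot_mulDl quot_mulDr.

Lemma qpiD x y : qpi (x + y) = qpi x + qpi y.
Proof. exact/esym/qaddE. Qed.
Lemma qpiN x : qpi (- x) = - qpi x.
Proof. exact/esym/qoppE. Qed.
Lemma qpi0 : qpi 0 = 0.
Proof. by []. Qed.
Lemma qpi1 : qpi 1 = 1.
Proof. by []. Qed.
Lemma qpiM x y : qpi (x * y) = qpi x * qpi y.
Proof. exact/esym/qmulE. Qed.

Let qalg (k : K) : quot := qpi (alg k).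
Fact qalg_zmod_morphism : zmod_morphism qalg.
Proof. by move=> a b; rewrite /qalg rmorphB qpiD qpiN. Qed.
Fact qalg_monoid_morphism : monoid_morphism qalg.
Proof.
by split=> [|a b]; rewrite /qalg ?rmorph1 // rmorphM qpiM.
Qed.
Fact qalg_central k (x : quot) : qalg k * x = x * qalg k.
Proof. by elim/quotP: x => x; rewrite -!qpiM alg_central. Qed.
HB.instance Definition _ := isPzAlg.Build K quot
  qalg_zmod_morphism qalg_monoid_morphism qalg_central.

Lemma qpi_alg k : qpi (alg k) = alg k.
Proof. by []. Qed.
Lemma qpiZ k x : qpi (k *~: x) = k *~: qpi x.
Proof. by rewrite /ascale qpiM. Qed.

End Quotient.

Section Completion.
Variables (K : comNzRingType) (A : pzAlgType K) (F : filtration A).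

(* The inverse limit of the quotients A / F r; the transition map sends the
   class of x modulo F r.+1 to its class modulo F r. *)
Record completion := Completion {
  cproj : forall r, quot (F r);
  cproj_compat : forall r, qpi (F r) (qrepr (cproj r.+1)) = cproj r }.

Lemma completionP (X Y : completion) : (forall r, cproj X r = cproj Y r) <-> X = Y.
Proof.
split=> [|-> //]; case: X Y => [X cX] [Y cY] /= e.
have {}e : X = Y by apply: functional_extensionality_dep.
by rewrite -{}e in cY *; congr Completion; exact: Prop_irrelevance.
Qed.

HB.instance Definition _ := gen_eqMixin completion.
HB.instance Definition _ := gen_choiceMixin completion.

Lemma compat_pi r (x : A) : qpi (F r) (qrepr (qpi (F r.+1) x)) = qpi (F r) x.
Proof. by apply/qpiP/fil_sub; exact: qrepr_pi. Qed.

(* The element of the completion with components the classes of s 0, s 1, ... *)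
Definition coherent (s : nat -> A) := forall r, F r (s r.+1 - s r).

Lemma coherent_compat s : coherent s ->
  forall r, qpi (F r) (qrepr (qpi (F r.+1) (s r.+1))) = qpi (F r) (s r).
Proof. by move=> cs r; rewrite compat_pi; apply/qpiP/cs. Qed.

Definition cmk (s : nat -> A) (cs : coherent s) : completion :=
  Completion (coherent_compat cs).

Lemma crepr_coherent (X : completion) : coherent (fun r => qrepr (cproj X r)).
Proof. by move=> r; apply/qpiP; rewrite qreprK cproj_compat. Qed.

Fact const_coherent (x : A) : coherent (fun=> x).
Proof. by move=> r; rewrite subrr; exact: ideal0. Qed.

Definition cin (x : A) : completion := cmk (const_coherent x).

Section Lift.
Variables (op : forall r, quot (F r) -> quot (F r) -> quot (F r)) (opA : A -> A -> A).
Hypothesis opE : forall r x y, @op r (qpi (F r) x) (qpi (F r) y) = qpi (F r) (opA x y).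
Fact lift2_compat (X Y : completion) r :
  qpi (F r) (qrepr (op (cproj X r.+1) (cproj Y r.+1))) = op (cproj X r) (cproj Y r).
Proof.
rewrite -[in LHS](qreprK (cproj X _)) -[in LHS](qreprK (cproj Y _)) opE compat_pi.
by rewrite -opE !cproj_compat.
Qed.
End Lift.

Section Lift1.
Variables (op : forall r, quot (F r) -> quot (F r)) (opA : A -> A).
Hypothesis opE : forall r x, @op r (qpi (F r) x) = qpi (F r) (opA x).
Fact lift1_compat (X : completion) r :
  qpi (F r) (qrepr (op (cproj X r.+1))) = op (cproj X r).
Proof.
by rewrite -[in LHS](qreprK (cproj X _)) opE compat_pi -opE !cproj_compat.
Qed.
End Lift1.

Let zero : completion := cin 0.
Let one : completion := cin 1.
Let opp (X : completion) : completion := Completion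
  (lift1_compat (op := fun r x => - x) (fun r x => esym (qpiN (F r) x)) X).
Let add (X Y : completion) : completion := Completion
  (lift2_compat (op := fun r x y => x + y) (fun r x y => esym (qpiD (F r) x y)) X Y).
Let mul (X Y : completion) : completion := Completion
  (lift2_compat (op := fun r x y => x * y) (fun r x y => esym (qpiM (F r) x y)) X Y).
Fact comp_addA : associative add.
Proof. by move=> X Y Z; apply/completionP=> r /=; rewrite addrA. Qed.
Fact comp_addC : commutative add.
Proof. by move=> X Y; apply/completionP=> r /=; rewrite addrC. Qed.
Fact comp_add0 : left_id zero add.
Proof. by move=> X; apply/completionP=> r /=; rewrite qpi0 add0r. Qed.
Fact comp_addN : left_inverse zero opp add.
Proof. by move=> X; apply/completionP=> r /=; rewrite qpi0 addNr. Qed.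
HB.instance Definition _ :=
  GRing.isZmodule.Build completion comp_addA comp_addC comp_add0 comp_addN.

Fact comp_mulA : associative mul.
Proof. by move=> X Y Z; apply/completionP=> r /=; rewrite mulrA. Qed.
Fact comp_mul1l : left_id one mul.
Proof. by move=> X; apply/completionP=> r /=; rewrite qpi1 mul1r. Qed.
Fact comp_mul1r : right_id one mul.
Proof. by move=> X; apply/completionP=> r /=; rewrite qpi1 mulr1. Qed.
Fact comp_mulDl : left_distributive mul +%R.
Proof. by move=> X Y Z; apply/completionP=> r /=; rewrite mulrDl. Qed.
Fact comp_mulDr : right_distributive mul +%R.
Proof. by move=> X Y Z; apply/completionP=> r /=; rewrite mulrDr. Qed.
HB.instance Definition _ := GRing.Zmodule_isPzRing.Build completion
  comp_mulA comp_mul1l comp_mul1r comp_mulDl comp_mulDr.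

Let calg (k : K) : completion := cin (alg k).
Fact calg_zmod_morphism : zmod_morphism calg.
Proof.
by move=> a b; apply/completionP=> r /=; rewrite rmorphB qpiD qpiN.
Qed.
Fact calg_monoid_morphism : monoid_morphism calg.
Proof.
by split=> [|a b]; apply/completionP=> r /=; rewrite ?rmorph1 // rmorphM qpiM.
Qed.
Fact calg_central k (X : completion) : calg k * X = X * calg k.
Proof. by apply/completionP=> r /=; rewrite qpi_alg alg_central. Qed.
HB.instance Definition _ := isPzAlg.Build K completion
  calg_zmod_morphism calg_monoid_morphism calg_central.

HB.instance Definition _ := GRing.Zmodule_isLmodule.Build K completion
  (@ascaleA K completion) (@ascale1 K completion) (@ascaleDr K completion)
  (@ascaleDl K completion).

Lemma cprojD X Y r : cproj (X + Y) r = cproj X r + cproj Y r. Proof. by []. Qed.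
Lemma cprojN X r : cproj (- X) r = - cproj X r. Proof. by []. Qed.
Lemma cprojM X Y r : cproj (X * Y) r = cproj X r * cproj Y r. Proof. by []. Qed.
Lemma cprojZ k X r : cproj (k *: X) r = k *~: cproj X r. Proof. by []. Qed.
Lemma cproj0 r : cproj 0 r = 0. Proof. by []. Qed.
Lemma cproj1 r : cproj 1 r = 1. Proof. by []. Qed.
Lemma cproj_in x r : cproj (cin x) r = qpi (F r) x. Proof. by []. Qed.

Lemma cin_alg_hom : alg_hom cin.
Proof.
split; first by move=> k x y; apply/completionP=> r; rewrite /= qpiD qpiZ.
by split=> // x y; apply/completionP=> r /=; rewrite qpiM.
Qed.

End Completion.

Section CompletionMap.
Variables (K : comNzRingType) (A B : pzAlgType K).
Variables (F : filtration A) (G : filtration B).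

Definition filtered (f : A -> B) :=
  (forall x y, f (x - y) = f x - f y) /\ (forall r x, F r x -> G r (f x)).

Fact filtered_coherent f (hf : filtered f) (X : completion F) :
  coherent G (fun r => f (qrepr (cproj X r))).
Proof. by move=> r; rewrite -hf.1; apply: hf.2; exact: crepr_coherent. Qed.

Definition cmap f (hf : filtered f) (X : completion F) : completion G :=
  cmk (filtered_coherent hf X).

Lemma cmapE f (hf : filtered f) X r x :
  qpi (F r) x = cproj X r -> cproj (cmap hf X) r = qpi (G r) (f x).
Proof.
move=> e /=; apply/qpiP; rewrite -hf.1; apply: hf.2; apply/qpiP.
by rewrite qreprK e.
Qed.

Lemma cmap_in f (hf : filtered f) x : cmap hf (cin F x) = cin G (f x).
Proof. by apply/completionP=> r; apply: cmapE. Qed.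

End CompletionMap.

Section Matrices.
Variables (K : comNzRingType) (A : pzAlgType K).

Definition mat (m : nat) := 'M[A]_m.

Section Size.
Variable m : nat.

HB.instance Definition _ := GRing.PzRing.copy (mat m) 'M[A]_m.

Let malg (k : K) : mat m := (alg k)%:M.
Fact malg_zmod_morphism : zmod_morphism malg.
Proof. by move=> a b; rewrite /malg !rmorphB. Qed.
Fact malg_monoid_morphism : monoid_morphism malg.
Proof.
by split=> [|a b]; rewrite /malg ?rmorph1 // rmorphM; exact: scalar_mxM.
Qed.
Fact malg_central k (X : mat m) : malg k * X = X * malg k.
Proof.
apply/matrixP=> i j; rewrite [LHS]mxE [RHS]mxE.
rewrite (bigD1 i) //= big1 => [|l /negPf li]; last by rewrite mxE eq_sym li mul0r.
rewrite [in RHS](bigD1 j) //= big1 => [|l /negPf lj]; last first.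
  by rewrite [X in _ * X]mxE lj mulr0.
by rewrite !addr0 mxE eqxx [X in _ = _ * X]mxE eqxx alg_central.
Qed.
HB.instance Definition _ := isPzAlg.Build K (mat m)
  malg_zmod_morphism malg_monoid_morphism malg_central.

Section Filtration.
Variable F : filtration A.

(* The left ideal Mat_m(A) . F r generated by the scalar matrices in F r; it is
   two-sided, and consists of the matrices with entries in F r. *)
Definition mat_ideal_set r : set (mat m) :=
  [set X | exists s : seq (mat m * A),
     (forall p, p \in s -> F r p.2) /\ X = \sum_(p <- s) p.1 * (p.2)%:M].

Lemma mat_ideal_setE r X : mat_ideal_set r X <-> forall i j, F r (X i j).
Proof.
split.
  case=> s [sF ->] i j; rewrite summxE.
  elim: s sF => [|p s IH] sF; first by rewrite big_nil; exact: ideal0.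
  rewrite big_cons; apply: idealD; last first.
    by apply: IH => p' ps; apply: sF; rewrite inE ps orbT.
  rewrite mxE (bigD1 j) //= big1 => [|l /negPf lj]; last by rewrite mxE lj mulr0.
  by rewrite addr0 mxE eqxx; apply: idealMl; apply: sF; rewrite inE eqxx.
move=> XF; exists [seq (delta_mx p.1 p.2 : mat m, X p.1 p.2) | p : 'I_m * 'I_m].
split; first by move=> _ /mapP [p _ ->]; exact: XF.
rewrite big_map big_enum /= [LHS]matrix_sum_delta pair_bigA /=.
apply: eq_bigr => p _; apply/matrixP=> i j; rewrite !mxE.
rewrite (bigD1 j) //= big1 => [|l /negPf lj]; last by rewrite [X in _ * X]mxE lj mulr0.
rewrite addr0 [X in _ = _ * X]mxE eqxx mulr1n mxE.
by rewrite mulr_natr mulr_natl.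
Qed.

Fact mat_ideal0 r : mat_ideal_set r 0.
Proof. by apply/mat_ideal_setE => i j; rewrite mxE; exact: ideal0. Qed.
Fact mat_idealD r X Y :
  mat_ideal_set r X -> mat_ideal_set r Y -> mat_ideal_set r (X + Y).
Proof.
move=> /mat_ideal_setE X0 /mat_ideal_setE Y0; apply/mat_ideal_setE => i j.
by rewrite mxE; exact: idealD.
Qed.
Fact mat_idealMl r Y X : mat_ideal_set r X -> mat_ideal_set r (Y * X).
Proof.
move=> /mat_ideal_setE X0; apply/mat_ideal_setE => i j.
by rewrite mxE; apply: ideal_sum => l _; exact: idealMl.
Qed.
Fact mat_idealMr r Y X : mat_ideal_set r X -> mat_ideal_set r (X * Y).
Proof.
move=> /mat_ideal_setE X0; apply/mat_ideal_setE => i j.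
by rewrite mxE; apply: ideal_sum => l _; exact: idealMr.
Qed.

Definition mat_ideal r : ideal (mat m) :=
  Ideal (@mat_ideal0 r) (@mat_idealD r) (@mat_idealMl r) (@mat_idealMr r).

Fact mat_fil_sub r X : mat_ideal r.+1 X -> mat_ideal r X.
Proof.
move=> /mat_ideal_setE X0; apply/mat_ideal_setE => i j; exact: fil_sub.
Qed.
Definition mat_fil : filtration (mat m) := Filtration mat_fil_sub.

End Filtration.
End Size.

(* E_{a,b} (x) u *)
Definition msingle n (a b : 'I_n) (u : A) : mat n := u *: delta_mx a b.

Fact msingle_filtered F n (a b : 'I_n) : filtered F (mat_fil n F) (msingle a b).
Proof.
split=> [x y|r x Fx]; first by rewrite /msingle scalerBl.
by apply/mat_ideal_setE => i j; rewrite !mxE; exact: idealMr.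
Qed.

(* E_{a,b} (x) u |-> u, with Mat_1 (x) A in place of A *)
Definition mentry n (a b : 'I_n) (X : mat n) : mat 1 := (X a b)%:M.

Fact mentry_filtered F n (a b : 'I_n) :
  filtered (mat_fil n F) (mat_fil 1 F) (mentry a b).
Proof.
split=> [X Y|r X /mat_ideal_setE FX].
  by apply/matrixP=> i j; rewrite !mxE mulrnBl.
apply/mat_ideal_setE => i j; rewrite mxE.
by rewrite mulrb; case: ifP => // _; exact: ideal0.
Qed.

Fact kron_subproof m n (a : 'I_m) (k : 'I_n) : (m * k + a < m * n)%N.
Proof.
have := ltn_ord a; have := ltn_ord k; case: n k => // n k kn am.
rewrite mulnS (leq_trans (_ : _ < m * k + m)%N) ?ltn_add2l //.
by rewrite addnC leq_add2l leq_mul2l -ltnS kn orbT.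
Qed.

(* With indices counted from 0, the m(k-1)+a of the identification
   Mat_m (x) Mat_n = Mat_{mn}. *)
Definition kron_index m n (a : 'I_m) (k : 'I_n) : 'I_(m * n) :=
  Ordinal (kron_subproof a k).

(* T |-> E_{a,b} (x) T under Mat_m (x) Mat_n = Mat_{mn} *)
Definition mblock m n (a b : 'I_m) (T : mat n) : mat (m * n) :=
  \sum_(k < n) \sum_(l < n)
    msingle (kron_index a k) (kron_index b l) (T k l).

Fact mblock_filtered F m n (a b : 'I_m) :
  filtered (mat_fil n F) (mat_fil (m * n) F) (@mblock m n a b).
Proof.
split=> [X Y|r X /mat_ideal_setE FX].
  rewrite /mblock -sumrB; apply: eq_bigr => k _; rewrite -sumrB.
  by apply: eq_bigr => l _; rewrite !mxE (msingle_filtered F _ _).1.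
apply: ideal_sum => k _; apply: ideal_sum => l _.
by apply: (msingle_filtered F _ _).2.
Qed.

(* The bilinear extension of (M1 (x) u, M2 (x) v) |-> tr(M1 M2) phi(u,v). *)
Definition mat_form (phi : A -> A -> K) m (X Y : mat m) : K :=
  \sum_(i < m) \sum_(j < m) phi (X i j) (Y j i).

Lemma mat_formE (phi : A -> A -> K) m (M1 M2 : 'M[K]_m) (u v : A) :
  (forall a b u v, phi (a *~: u) (b *~: v) = a * b * phi u v) ->
  mat_form phi (map_mx (fun a => a *~: u) M1) (map_mx (fun b => b *~: v) M2)
    = \tr (M1 *m M2) * phi u v.
Proof.
move=> phiZ; rewrite /mat_form /mxtrace mulr_suml; apply: eq_bigr => i _.
by rewrite mxE mulr_suml; apply: eq_bigr => j _; rewrite !mxE phiZ.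
Qed.

End Matrices.

(* The algebra with underlying module the direct sum over g in G of copies
   B g of B, with product (b1 g)(b2 h) = (gmul g h b1 b2)(g + h). *)
Record gsystem (K : comNzRingType) (B : lmodType K) (G : zmodType) := GSystem {
  gmul : G -> G -> B -> B -> B;
  gone : B;
  gmulDl : forall g h a b c, gmul g h (a + b) c = gmul g h a c + gmul g h b c;
  gmulDr : forall g h a b c, gmul g h a (b + c) = gmul g h a b + gmul g h a c;
  gmulZl : forall g h k a b, gmul g h (k *: a) b = k *: gmul g h a b;
  gmulZr : forall g h k a b, gmul g h a (k *: b) = k *: gmul g h a b;
  gmul1l : forall h b, gmul 0 h gone b = b;
  gmul1r : forall g a, gmul g 0 a gone = a;
  gmulA : forall g h i a b c,
    gmul g (h + i) a (gmul h i b c) = gmul (g + h) i (gmul g h a b) c }.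

Definition galg (K : comNzRingType) (B : lmodType K) (G : zmodType)
  (S : gsystem B G) := {malg B[G]}.

Section GAlg.
Variables (K : comNzRingType) (B : lmodType K) (G : zmodType) (S : gsystem B G).

Local Notation galg := (galg S).
HB.instance Definition _ := GRing.Zmodule.copy galg {malg B[G]}.

Implicit Types u v w : galg.

Lemma gmul0l g h b : gmul S g h 0 b = 0.
Proof. by rewrite -[X in gmul _ _ _ X](scale0r 0) gmulZl scale0r. Qed.
Lemma gmul0r g h b : gmul S g h b 0 = 0.
Proof. by rewrite -[X in gmul _ _ _ _ X](scale0r 0) gmulZr scale0r. Qed.

Definition galg_mul u v : galg :=
  \sum_(g <- msupp u) \sum_(h <- msupp v) << gmul S g h u@_g v@_h *g g + h >>.

Lemma galg_mulw (d1 d2 : {fset G}) u v :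
  (msupp u `<=` d1)%fset -> (msupp v `<=` d2)%fset ->
  galg_mul u v = \sum_(g <- d1) \sum_(h <- d2) << gmul S g h u@_g v@_h *g g + h >>.
Proof.
move=> le_d1 le_d2; rewrite /galg_mul (big_fset_incl _ le_d1) /=.
  apply/eq_bigr=> k1 _; apply/big_fset_incl => // k _ /mcoeff_outdom ->.
  by rewrite gmul0r monalgU0.
move=> k _ /mcoeff_outdom g1k.
by rewrite big1 => // k' _; rewrite g1k gmul0l monalgU0.
Qed.

Lemma galg_mulUU g h a b :
  galg_mul << a *g g >> << b *g h >> = << gmul S g h a b *g g + h >>.
Proof. by rewrite (galg_mulw msuppU_le msuppU_le) !big_seq_fset1 !mcoeffUU. Qed.

Fact galg_mulDl : left_distributive galg_mul +%R.
Proof.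
move=> g1 g2 g; rewrite [in RHS](galg_mulw (fsubsetUl _ (msupp g2)) (fsubset_refl _)).
rewrite [in RHS](galg_mulw (fsubsetUr (msupp g1) _) (fsubset_refl _)).
rewrite (galg_mulw (msuppD_le _ _) (fsubset_refl _)).
rewrite -big_split /=; apply/eq_bigr=> k1 _.
rewrite -big_split /=; apply/eq_bigr=> k2 _.
by rewrite mcoeffD gmulDl monalgUD.
Qed.
Fact galg_mulDr : right_distributive galg_mul +%R.
Proof.
move=> g g1 g2; rewrite [in RHS](galg_mulw (fsubset_refl _) (fsubsetUl _ (msupp g2))).
rewrite [in RHS](galg_mulw (fsubset_refl _) (fsubsetUr (msupp g1) _)).
rewrite (galg_mulw (fsubset_refl _) (msuppD_le _ _)).
rewrite -big_split /=; apply/eq_bigr=> k1 _.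
rewrite -big_split /=; apply/eq_bigr=> k2 _.
by rewrite mcoeffD gmulDr monalgUD.
Qed.
Fact galg_mul0l : left_zero 0 galg_mul.
Proof. by move=> g; rewrite /galg_mul msupp0 big_seq_fset0. Qed.
Fact galg_mul0r : right_zero 0 galg_mul.
Proof.
by move=> g; rewrite /galg_mul big1 // => k _; rewrite msupp0 big_seq_fset0.
Qed.

Lemma galg_ind (P : galg -> Prop) :
  P 0 -> (forall u v, P u -> P v -> P (u + v)) -> (forall a g, P << a *g g >>) ->
  forall u, P u.
Proof. by move=> P0 PD PU u; rewrite [u]monalgE; elim/big_ind: _. Qed.

Fact galg_mulA : associative galg_mul.
Proof.
move=> u v w; elim/galg_ind: u => [|u u' Hu Hu'|a g].
- by rewrite !galg_mul0l.
- by rewrite !galg_mulDl Hu Hu'.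
elim/galg_ind: v => [|u u' Hu Hu'|b h].
- by rewrite !(galg_mul0l, galg_mul0r).
- by rewrite !(galg_mulDl, galg_mulDr) Hu Hu'.
elim/galg_ind: w => [|u u' Hu Hu'|c i].
- by rewrite !galg_mul0r.
- by rewrite !galg_mulDr Hu Hu'.
by rewrite !galg_mulUU gmulA addrA.
Qed.

Let one : galg := << gone S *g 0 >>.
Fact galg_mul1l : left_id one galg_mul.
Proof.
move=> u; elim/galg_ind: u => [|u u' Hu Hu'|a g].
- by rewrite galg_mul0r.
- by rewrite galg_mulDr Hu Hu'.
by rewrite galg_mulUU gmul1l add0r.
Qed.
Fact galg_mul1r : right_id one galg_mul.
Proof.
move=> u; elim/galg_ind: u => [|u u' Hu Hu'|a g].
- by rewrite galg_mul0l.
- by rewrite galg_mulDl Hu Hu'.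
by rewrite galg_mulUU gmul1r addr0.
Qed.
HB.instance Definition _ := GRing.Zmodule_isPzRing.Build galg
  galg_mulA galg_mul1l galg_mul1r galg_mulDl galg_mulDr.

Let algc (k : K) : galg := << k *: gone S *g 0 >>.
Fact galg_zmod_morphism : zmod_morphism algc.
Proof. by move=> a b; rewrite /algc scalerBl monalgUB. Qed.
Fact galg_monoid_morphism : monoid_morphism algc.
Proof.
split=> [|a b]; rewrite /algc ?scale1r // [RHS]galg_mulUU addr0.
by rewrite gmulZl gmulZr gmul1l scalerA.
Qed.
Fact galg_central k u : algc k * u = u * algc k.
Proof.
elim/galg_ind: u => [|u u' Hu Hu'|a g].
- by rewrite mulr0 mul0r.
- by rewrite mulrDr mulrDl Hu Hu'.
rewrite [LHS]galg_mulUU [RHS]galg_mulUU addr0 add0r.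
by rewrite gmulZl gmulZr gmul1l gmul1r.
Qed.
HB.instance Definition _ := isPzAlg.Build K galg
  galg_zmod_morphism galg_monoid_morphism galg_central.

Lemma galgMUU g h a b :
  (<< a *g g >> : galg) * << b *g h >> = << gmul S g h a b *g g + h >>.
Proof. exact: galg_mulUU. Qed.
Lemma galgE1 : 1 = << gone S *g 0 >> :> galg. Proof. by []. Qed.
Lemma galgZU k a g : k *~: (<< a *g g >> : galg) = << k *: a *g g >>.
Proof. by rewrite /ascale [LHS]galg_mulUU gmulZl gmul1l add0r. Qed.

(* The bilinear form with value psi g h a b at (a g, b h). *)
Definition galg_form (psi : G -> G -> B -> B -> K) u v : K :=
  \sum_(g <- msupp u) \sum_(h <- msupp v) psi g h u@_g v@_h.

Section Form.
Variable psi : G -> G -> B -> B -> K.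
Hypothesis psiL : forall g h k a b c,
  psi g h (k *: a + b) c = k * psi g h a c + psi g h b c.
Hypothesis psiR : forall g h k a b c,
  psi g h a (k *: b + c) = k * psi g h a b + psi g h a c.

Let psi0l g h b : psi g h 0 b = 0.
Proof.
apply: (addrI (psi g h 0 b)); rewrite addr0.
by have := psiL g h 1 0 0 b; rewrite scale1r mul1r addr0 => <-.
Qed.
Let psi0r g h a : psi g h a 0 = 0.
Proof.
apply: (addrI (psi g h a 0)); rewrite addr0.
by have := psiR g h 1 a 0 0; rewrite scale1r mul1r addr0 => <-.
Qed.

Lemma galg_formw (d1 d2 : {fset G}) u v :
  (msupp u `<=` d1)%fset -> (msupp v `<=` d2)%fset ->
  galg_form psi u v = \sum_(g <- d1) \sum_(h <- d2) psi g h u@_g v@_h.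
Proof.
move=> le_d1 le_d2; rewrite /galg_form (big_fset_incl _ le_d1) /=.
  by apply/eq_bigr=> k1 _; apply/big_fset_incl => // k _ /mcoeff_outdom ->.
by move=> k _ /mcoeff_outdom g1k; rewrite big1 // => k' _; rewrite g1k.
Qed.

Lemma galg_formUU g h a b :
  galg_form psi << a *g g >> << b *g h >> = psi g h a b.
Proof. by rewrite (galg_formw msuppU_le msuppU_le) !big_seq_fset1 !mcoeffUU. Qed.

Lemma galg_formDl u u' v :
  galg_form psi (u + u') v = galg_form psi u v + galg_form psi u' v.
Proof.
rewrite [in RHS](galg_formw (fsubsetUl _ (msupp u')) (fsubset_refl _)).
rewrite [in RHS](galg_formw (fsubsetUr (msupp u) _) (fsubset_refl _)).
rewrite (galg_formw (msuppD_le _ _) (fsubset_refl _)).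
rewrite -big_split /=; apply/eq_bigr=> k1 _.
rewrite -big_split /=; apply/eq_bigr=> k2 _.
by rewrite mcoeffD -[X in X + _]scale1r psiL mul1r.
Qed.

Lemma galg_formDr u v v' :
  galg_form psi u (v + v') = galg_form psi u v + galg_form psi u v'.
Proof.
rewrite [in RHS](galg_formw (fsubset_refl _) (fsubsetUl _ (msupp v'))).
rewrite [in RHS](galg_formw (fsubset_refl _) (fsubsetUr (msupp v) _)).
rewrite (galg_formw (fsubset_refl _) (msuppD_le _ _)).
rewrite -big_split /=; apply/eq_bigr=> k1 _.
rewrite -big_split /=; apply/eq_bigr=> k2 _.
by rewrite mcoeffD -[X in X + _]scale1r psiR mul1r.
Qed.

Let form0l v : galg_form psi 0 v = 0.
Proof. by rewrite /galg_form msupp0 big_seq_fset0. Qed.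
Let form0r u : galg_form psi u 0 = 0.
Proof. by rewrite /galg_form big1 // => g _; rewrite msupp0 big_seq_fset0. Qed.

Lemma galg_formZl k u v : galg_form psi (k *~: u) v = k * galg_form psi u v.
Proof.
elim/galg_ind: u => [|u u' Hu Hu'|a g].
- by rewrite /ascale mulr0 form0l mulr0.
- by rewrite ascaleDr !galg_formDl Hu Hu' mulrDr.
elim/galg_ind: v => [|v v' Hv Hv'|b h].
- by rewrite !form0r mulr0.
- by rewrite !galg_formDr Hv Hv' mulrDr.
by rewrite galgZU !galg_formUU -[k *: a]addr0 psiL psi0l addr0.
Qed.

Lemma galg_formZr k u v : galg_form psi u (k *~: v) = k * galg_form psi u v.
Proof.
elim/galg_ind: v => [|u' v Hu Hu'|b h].
- by rewrite /ascale mulr0 form0r mulr0.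
- by rewrite ascaleDr !galg_formDr Hu Hu' mulrDr.
elim/galg_ind: u => [|u' v Hv Hv'|a g].
- by rewrite !form0l mulr0.
- by rewrite !galg_formDl Hv Hv' mulrDr.
by rewrite galgZU !galg_formUU -[k *: b]addr0 psiR psi0r addr0.
Qed.

End Form.

End GAlg.

Definition bilinear_form (K : comNzRingType) (A : pzAlgType K)
    (phi : A -> A -> K) : Prop :=
  (forall k u v w, phi (k *~: u + v) w = k * phi u w + phi v w) /\
  (forall k u v w, phi u (k *~: v + w) = k * phi u v + phi u w).

Lemma galg_form_bilinear (K : comNzRingType) (B : lmodType K) (G : zmodType)
    (S : gsystem B G) (psi : G -> G -> B -> B -> K) :
  (forall g h k a b c, psi g h (k *: a + b) c = k * psi g h a c + psi g h b c) ->
  (forall g h k a b c, psi g h a (k *: b + c) = k * psi g h a b + psi g h a c) ->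
  bilinear_form (galg_form psi : galg S -> galg S -> K).
Proof.
move=> psiL psiR; split=> k u v w.
- by rewrite galg_formDl // galg_formZl.
- by rewrite galg_formDr // galg_formZr.
Qed.

Section GAlgLift.
Variables (K : comNzRingType) (B : lmodType K) (G : zmodType) (S : gsystem B G).
Variables (T : pzAlgType K) (f : G -> B -> T).
Hypothesis fL : forall g k a b, f g (k *: a + b) = k *~: f g a + f g b.
Hypothesis fM : forall g h a b, f (g + h) (gmul S g h a b) = f g a * f h b.
Hypothesis f1 : f 0 (gone S) = 1.

Definition galg_lift (u : galg S) : T := \sum_(g <- msupp u) f g u@_g.

Let fD g a b : f g (a + b) = f g a + f g b.
Proof. by rewrite -[X in X + b]scale1r fL ascale1. Qed.
Let f0 g : f g 0 = 0.
Proof. by apply: (addrI (f g 0)); rewrite -fD !addr0. Qed.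
Let fZ g k a : f g (k *: a) = k *~: f g a.
Proof. by rewrite -[k *: a]addr0 fL f0 addr0. Qed.

Let liftw (d : {fset G}) (u : galg S) : (msupp u `<=` d)%fset ->
  galg_lift u = \sum_(g <- d) f g u@_g.
Proof.
by move=> le; apply: big_fset_incl => // g _ /mcoeff_outdom ->.
Qed.

Lemma galg_liftU a g : galg_lift << a *g g >> = f g a.
Proof. by rewrite (liftw msuppU_le) big_seq_fset1 mcoeffUU. Qed.

Let liftD u v : galg_lift (u + v) = galg_lift u + galg_lift v.
Proof.
rewrite (liftw (msuppD_le _ _)) (liftw (fsubsetUl _ (msupp v))).
rewrite (liftw (fsubsetUr (msupp u) _)) -big_split /=.
by apply: eq_bigr => g _; rewrite mcoeffD fD.
Qed.
Let lift0 : galg_lift 0 = 0.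
Proof. by rewrite /galg_lift msupp0 big_seq_fset0. Qed.

Let liftM u v : galg_lift (u * v) = galg_lift u * galg_lift v.
Proof.
elim/(@galg_ind K B G S): u => [|u u' Hu Hu'|a g].
- by rewrite mul0r lift0 mul0r.
- by rewrite mulrDl !liftD mulrDl Hu Hu'.
elim/(@galg_ind K B G S): v => [|v v' Hv Hv'|b h].
- by rewrite mulr0 lift0 mulr0.
- by rewrite mulrDr !liftD mulrDr Hv Hv'.
by rewrite galgMUU !galg_liftU fM.
Qed.

Lemma galg_lift_alg_hom : alg_hom galg_lift.
Proof.
split; last by split=> //; rewrite galgE1 galg_liftU.
move=> k u v; rewrite liftD; congr (_ + _).
elim/(@galg_ind K B G S): u => [|u u' Hu Hu'|a g].
- by rewrite /ascale mulr0 lift0 mulr0.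
- by rewrite ascaleDr !liftD ascaleDr Hu Hu'.
by rewrite galgZU !galg_liftU fZ.
Qed.

End GAlgLift.

Section AlgHomTheory.
Variables (K : comNzRingType) (A B : pzAlgType K) (f : A -> B).
Hypothesis fh : alg_hom f.

Lemma alg_homD x y : f (x + y) = f x + f y.
Proof. by have := fh.1 1 x y; rewrite !ascale1. Qed.
Lemma alg_hom0 : f 0 = 0.
Proof. by apply: (addrI (f 0)); rewrite -alg_homD !addr0. Qed.
Lemma alg_homZ k x : f (k *~: x) = k *~: f x.
Proof. by have := fh.1 k x 0; rewrite alg_hom0 !addr0. Qed.
Lemma alg_hom1 : f 1 = 1. Proof. exact: fh.2.1. Qed.
Lemma alg_homM x y : f (x * y) = f x * f y. Proof. exact: fh.2.2. Qed.
Lemma alg_homN x : f (- x) = - f x.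
Proof. by apply: (addrI (f x)); rewrite -alg_homD !subrr alg_hom0. Qed.
Lemma alg_homB x y : f (x - y) = f x - f y.
Proof. by rewrite alg_homD alg_homN. Qed.
Lemma alg_hom_sum (J : Type) (r : seq J) (P : pred J) (F : J -> A) :
  f (\sum_(i <- r | P i) F i) = \sum_(i <- r | P i) f (F i).
Proof. exact: (big_morph f alg_homD alg_hom0). Qed.
Lemma alg_homX x n : f (x ^+ n) = f x ^+ n.
Proof.
by elim: n => [|n IH]; rewrite ?expr0 ?alg_hom1 // !exprS alg_homM IH.
Qed.
Lemma alg_hom_alg k : f (alg k) = alg k.
Proof. by rewrite -[alg k]mulr1 alg_homZ alg_hom1 /ascale mulr1. Qed.

End AlgHomTheory.

Lemma alg_hom_galg (K : comNzRingType) (B : lmodType K) (G : zmodType)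
    (S : gsystem B G) (T : pzAlgType K) (f f' : galg S -> T) :
  alg_hom f -> alg_hom f' ->
  (forall a g, f << a *g g >> = f' << a *g g >>) -> f = f'.
Proof.
move=> fh fh' ff'; apply/funext; elim/(@galg_ind K B G S) => [|u v Hu Hv|a g].
- by rewrite !alg_hom0.
- by rewrite !alg_homD // Hu Hv.
- exact: ff'.
Qed.

Section IntPowers.
Variables (K : comUnitRingType) (T : pzAlgType K).

Definition zpow (x x' : T) (k : int) : T :=
  match k with Posz p => x ^+ p | Negz p => x' ^+ p.+1 end.

Section Inverse.
Variables x x' : T.
Hypotheses (xx' : x * x' = 1) (x'x : x' * x = 1).

Lemma zpowS k : zpow x x' (k + 1) = zpow x x' k * x.
Proof.
case: k => p; first by rewrite -PoszD addn1 /= exprSr.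
case: p => [|p]; first by rewrite /= x'x.
rewrite -[RHS]/(x' ^+ p.+2 * x) exprSr -mulrA x'x mulr1.
have -> : Negz p.+1 + 1 = Negz p; last by [].
by rewrite !NegzE -[p.+2]addn1 PoszD opprD subrK.
Qed.

Lemma zpowP k : zpow x x' (k - 1) = zpow x x' k * x'.
Proof. by rewrite -[in RHS](subrK 1 k) zpowS -mulrA xx' mulr1. Qed.

Lemma zpowD k l : zpow x x' (k + l) = zpow x x' k * zpow x x' l.
Proof.
case: l => p.
  elim: p => [|p IH]; first by rewrite addr0 mulr1.
  by rewrite -addn1 PoszD addrA !zpowS IH mulrA.
elim: p => [|p IH]; first by rewrite [Negz 0]NegzE zpowP -[zpow _ _ (- _)]/(x' ^+ 1).
have -> : Negz p.+1 = Negz p - 1 by rewrite !NegzE -[p.+2]addn1 PoszD opprD.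
by rewrite addrA !zpowP IH mulrA.
Qed.

Lemma zpow_comm (c : K) (y : T) : c \is a GRing.unit -> x * y = c *~: (y * x) ->
  forall l, zpow x x' l * y = c ^ l *~: (y * zpow x x' l).
Proof.
move=> uc xy.
have pow (t : T) (e : K) : t * y = e *~: (y * t) ->
    forall p, t ^+ p * y = e ^+ p *~: (y * t ^+ p).
  move=> ty; elim=> [|p IH]; first by rewrite !expr0 mul1r mulr1 ascale1.
  rewrite exprS -mulrA IH -ascaleAr mulrA ty -ascaleAl ascaleA -exprSr.
  by rewrite -mulrA.
case=> p /=; first exact: pow.
rewrite (_ : c ^ Negz p = (c^-1) ^+ p.+1); last by rewrite exprVn NegzE.
apply: pow; have : x' * (x * y) * x' = x' * (c *~: (y * x)) * x' by rewrite xy.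
rewrite mulrA x'x mul1r -ascaleAr -ascaleAl -!mulrA xx' mulr1 => ->.
by rewrite ascaleA mulVr // ascale1.
Qed.

End Inverse.
End IntPowers.

Section HbarAdic.
Variables (C : comNzRingType) (A : pzAlgType (fps C)).

Definition hbar_ideal_set r : set A := [set x | exists y, x = hbar ^+ r *~: y].

Fact hbar_ideal0 r : hbar_ideal_set r 0.
Proof. by exists 0; rewrite /ascale mulr0. Qed.
Fact hbar_idealD r x y :
  hbar_ideal_set r x -> hbar_ideal_set r y -> hbar_ideal_set r (x + y).
Proof. by move=> [x' ->] [y' ->]; exists (x' + y'); rewrite ascaleDr. Qed.
Fact hbar_idealMl r a x : hbar_ideal_set r x -> hbar_ideal_set r (a * x).
Proof. by move=> [x' ->]; exists (a * x'); rewrite ascaleAr. Qed.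
Fact hbar_idealMr r a x : hbar_ideal_set r x -> hbar_ideal_set r (x * a).
Proof. by move=> [x' ->]; exists (x' * a); rewrite ascaleAl. Qed.

Definition hbar_ideal r : ideal A := Ideal
  (@hbar_ideal0 r) (@hbar_idealD r) (@hbar_idealMl r) (@hbar_idealMr r).

Fact hbar_fil_sub r x : hbar_ideal r.+1 x -> hbar_ideal r x.
Proof. by move=> [y ->]; exists (hbar *~: y); rewrite ascaleA -exprSr. Qed.

Definition hbar_fil : filtration A := Filtration hbar_fil_sub.

End HbarAdic.

Section Exponential.
Variables (C : numFieldType) (A : pzAlgType (fps C)) (F : filtration A) (x : A).
Hypothesis xF : forall r, F r (x ^+ r).

Definition exp_sum (r : nat) : A :=
  \sum_(k < r) fpsC (k`!%:R^-1) *~: x ^+ k.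

Fact exp_sum_coherent : coherent F exp_sum.
Proof.
by move=> r; rewrite /exp_sum big_ord_recr /= addrAC subrr add0r; exact: idealMl.
Qed.

Definition cexp : completion F := cmk exp_sum_coherent.

End Exponential.

Definition fps_unit (C : comNzRingType) := {q : fps C | q \is a GRing.unit}.

Section QuantumTorus.
Variable C : comNzRingType.
Local Notation K := (fps C).
Variable q : fps_unit C.

(* D^k1 Z^l1 D^k2 Z^l2 = q^(- l1 k2) D^(k1+k2) Z^(l1+l2) *)
Let dmul (g h : int * int) (a b : K^o) : K^o :=
  a * b * val q ^ (- (g.2 * h.1)).

Let qD := exprzDr (valP q).

Fact dmul1l h (b : K^o) : dmul 0 h 1 b = b.
Proof. by rewrite /dmul mul0r oppr0 expr0z mul1r mulr1. Qed.
Fact dmul1r g (a : K^o) : dmul g 0 a 1 = a.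
Proof. by rewrite /dmul mulr0 oppr0 expr0z !mulr1. Qed.
Fact dmulA g h i (a b c : K^o) :
  dmul g (h + i) a (dmul h i b c) = dmul (g + h) i (dmul g h a b) c.
Proof.
rewrite /dmul /= mulrDr opprD qD mulrDl opprD qD -!mulrA.
by do 2!congr (_ * _); rewrite [RHS]mulrCA; congr (_ * _); rewrite mulrC -mulrA.
Qed.

Definition qtorus_system : gsystem K^o (int * int)%type.
Proof.
apply: (@GSystem K K^o (int * int)%type dmul 1) => //.
- by move=> *; rewrite /dmul !mulrDl.
- by move=> *; rewrite /dmul mulrDr mulrDl.
- by move=> g h k a b; rewrite /dmul /GRing.scale /= !mulrA.
- by move=> g h k a b; rewrite /dmul /GRing.scale /= mulrCA !mulrA.
- exact: dmul1l.
- exact: dmul1r.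
- exact: dmulA.
Defined.

(* The C[[hbar]]-algebra generated by Z^{+-1}, D^{+-1} with D Z = q Z D, on its
   basis D^k Z^l; see qtorus_alg_universal. *)
Definition qtorus_alg := galg qtorus_system.

Definition DZ (k l : int) : qtorus_alg := << 1 *g (k, l) >>.

Lemma DZ_mul k1 l1 k2 l2 :
  DZ k1 l1 * DZ k2 l2 = val q ^ (- (l1 * k2)) *~: DZ (k1 + k2) (l1 + l2).
Proof.
by rewrite [LHS]galgMUU [RHS]galgZU /=; congr << _ *g _ >>; rewrite /dmul /= !mul1r; exact/esym/mulr1.
Qed.

(* Topologically generated: completed in the hbar-adic topology. *)
Definition qtorus := completion (hbar_fil qtorus_alg).

Definition qtorus_D : qtorus := cin _ (DZ 1 0).
Definition qtorus_Z : qtorus := cin _ (DZ 0 1).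

(* The value at x of the Laurent polynomial (1 - X^l) / (1 - X). *)
Definition geom (l : int) (x : K) : K :=
  match l with
  | Posz p => \sum_(j < p) x ^+ j
  | Negz p => - \sum_(j < p.+1) x ^ (- j.+1%:Z)
  end.

Lemma geomP l x : x \is a GRing.unit -> (1 - x) * geom l x = 1 - x ^ l.
Proof.
move=> ux; case: l => p; rewrite /geom.
  rewrite -[RHS]opprB [x ^ _ - 1](subrX1 x p) -mulNr opprB.
  by congr (_ * _).
elim: p => [|p IH]; rewrite big_ord_recr /=.
  rewrite big_ord0 add0r mulrN -mulNr opprB mulrBl mul1r.
  by rewrite -[X in X * _]expr1z -exprzDr // subrr.
rewrite opprD mulrDr {}IH NegzE mulrN -mulNr opprB mulrBl mul1r.
rewrite -[X in X * _]expr1z -exprzDr // NegzE.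
rewrite [in X in _ + (X - _)](_ : 1 - p.+2%:Z = - p.+1%:Z); last first.
  by rewrite -[p.+2]addn1 PoszD opprD addrCA subrr addr0.
by rewrite addrA subrK.
Qed.

Definition qtorus_alg_form : qtorus_alg -> qtorus_alg -> K :=
  galg_form (fun g h (a b : K^o) =>
    if g.2 == - h.2 then
      a * b * (val q ^ (- (g.2 * h.1)) * geom g.2 (val q ^ (g.1 + h.1)))
    else 0).

Lemma qtorus_alg_formP : bilinear_form qtorus_alg_form.
Proof.
have scE (k x : K) : k *: (x : K^o) = k * x :> K by [].
apply: galg_form_bilinear => g h k a b c; case: ifP => _; rewrite ?mulr0 ?addr0 //.
- by rewrite scE !mulrDl !mulrA.
- by rewrite scE mulrDr mulrDl -!mulrA; congr (_ + _); rewrite mulrCA.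
Qed.

End QuantumTorus.

Section Weyl.
Variable C : comNzRingType.
Local Notation K := (fps C).

(* f1(d) x^k f2(d) x^l = f1(d) f2(d - k hbar) x^(k+l) *)
Let wmul (k l : int) (f g : {poly K}) : {poly K} :=
  f * (g \Po ('X - (hbar *~ k)%:P)).

Fact wmulA g h i a b c :
  wmul g (h + i) a (wmul h i b c) = wmul (g + h) i (wmul g h a b) c.
Proof.
rewrite /wmul comp_polyM mulrA; congr (_ * _); rewrite -comp_polyA; congr (_ \Po _).
by rewrite comp_polyB comp_polyX comp_polyC mulrzDr polyCD -addrA -opprD.
Qed.

Definition weyl_system : gsystem {poly K} int.
Proof.
apply: (@GSystem K {poly K} int wmul 1) => //.
- by move=> *; rewrite /wmul !mulrDl.
- by move=> *; rewrite /wmul comp_polyD mulrDr.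
- by move=> *; rewrite /wmul -!scalerAl.
- by move=> *; rewrite /wmul comp_polyZ -scalerAr.
- by move=> h b; rewrite /wmul mulr0z subr0 comp_polyXr mul1r.
- by move=> g a; rewrite /wmul comp_polyC mulr1.
- exact: wmulA.
Defined.

(* The C[[hbar]]-algebra generated by d, x^{+-1} with d x = x (d + hbar), whose
   elements are written as sums of f(d) x^k; see weyl_alg_universal. *)
Definition weyl_alg := galg weyl_system.

Definition wmon (f : {poly K}) (k : int) : weyl_alg := << f *g k >>.

Lemma wmon_mul f k g l :
  wmon f k * wmon g l = wmon (f * (g \Po ('X - (hbar *~ k)%:P))) (k + l).
Proof. exact: galgMUU. Qed.

Definition weyl := completion (hbar_fil weyl_alg).

Definition weyl_d : weyl := cin _ (wmon 'X 0).
Definition weyl_x : weyl := cin _ (wmon 1 1).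

Definition weyl_alg_form : weyl_alg -> weyl_alg -> K :=
  galg_form (fun k l (f g : {poly K}) =>
    if k == - l then
      match k with
      | Posz p => \sum_(a < p)
          f.[a%:R * hbar] * g.[(a%:R - p%:R) * hbar]
      | Negz p' => let p := p'.+1 in - \sum_(a < p)
          g.[a%:R * hbar] * f.[(a%:R - p%:R) * hbar]
      end
    else 0).

Lemma weyl_alg_formP : bilinear_form weyl_alg_form.
Proof.
apply: galg_form_bilinear => k l c f g e; case: ifP => _; rewrite ?mulr0 ?addr0 //;
  case: k => p /=; rewrite ?mulrN -?opprD; try congr (- _);
  rewrite mulr_sumr -big_split; apply: eq_bigr => a _ /=;
  rewrite hornerD hornerZ; first [rewrite [LHS]mulrDl|rewrite [LHS]mulrDr];
  congr (_ + _); by [rewrite -mulrA | rewrite mulrCA].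
Qed.

Definition weyl_adic : filtration weyl :=
  adic (gen [set weyl_d; alg (hbar : K)]).

Definition weyl_hat (m : nat) := completion (mat_fil m weyl_adic).

End Weyl.

Section UniversalProperties.
Variable C : comNzRingType.
Local Notation K := (fps C).

Section QTorus.
Variable q : fps_unit C.
Let uq : val q \is a GRing.unit := valP q.

Lemma DZ_relations :
  [/\ DZ q 1 0 * DZ q (-1) 0 = 1, DZ q (-1) 0 * DZ q 1 0 = 1,
      DZ q 0 1 * DZ q 0 (-1) = 1, DZ q 0 (-1) * DZ q 0 1 = 1 &
      DZ q 1 0 * DZ q 0 1 = val q *~: (DZ q 0 1 * DZ q 1 0)].
Proof.
split; rewrite !DZ_mul ?mulr0 ?mul0r ?oppr0 ?expr0z ?ascale1 //.
by rewrite ascaleA mulr1 exprN1 mulrV // ascale1.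
Qed.

Variables (T : pzAlgType K) (d d' z z' : T).
Hypotheses (dd' : d * d' = 1) (d'd : d' * d = 1).
Hypotheses (zz' : z * z' = 1) (z'z : z' * z = 1).
Hypothesis dz : d * z = val q *~: (z * d).

Let dpw := zpow d d'.
Let zpw := zpow z z'.

Let zd k l : zpw l * dpw k = val q ^ (- (l * k)) *~: (dpw k * zpw l).
Proof.
have zd1 : z * d = (val q)^-1 *~: (d * z).
  by rewrite dz ascaleA mulVr // ascale1.
have uq' : (val q)^-1 \is a GRing.unit by rewrite unitrV.
have H := zpow_comm zz' z'z uq' zd1 l.
have dzl : d * zpw l = val q ^ l *~: (zpw l * d).
  by rewrite /zpw H ascaleA exprz_inv -exprzDr // subrr expr0z ascale1.
have ul : val q ^ l \is a GRing.unit by exact: unitrXz.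
rewrite (zpow_comm dd' d'd ul dzl k) ascaleA exprz_exp -exprzDr //.
by rewrite addNr expr0z ascale1.
Qed.

Lemma qtorus_alg_universal : exists f, unique
  (fun f : qtorus_alg q -> T => [/\ alg_hom f, f (DZ q 1 0) = d & f (DZ q 0 1) = z]) f.
Proof.
pose F (g : int * int) (a : K^o) : T := (a : K) *~: (dpw g.1 * zpw g.2).
have FL g k a b : F g (k *: a + b) = k *~: F g a + F g b.
  by rewrite /F ascaleDl ascaleA.
have FM g h a b : F (g + h) (gmul (qtorus_system q) g h a b) = F g a * F h b.
  rewrite /F /dpw /zpw !zpowD // -/dpw -/zpw -ascaleAl -ascaleAr ascaleA.
  rewrite !mulrA -[dpw g.1 * zpw g.2 * _]mulrA zd -ascaleAr -!ascaleAl ascaleA.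
  by rewrite !mulrA.
have F1 : F 0 (gone (qtorus_system q)) = 1.
  by rewrite /F ascale1 /dpw /zpw /= !expr0 mulr1.
exists (galg_lift F); split.
  split; first exact: galg_lift_alg_hom.
    by rewrite galg_liftU // /F ascale1 mulr1.
  by rewrite galg_liftU // /F ascale1 mul1r.
move=> f [fh fd fz]; apply: (alg_hom_galg (galg_lift_alg_hom FL FM F1) fh).
have [r1 r2 r3 r4 _] := DZ_relations.
have inv (x x' y y' : T) : x' * x = 1 -> x * y' = 1 -> y' = x'.
  by move=> e1 e2; rewrite -[y']mul1r -e1 -mulrA e2 mulr1.
have fd' : f (DZ q (-1) 0) = d'.
  by apply: (inv d) => //; rewrite -fd -alg_homM // r1 alg_hom1.
have fz' : f (DZ q 0 (-1)) = z'.
  by apply: (inv z) => //; rewrite -fz -alg_homM // r3 alg_hom1.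
have zpE (x x' : qtorus_alg q) k :
    f (zpow x x' k) = zpow (f x) (f x') k.
  by case: k => p; rewrite /= alg_homX.
have NegzS p : Negz p.+1 = Negz p - 1.
  by rewrite !NegzE -[p.+2]addn1 PoszD opprD.
have DZ1 k : DZ q k 0 = zpow (DZ q 1 0) (DZ q (-1) 0) k.
  case: k => p; elim: p => [|p IH]; try by [].
  - by rewrite -addn1 PoszD (zpowS r2) -IH DZ_mul mul0r oppr0 expr0z ascale1.
  - by rewrite NegzS (zpowP r1 r2) -IH DZ_mul mul0r oppr0 expr0z ascale1.
have DZ2 k : DZ q 0 k = zpow (DZ q 0 1) (DZ q 0 (-1)) k.
  case: k => p; elim: p => [|p IH]; try by [].
  - by rewrite -addn1 PoszD (zpowS r4) -IH DZ_mul mulr0 oppr0 expr0z ascale1.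
  - by rewrite NegzS (zpowP r3 r4) -IH DZ_mul mulr0 oppr0 expr0z ascale1.
move=> a [k l]; rewrite galg_liftU // /F /=.
have -> : << a *g (k, l) >> = (a : K) *~: (DZ q k 0 * DZ q 0 l).
  rewrite DZ_mul mul0r oppr0 expr0z ascale1 addr0 add0r galgZU.
  by congr << _ *g _ >>; exact/esym/mulr1.
by rewrite (alg_homZ fh) (alg_homM fh) DZ1 DZ2 !zpE fd fd' fz fz'.
Qed.

End QTorus.

Section WeylAlg.

Lemma weyl_alg_relations :
  [/\ wmon 1 1 * wmon 1 (-1) = 1 :> weyl_alg C,
      wmon 1 (-1) * wmon 1 1 = 1 :> weyl_alg C &
      wmon 'X 0 * wmon 1 1 = wmon 1 1 * (wmon 'X 0 + alg hbar) :> weyl_alg C].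
Proof.
split; try by rewrite wmon_mul comp_polyC mulr1.
rewrite mulrDr !wmon_mul mulr0z subr0 comp_polyX !mul1r mulr1z comp_polyC ?mulr1.
rewrite -[gone _]/(1%:P : {poly K}) comp_polyZ comp_polyC add0r addr0.
by rewrite -mul_polyC mulr1 /wmon -monalgUD subrK.
Qed.

Variables (T : pzAlgType K) (d x x' : T).
Hypotheses (xx' : x * x' = 1) (x'x : x' * x = 1).
Hypothesis dx : d * x = x * (d + alg hbar).

Definition peval (e : T) (f : {poly K}) : T :=
  \sum_(i < size f) f`_i *~: e ^+ i.

Let pevalw e n (f : {poly K}) : (size f <= n)%N ->
  peval e f = \sum_(i < n) f`_i *~: e ^+ i.
Proof.
move=> fn; rewrite /peval (big_ord_widen n (fun i => f`_i *~: e ^+ i)) //.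
rewrite big_mkcond; apply: eq_bigr => i _; case: ltnP => // fi.
by rewrite nth_default // /ascale rmorph0 mul0r.
Qed.

Lemma pevalL e k f g : peval e (k *: f + g) = k *~: peval e f + peval e g.
Proof.
pose n := maxn (size f) (size g).
rewrite !(@pevalw e n) ?leq_maxl ?leq_maxr //; last first.
  apply: leq_trans (size_polyD _ _) _; rewrite geq_max leq_maxr andbT.
  exact: leq_trans (size_scale_leq _ _) (leq_maxl _ _).
rewrite [X in _ = X + _](big_morph (ascale k) (ascaleDr k) (mulr0 _)) -big_split /=.
by apply: eq_bigr => i _; rewrite coefD coefZ ascaleDl ascaleA.
Qed.

Let pevalD e f g : peval e (f + g) = peval e f + peval e g.
Proof. by rewrite -[X in X + g]scale1r pevalL ascale1. Qed.
Let peval0 e : peval e 0 = 0.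
Proof. by rewrite /peval size_poly0 big_ord0. Qed.
Lemma pevalC e c : peval e c%:P = alg c.
Proof.
by rewrite (@pevalw e 1) ?size_polyC_leq1 // big_ord1 coefC /ascale mulr1.
Qed.
Lemma pevalMX e f : peval e (f * 'X) = peval e f * e.
Proof.
rewrite (@pevalw e (size f).+1); last first.
  by apply: leq_trans (size_polyMleq _ _) _; rewrite size_polyX addn2.
rewrite big_ord_recl coefMX /ascale rmorph0 mul0r add0r /peval mulr_suml.
by apply: eq_bigr => i _; rewrite coefMX /ascale -mulrA -exprSr.
Qed.
Lemma pevalX e : peval e 'X = e.
Proof. by rewrite -['X]mul1r pevalMX -polyC1 pevalC rmorph1 mul1r. Qed.

Lemma pevalM e f g : peval e (f * g) = peval e f * peval e g.
Proof.
elim/poly_ind: g => [|g c IH]; first by rewrite mulr0 peval0 mulr0.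
rewrite mulrDr pevalD mulrA pevalMX IH pevalD pevalMX pevalC mulrDr mulrA.
congr (_ + _); rewrite mulrC mul_polyC -[_ *: f]addr0 pevalL peval0 addr0.
by rewrite -alg_central.
Qed.

Let xpow := zpow x x'.

Let xd k : xpow k * d = (d - alg (hbar *~ k)) * xpow k.
Proof.
have xd1 : x * d = (d - alg hbar) * x.
  by rewrite mulrBl dx mulrDr alg_central addrK.
have x'd1 : x' * d = (d + alg hbar) * x'.
  have : x' * (d * x) * x' = x' * (x * (d + alg hbar)) * x' by rewrite dx.
  by rewrite !mulrA x'x mul1r -!mulrA xx' mulr1.
have step y y' (c c' : K) : y * d = (d - alg c) * y -> y' * d = (d - alg c') * y' ->
    (y * y') * d = (d - alg (c + c')) * (y * y').
  move=> yd y'd; rewrite -mulrA y'd mulrA mulrBr yd -alg_central -mulrBl.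
  by rewrite rmorphD opprD addrA mulrA.
have alg0 : alg (0 : K) = 0 :> T by exact: rmorph0.
rewrite /xpow; case: k => p.
  elim: p => [|p IH]; first by rewrite mulr0z alg0 subr0 /= expr0 mulr1 mul1r.
  by rewrite -addn1 PoszD (zpowS x'x) mulrzDr mulr1z; exact: step.
elim: p => [|p IH].
  by rewrite /= expr1 x'd1 NegzE mulrNz mulr1z rmorphN opprK.
have -> : Negz p.+1 = Negz p - 1 by rewrite !NegzE -[p.+2]addn1 PoszD opprD.
rewrite (zpowP xx' x'x) mulrzBr mulr1z; apply: step => //.
by rewrite x'd1 rmorphN opprK.
Qed.

Let xf k f : xpow k * peval d f = peval d (f \Po ('X - (hbar *~ k)%:P)) * xpow k.
Proof.
elim/poly_ind: f => [|f c IH]; first by rewrite comp_poly0 peval0 mul0r mulr0.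
rewrite comp_poly_MXaddC !pevalD !pevalM !pevalC pevalX mulrDr mulrDl mulrA IH.
rewrite alg_central; congr (_ + _); rewrite -!mulrA xd; congr (_ * _).
by rewrite -polyCN pevalD pevalX pevalC rmorphN.
Qed.

Lemma weyl_alg_universal : exists h, unique
  (fun h : weyl_alg C -> T =>
     [/\ alg_hom h, h (wmon 'X 0) = d & h (wmon 1 1) = x]) h.
Proof.
pose F (k : int) (f : {poly K}) : T := peval d f * xpow k.
have FL g k a b : F g (k *: a + b) = k *~: F g a + F g b.
  by rewrite /F pevalL mulrDl ascaleAl.
have FM g h a b : F (g + h) (gmul (weyl_system C) g h a b) = F g a * F h b.
  rewrite /F /xpow zpowD // -/xpow pevalM !mulrA; congr (_ * _).
  by rewrite -!mulrA xf.
have F1 : F 0 (gone (weyl_system C)) = 1.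
  by rewrite /F -[gone _]/(1%:P) pevalC rmorph1 mul1r.
exists (galg_lift F); split.
  split; first exact: galg_lift_alg_hom.
    by rewrite galg_liftU // /F pevalX mulr1.
  by rewrite galg_liftU // /F -[1]/(1%:P) pevalC rmorph1 mul1r.
move=> f [fh fd fx]; apply: (alg_hom_galg (galg_lift_alg_hom FL FM F1) fh).
have [r1 r2 _] := weyl_alg_relations.
have fx' : f (wmon 1 (-1)) = x'.
  by rewrite -[LHS]mul1r -x'x -mulrA -[X in x' * (X * _)]fx -(alg_homM fh) r1
    (alg_hom1 fh) mulr1.
have NegzS p : Negz p.+1 = Negz p - 1.
  by rewrite !NegzE -[p.+2]addn1 PoszD opprD.
have wx k : wmon 1 k = zpow (wmon 1 1) (wmon 1 (-1)) k :> weyl_alg C.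
  case: k => p; elim: p => [|p IH]; try by [].
  - by rewrite -addn1 PoszD (zpowS r2) -IH wmon_mul comp_polyC mulr1.
  - by rewrite NegzS (zpowP r1 r2) -IH wmon_mul comp_polyC mulr1.
have fp g : f (wmon g 0) = peval d g.
  elim/poly_ind: g => [|g c IH].
    by rewrite peval0 /wmon monalgU0 (alg_hom0 fh).
  rewrite pevalD pevalMX pevalC -IH -fd -(alg_homM fh) wmon_mul.
  rewrite mulr0z subr0 comp_polyXr addr0 -(alg_hom_alg fh) -(alg_homD fh).
  by congr f; rewrite -[c%:P]alg_polyC /wmon monalgUD.
move=> g k; rewrite galg_liftU // /F.
have -> : << g *g k >> = wmon g 0 * wmon 1 k :> weyl_alg C.
  by rewrite wmon_mul comp_polyC mulr1 add0r.
rewrite (alg_homM fh) fp wx; congr (_ * _).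
by rewrite /xpow; case: k => p; rewrite /= (alg_homX fh) ?fx ?fx'.
Qed.

End WeylAlg.

End UniversalProperties.

(* Continuity of an additive map for the linear topologies with bases of
   neighbourhoods of 0 given by NU and NV. *)
Definition lin_continuous (U V : zmodType) (NU : nat -> set U) (NV : nat -> set V)
    (f : U -> V) : Prop :=
  forall s, exists r, forall x y, NU r (x - y) -> NV s (f x - f y).

Definition comp_nbhs (K : comNzRingType) (A : pzAlgType K) (F : filtration A)
  (r : nat) : set (completion F) := [set X | cproj X r = 0].

Section CentralExtension.
Variables (C : comNzRingType) (A : pzAlgType (fps C)) (F : filtration A).
Local Notation K := (fps C).
Variable phi : A -> A -> K.

(* c is the hbar-adic limit of phi x y as x tends to X and y tends to Y. *)
Definition is_form_lim (X Y : completion F) (c : K) : Prop :=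
  forall N, exists r, forall x y : A,
    qpi (F r) x = cproj X r -> qpi (F r) y = cproj Y r -> fps_cong N (phi x y) c.

(* The extension of phi to the completion by continuity; see cont_extP. *)
Definition cont_ext (X Y : completion F) : K := xget 0 [set c | is_form_lim X Y c].

Definition central_ext := (completion F * K^o)%type.

Definition central_c : central_ext := (0, 1).
Definition central_in (X : completion F) : central_ext := (X, 0).

Definition central_bracket (u v : central_ext) : central_ext :=
  (u.1 * v.1 - v.1 * u.1, cont_ext u.1 v.1).

Definition central_nbhs (r : nat) : set central_ext :=
  [set u | cproj u.1 r = 0 /\ fps_cong r u.2 0].

Lemma cproj_repr_le (Z : completion F) u t : (u <= t)%N ->
  qpi (F u) (qrepr (cproj Z t)) = cproj Z u.
Proof.
move=> /subnK <-; elim: (t - u)%N => [|d IH]; first exact: qreprK.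
rewrite -IH; apply/qpiP; apply: (@fil_le _ F u (d + u)); first exact: leq_addl.
exact: crepr_coherent.
Qed.

Lemma is_form_lim_uniq X Y c d : is_form_lim X Y c -> is_form_lim X Y d -> c = d.
Proof.
move=> cl dl; apply/fpsP=> i; have [r rP] := cl i.+1; have [s sP] := dl i.+1.
pose t := maxn r s; pose x := qrepr (cproj X t); pose y := qrepr (cproj Y t).
have rt : (r <= t)%N by exact: leq_maxl.
have st : (s <= t)%N by exact: leq_maxr.
rewrite -(rP x y) ?cproj_repr_le //.
by rewrite (sP x y) ?cproj_repr_le.
Qed.

Hypothesis phiB : forall x x' y, phi (x - x') y = phi x y - phi x' y.
Hypothesis phiBr : forall x y y', phi x (y - y') = phi x y - phi x y'.
Hypothesis phi_cont : forall N, exists r, forall x y,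
  F r x -> fps_cong N (phi x y) 0 /\ fps_cong N (phi y x) 0.

Lemma cont_extP X Y : is_form_lim X Y (cont_ext X Y).
Proof.
suff [c cP] : exists c, is_form_lim X Y c.
  exact: (xgetI 0 (cP : [set c | is_form_lim X Y c] c)).
have [rho rhoP] := choice phi_cont.
pose x0 r := qrepr (cproj X r); pose y0 r := qrepr (cproj Y r).
exists (Fps (fun i => fcoef (phi (x0 (rho i.+1)) (y0 (rho i.+1))) i)) => N.
exists (\max_(i < N) rho i.+1)%N => x y Xx Yy i iN /=.
set t := rho i.+1; have tr : (t <= \max_(i < N) rho i.+1)%N.
  exact: (leq_bigmax (Ordinal iN)).
have mem (Z : completion F) z : qpi (F (\max_(i < N) rho i.+1)%N) z =
    cproj Z (\max_(i < N) rho i.+1)%N -> F t (z - qrepr (cproj Z t)).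
  move=> Zz; apply/qpiP; rewrite qreprK -(cproj_repr_le _ tr).
  by apply/qpiP; apply: (fil_le tr); apply/qpiP; rewrite qreprK.
have /eqP := (rhoP i.+1 _ y (mem _ _ Xx)).1 i (ltnSn i).
rewrite phiB fcoefD fcoefN fcoef0 subr_eq0 => /eqP ->.
have /eqP := (rhoP i.+1 _ (x0 t) (mem _ _ Yy)).2 i (ltnSn i).
by rewrite phiBr fcoefD fcoefN fcoef0 subr_eq0 => /eqP ->.
Qed.

Lemma cont_ext_in x y : cont_ext (cin F x) (cin F y) = phi x y.
Proof.
apply: is_form_lim_uniq (cont_extP _ _) _ => N.
have [r rP] := phi_cont N; exists r => x' y' /qpiP xx' /qpiP yy' i iN.
have /eqP := (rP _ y' xx').1 i iN.
rewrite phiB fcoefD fcoefN fcoef0 subr_eq0 => /eqP ->.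
have /eqP := (rP _ x yy').2 i iN.
by rewrite phiBr fcoefD fcoefN fcoef0 subr_eq0 => /eqP ->.
Qed.

End CentralExtension.

Section HbarContinuity.
Variable C : comNzRingType.
Local Notation K := (fps C).

Lemma hbar_mulS (f : K) i : fcoef (hbar * f) i = if i is j.+1 then fcoef f j else 0.
Proof.
rewrite fcoefM; case: i => [|i]; first by rewrite big_ord1 /= mul0r.
rewrite 2!big_ord_recl /= mul0r add0r mul1r subSS subn0 big1 ?addr0 //.
by move=> j _; rewrite mul0r.
Qed.

Lemma hbar_exp_cong r (f : K) : fps_cong r (hbar ^+ r * f) 0.
Proof.
elim: r => [//|r IH] i; rewrite exprS -mulrA hbar_mulS.
by case: i => // i ir; exact: IH.
Qed.

Variables (A : pzAlgType K) (phi : A -> A -> K).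
Hypothesis phiP : bilinear_form phi.

Lemma bilinear_formBl x x' y : phi (x - x') y = phi x y - phi x' y.
Proof.
have {2}-> : x = 1 *~: (x - x') + x' by rewrite ascale1 subrK.
by rewrite phiP.1 mul1r addrK.
Qed.
Lemma bilinear_formBr x y y' : phi x (y - y') = phi x y - phi x y'.
Proof.
have {2}-> : y = 1 *~: (y - y') + y' by rewrite ascale1 subrK.
by rewrite phiP.2 mul1r addrK.
Qed.

Lemma bilinear_form_hbar_cont N : exists r, forall x y,
  hbar_fil A r x -> fps_cong N (phi x y) 0 /\ fps_cong N (phi y x) 0.
Proof.
exists N => _ y [x ->]; split.
- have -> : phi (hbar ^+ N *~: x) y = hbar ^+ N * phi x y; last exact: hbar_exp_cong.
  by rewrite -[_ *~: x]addr0 phiP.1 -[in phi 0 _](subrr 0) bilinear_formBl subrr addr0.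
- have -> : phi y (hbar ^+ N *~: x) = hbar ^+ N * phi y x; last exact: hbar_exp_cong.
  by rewrite -[_ *~: x]addr0 phiP.2 -[in phi _ 0](subrr 0) bilinear_formBr subrr addr0.
Qed.

Lemma cont_ext_hbarP X Y :
  is_form_lim (F := hbar_fil A) phi X Y (cont_ext phi X Y).
Proof.
by apply: cont_extP; [exact: bilinear_formBl|exact: bilinear_formBr|
  exact: bilinear_form_hbar_cont].
Qed.

Lemma cont_ext_hbar_in x y :
  cont_ext phi (cin (hbar_fil A) x) (cin (hbar_fil A) y) = phi x y.
Proof.
by apply: cont_ext_in; [exact: bilinear_formBl|exact: bilinear_formBr|
  exact: bilinear_form_hbar_cont].
Qed.

End HbarContinuity.

Definition lie_hom (K : comNzRingType) (U V : lmodType K)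
    (brU : U -> U -> U) (brV : V -> V -> V) (f : U -> V) : Prop :=
  linear f /\ forall x y, f (brU x y) = brV (f x) (f y).

Section Upsilon.
Variable C : numFieldType.
Local Notation K := (fps C).

Section Source.
Variables (n : nat) (w : C) (q : fps_unit C).

Definition qtorus_adic : filtration (qtorus q) :=
  adic (gen [set qtorus_D q ^+ n - 1; alg (val q - fpsC w)]).

Definition qtorus_hat (m : nat) := completion (mat_fil m qtorus_adic).

Definition qtorus_form : qtorus q -> qtorus q -> K :=
  cont_ext (@qtorus_alg_form C q).

Lemma qtorus_form_in u v : qtorus_form (cin _ u) (cin _ v) = qtorus_alg_form u v.
Proof. exact/cont_ext_hbar_in/qtorus_alg_formP. Qed.

Definition qtorus_ext (m : nat) := central_ext (mat_fil m qtorus_adic).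

Definition qtorus_bracket (m : nat) :
    qtorus_ext m -> qtorus_ext m -> qtorus_ext m :=
  central_bracket (@mat_form K (qtorus q) qtorus_form m).

End Source.

Definition weyl_form : weyl C -> weyl C -> K := cont_ext (@weyl_alg_form C).

Lemma weyl_form_in u v : weyl_form (cin _ u) (cin _ v) = weyl_alg_form u v.
Proof. exact/cont_ext_hbar_in/weyl_alg_formP. Qed.

Definition weyl_ext (m : nat) := central_ext (mat_fil m (weyl_adic C)).

Definition weyl_bracket (m : nat) : weyl_ext m -> weyl_ext m -> weyl_ext m :=
  central_bracket (@mat_form K (weyl C) weyl_form m).

Fact weyl_nd_adic (n r : nat) : weyl_adic C r ((n%:R * weyl_d C) ^+ r).
Proof.
by apply: ideal_pow_expr; apply: idealMl; apply: sub_gen; left.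
Qed.

Definition weyl_exp (n : nat) : completion (weyl_adic C) :=
  cexp (weyl_nd_adic n).

Definition weyl_single n (a b : 'I_n) :
    completion (weyl_adic C) -> weyl_hat C n :=
  cmap (msingle_filtered (weyl_adic C) a b).

(* With indices counted from 0, q^(n-a) becomes q^(n-1-a). *)
Definition upsilon_D (q : fps_unit C) n : weyl_hat C n :=
  \sum_(a < n) weyl_single a a (val q ^+ (n.-1 - a) *: weyl_exp n).

Definition upsilon_Z n : weyl_hat C n :=
  \sum_(a < n) \sum_(b < n)
    (if b == a.+1 :> nat then weyl_single a b 1
     else if (a == n.-1 :> nat) && (b == 0%N :> nat)
          then weyl_single a b (cin _ (weyl_x C)) else 0).

Section Extend.
Variables (n : nat) (w : C) (q : fps_unit C).

Definition qtorus_in m (X : mat (qtorus q) m) : qtorus_hat n w q m := cin _ X.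

Definition is_upsilon1 (Y : qtorus_hat n w q 1 -> weyl_hat C n) : Prop :=
  [/\ alg_hom Y,
      lin_continuous (@comp_nbhs _ _ _) (@comp_nbhs _ _ _) Y,
      Y (qtorus_in (qtorus_D q)%:M) = upsilon_D q n &
      Y (qtorus_in (qtorus_Z q)%:M) = upsilon_Z n].

(* E_{a,b} (x) A |-> E_{a,b} (x) Y(A) *)
Definition upsilon_mn (Y : qtorus_hat n w q 1 -> weyl_hat C n) m
    (X : qtorus_hat n w q m) : weyl_hat C (m * n) :=
  \sum_(a < m) \sum_(b < m)
    cmap (mblock_filtered (weyl_adic C) n a b)
      (Y (cmap (mentry_filtered (qtorus_adic n w q) a b) X)).

Definition is_upsilon_bar m (Ym : qtorus_hat n w q m -> weyl_hat C (m * n))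
    (Z : qtorus_ext n w q m -> weyl_ext (m * n)) : Prop :=
  [/\ lie_hom (@qtorus_bracket n w q m) (@weyl_bracket (m * n)) Z,
      lin_continuous (@central_nbhs _ _ _) (@central_nbhs _ _ _) Z,
      Z (central_c _) = central_c _ &
      forall A : mat (qtorus q) m,
        Z (central_in (qtorus_in A)) = central_in (Ym (qtorus_in A))].

End Extend.

Definition root_times_exp (n : nat) (w : C) (hn : (0 < n)%N) (hw : w ^+ n = 1) :
  fps_unit C :=
  exist (fun q : fps C => q \is a GRing.unit) _ (root_exp_unit hn hw).

End Upsilon.

(* Main.v *)
(** On the basis D^k Z^l the homomorphism is explicit: the row a of the image
    has the single entry q^(k(n-1-a)) e^(nk d) x^s in column b, where
    a + l = b + n s and rows are counted from 0; the relations reduce to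
    x^s e^(c d) = e^(-c s hbar) e^(c d) x^s and q^n = e^(n hbar).  The cocycles
    agree because i = n-1-a + n j runs exactly once through 0, ..., l-1 when a
    runs over the rows and j over 0, ..., s-1.  In both algebras the powers of
    the ideal have the form of the right ideals generated by the t^i hbar^(r-i),
    with t = d on one side and, on the other,
      t = delta = (D^n - 1) / n^2 - hbar / n sum_a (n-1-a) e_a,
    the e_a being the idempotents of C[D]/(D^n - 1) if the root of unity is
    primitive.  Since delta, e_a and Z map to d, E_{a,a} and the shift up to terms of
    higher order, E_{a,b} f(d) x^s |-> f(delta) e_a Z^(b-a+ns) inverts the
    homomorphism on the associated graded level, and completeness does the rest. *)
From HB Require Import structures.
Require Import Defs.
From mathcomp Require Import all_boot all_order all_algebra.
From mathcomp Require Import all_classical.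
From mathcomp Require Import reals complex finmap.
From mathcomp.multinomials Require Import monalg.
From mathcomp Require Import ring zify.
Set Implicit Arguments.
Unset Strict Implicit.
Unset Printing Implicit Defensive.
Import Order.TTheory GRing.Theory Num.Theory.
Local Open Scope classical_set_scope.
Local Open Scope ring_scope.

(** * Formal power series *)

(** Each side carries two nested completions: the hbar-adic one behind topological generation, and
    the adic one of the statement. Computation is possible only with finite sums, so orders must be
    comparable before and after completing: an element of order r in the hbar-adic completion
    differs from an uncompleted element of order r by a multiple of hbar^r, which has order r
    itself. The candidate inverse is linear but not multiplicative. Two facts about it suffice.
    Followed by the homomorphism, it preserves leading terms; and each element of order r is one of
    its values modulo order r+1. The second fact replaces the knowledge of a basis of the graded
    algebra: injectivity follows because the coefficients of such a value can be read off from its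
    image. The first fact forces delta to agree with d up to order 2: the error in delta, multiplied
    by an element of order r, must have order r+2. Now (D^n - 1) / n^2 differs from d in row a by
    (n-1-a) hbar / n, a term of the same order as d that varies with the row. Only an element that
    tells the rows apart can remove it, whence the idempotents in delta and the need for a primitive
    root. *)

Section FpsCongruence.
Variable C : comNzRingType.
Implicit Types f g : fps C.

Lemma fps_congP N f : fps_cong N f 0 <-> exists g, f = hbar ^+ N * g.
Proof.
split=> [f0|[g ->]]; last exact: hbar_exp_cong.
exists (Fps (fun i => fcoef f (i + N))); apply/fpsP=> i.
have coefX m g j : fcoef (hbar ^+ m * g) (j + m) = fcoef g j.
  elim: m => [|m IH]; first by rewrite mul1r addn0.
  by rewrite exprS -mulrA addnS hbar_mulS.
have [iN|Ni] := ltnP i N; first by rewrite f0 // hbar_exp_cong.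
by rewrite -(subnK Ni) coefX.
Qed.

Lemma fps_congB N f g : fps_cong N f g <-> fps_cong N (f - g) 0.
Proof.
split=> fg i iN; first by rewrite fcoefD fcoefN fg // subrr.
by apply/eqP; rewrite -subr_eq0 -fcoefN -fcoefD fg.
Qed.

Lemma fps_congMl N f g : fps_cong N g 0 -> fps_cong N (f * g) 0.
Proof. by move=> /fps_congP [h ->]; rewrite mulrCA; exact: hbar_exp_cong. Qed.

Lemma fps_congM M N f g :
  fps_cong M f 0 -> fps_cong N g 0 -> fps_cong (M + N) (f * g) 0.
Proof.
move=> /fps_congP [f' ->] /fps_congP [g' ->].
by rewrite mulrACA -exprD; exact: hbar_exp_cong.
Qed.

Lemma fps_congD N f f' g g' :
  fps_cong N f f' -> fps_cong N g g' -> fps_cong N (f + g) (f' + g').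
Proof. by move=> ff gg i iN; rewrite !fcoefD ff ?gg. Qed.

Lemma fps_congN N f f' : fps_cong N f f' -> fps_cong N (- f) (- f').
Proof. by move=> ff i iN; rewrite !fcoefN ff. Qed.

Lemma fps_cong_sum N (I : Type) (r : seq I) (P : pred I) (F G : I -> fps C) :
  (forall i, P i -> fps_cong N (F i) (G i)) ->
  fps_cong N (\sum_(i <- r | P i) F i) (\sum_(i <- r | P i) G i).
Proof.
move=> FG; apply: (big_ind2 (fun f g => fps_cong N f g)) => //.
by move=> f f' g g'; exact: fps_congD.
Qed.

Lemma fps_cong_sum0 N (I : Type) (r : seq I) (P : pred I) (F : I -> fps C) :
  (forall i, P i -> fps_cong N (F i) 0) -> fps_cong N (\sum_(i <- r | P i) F i) 0.
Proof.
move=> F0; have := @fps_cong_sum N I r P F (fun=> 0) F0.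
by rewrite [X in fps_cong _ _ X]big1.
Qed.

Lemma fps_congMM N f f' g g' :
  fps_cong N f f' -> fps_cong N g g' -> fps_cong N (f * g) (f' * g').
Proof.
move=> /fps_congB ff /fps_congB gg; apply/fps_congB.
have -> : f * g - f' * g' = g * (f - f') + f' * (g - g').
  by rewrite !mulrBr addrA [f' * g]mulrC subrK mulrC.
by rewrite -[0]addr0; apply: fps_congD; exact: fps_congMl.
Qed.

Lemma fps_cong_le M N f g : (M <= N)%N -> fps_cong N f g -> fps_cong M f g.
Proof. by move=> MN fg i iM; apply: fg; exact: leq_trans MN. Qed.

Lemma fps_eq_cong f g : (forall N, fps_cong N f g) -> f = g.
Proof. by move=> fg; apply/fpsP => i; exact: (fg i.+1). Qed.

Lemma fpsCD (a b : C) : fpsC (a + b) = fpsC a + fpsC b.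
Proof. by apply/fpsP=> i /=; case: eqP => //; rewrite addr0. Qed.
Lemma fpsC_nat k : fpsC k%:R = k%:R :> fps C.
Proof.
elim: k => [|k IH]; last by rewrite -natr1 fpsCD IH -[RHS]natr1.
by apply/fpsP=> i /=; case: ifP.
Qed.

Lemma fps_cong1 f : fps_cong 1 f (fpsC (fcoef f 0)).
Proof. by case. Qed.

(* The inverse of 1 - hbar u is the geometric series. *)
Lemma fps_unit_geom (u : fps C) : 1 - hbar * u \is a GRing.unit.
Proof.
pose s N := \sum_(k < N) (hbar * u) ^+ k.
have sP N d : fps_cong N (s (d + N)%N) (s N).
  elim: d => [//|d IH]; rewrite addSn {1}/s big_ord_recr /= -/(s _) -[s N]addr0.
  apply: fps_congD => //; rewrite exprD; apply: fps_congMl; rewrite exprMn.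
  exact: hbar_exp_cong.
(* The limit of the partial sums is read off diagonally: the coefficient of degree i no longer
   changes after i+1 terms. *)
apply/unitrPr; exists (Fps (fun i => fcoef (s i.+1) i)); apply: fps_eq_cong => N.
have sN : fps_cong N (Fps (fun i => fcoef (s i.+1) i)) (s N).
  by move=> i iN; rewrite /= -(subnK iN); exact/esym/sP.
have e1 : (1 - hbar * u) * s N + hbar ^+ N * u ^+ N = 1.
  by rewrite -[X in X * _]opprB mulNr -subrX1 opprB exprMn subrK.
rewrite -[X in fps_cong _ _ X]e1 -[X in fps_cong _ X]addr0; apply: fps_congD.
  by apply: fps_congMM.
by move=> i iN; rewrite hbar_exp_cong.
Qed.

End FpsCongruence.

Section FpsField.
Variable C : numFieldType.
Implicit Types f g : fps C.

(** Dividing by the constant term leaves a series of the form 1 - hbar u. *)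
Lemma fps_unitP f : fcoef f 0 != 0 -> f \is a GRing.unit.
Proof.
move=> f0; have /fps_congB/fps_congP [u fu] := @fps_cong1 _ f.
have c0 : fpsC (fcoef f 0) * fpsC (fcoef f 0)^-1 = 1 by rewrite -fpsCM divff.
have cU : fpsC (fcoef f 0) \is a GRing.unit by apply/unitrPr; eexists; exact: c0.
set c := fpsC _ in fu c0 cU; set d := fpsC _ in c0.
have -> : f = c * (1 - hbar * (- (d * u))).
  rewrite mulrN opprK mulrDr mulr1 [c * _]mulrCA [c * _]mulrA c0 mul1r.
  by rewrite -[hbar]expr1 -fu addrC subrK.
by rewrite unitrM cU fps_unit_geom.
Qed.

End FpsField.

Section FpsExponential.
Variable C : numFieldType.

Definition exps (c : C) : fps C := Fps (fun i => c ^+ i / i`!%:R).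

Lemma exps0 : exps 0 = 1.
Proof.
by apply/fpsP => -[|i]; rewrite fcoef1 /= expr0n /= ?mul0r // fact0 divr1.
Qed.

Lemma expsD a b : exps (a + b) = exps a * exps b.
Proof.
apply/fpsP=> i; rewrite fcoefM /= exprDn mulr_suml.
rewrite (reindex_inj rev_ord_inj) /=; apply: eq_bigr => j _.
have ji : (j <= i)%N by rewrite -ltnS.
have fact_neq0 k : k`!%:R != 0 :> C by rewrite pnatr_eq0 -lt0n fact_gt0.
rewrite subSS subKn // mulrACA -mulr_natr -[LHS]mulrA; congr (_ * _).
rewrite bin_sub // -(bin_fact ji) !natrM invfM mulrA divff ?mul1r ?invfM //.
by rewrite pnatr_eq0 -lt0n bin_gt0.
Qed.

Lemma exps1 : exp_hbar C = exps 1.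
Proof. by apply/fpsP=> i /=; rewrite expr1n mul1r. Qed.

Lemma exps_unit a : exps a \is a GRing.unit.
Proof. by apply/unitrPr; exists (exps (- a)); rewrite -expsD subrr exps0. Qed.

Lemma expsX a k : exps a ^+ k = exps (a *+ k).
Proof. by elim: k => [|k IH]; rewrite ?exps0 // exprS IH -expsD mulrS. Qed.

Lemma expsXz a (z : int) : exps a ^ z = exps (a *~ z).
Proof.
case: z => k; first by rewrite -exprnP expsX.
rewrite NegzE -exprnN expsX mulrNz; apply: (mulIr (exps_unit (a *+ k.+1))).
by rewrite mulVr ?exps_unit // -expsD addNr exps0.
Qed.

Lemma exps_cong2 a : fps_cong 2 (exps a) (1 + fpsC a * hbar).
Proof.
move=> i; rewrite fcoefD fcoef1 mulrC hbar_mulS.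
by case: i => [|[|//]] _ /=; rewrite ?expr0 ?fact0 ?addr0 ?add0r divr1.
Qed.

Variables (n : nat) (w : C).
Hypotheses (hn : (0 < n)%N) (hw : w ^+ n = 1).
Let q := val (root_times_exp hn hw).

(** The root of unity disappears from exponents divisible by [n]. This is how the exponential
    factors created by moving x past e^(n k d) become powers of [q]. *)
Lemma q_nmul (z : int) : q ^ (n%:Z * z) = exps (n%:R *~ z).
Proof.
rewrite -exprz_exp -exprnP exprMn.
have -> : fpsC w ^+ n = 1.
  have fX k : fpsC w ^+ k = fpsC (w ^+ k).
    by elim: k => [|k IH] //; rewrite exprS IH -fpsCM -exprS.
  by rewrite fX hw.
by rewrite mul1r exps1 expsX expsXz.
Qed.

Lemma q_cong k : fps_cong 1 (q ^+ k) (fpsC (w ^+ k)).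
Proof.
elim: k => [//|k IH]; rewrite !exprS fpsCM; apply: fps_congMM => //.
rewrite -[fpsC w]mulr1; apply: fps_congMM => // -[|//] _.
by rewrite fcoef1 /= fact0 invr1.
Qed.

(** Since the cofactor is a unit, [hbar] itself belongs to the ideal that defines the source
    completion. *)
Lemma q_sub_w : exists2 c : fps C, c \is a GRing.unit & q - fpsC w = hbar * c.
Proof.
have w0 : w != 0 by apply: contra_eq_neq hw => ->; rewrite expr0n gtn_eqF // eq_sym oner_eq0.
pose c : fps C := Fps (fun i => w / i.+1`!%:R).
exists c; first by apply: fps_unitP; rewrite /= divr1.
apply/fpsP=> i; rewrite hbar_mulS fcoefD fcoefN fcoefM big_ord_recl /= subn0.
rewrite big1 ?addr0; last by move=> j _; rewrite mul0r.
by case: i => [|i] /=; rewrite ?subr0 // fact0 invr1 mulr1 subrr.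
Qed.

End FpsExponential.

(** * Powers of ideals, and maps between completions *)

Section IdealPowers.
Variables (A : pzRingType) (I : ideal A).

Lemma ideal_powM r s x y :
  ideal_pow I r x -> ideal_pow I s y -> ideal_pow I (r + s) (x * y).
Proof.
elim: s r x y => [|s IH] r x y Ix Iy; first by rewrite addn0; exact: Defs.idealMr.
(* The right factors that send the power [r] into the power r+s+1 form a two-sided ideal, so it is
   enough to test the generators of the power s+1. *)
pose J y := forall x, ideal_pow I r x -> ideal_pow I (r + s.+1) (x * y).
have J0 : J 0 by move=> z _; rewrite mulr0; exact: ideal0.
have JD u v : J u -> J v -> J (u + v).
  by move=> Ju Jv z Iz; rewrite mulrDr; apply: idealD; [exact: Ju|exact: Jv].
have JMl a u : J u -> J (a * u).
  by move=> Ju z Iz; rewrite mulrA; apply: Ju; exact: Defs.idealMr.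
have JMr a u : J u -> J (u * a).
  by move=> Ju z Iz; rewrite mulrA; apply: Defs.idealMr; exact: Ju.
apply: (@gen_sub _ _ (Ideal J0 JD JMl JMr) _ _ Iy) => // _ [u [v [Iu Iv ->]]] z Iz.
by rewrite mulrA addnS; apply: sub_gen; exists (z * u), v; split=> //; exact: IH.
Qed.

Lemma ideal_pow1 x : I x -> ideal_pow I 1 x.
Proof. by move=> Ix; apply: sub_gen; exists 1, x; rewrite mul1r. Qed.

End IdealPowers.

Section CompletionTheory.
Variables (C : comNzRingType) (A : pzAlgType (fps C)) (F : filtration A).
Implicit Types X Y : completion F.

Lemma qpi_eq0 r x : qpi (F r) x = 0 <-> F r x.
Proof. by rewrite -qpi0 qpiP subr0. Qed.

Lemma cproj_in0 r x : cproj (cin F x) r = 0 <-> F r x.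
Proof. exact: qpi_eq0. Qed.

Lemma cproj_repr X r : cproj (cin F (qrepr (cproj X r))) r = cproj X r.
Proof. exact: qreprK. Qed.

Lemma cprojE X r : {x | cproj X r = qpi (F r) x}.
Proof. by exists (qrepr (cproj X r)); rewrite qreprK. Qed.

Lemma cprojB X Y r : cproj (X - Y) r = cproj X r - cproj Y r. Proof. by []. Qed.

Lemma cproj_sub0 X Y r : cproj (X - Y) r = 0 <-> cproj X r = cproj Y r.
Proof.
by split=> [/eqP|e]; rewrite cprojB ?e ?subrr // subr_eq0 => /eqP.
Qed.

Lemma cproj_sum (J : Type) (l : seq J) (P : pred J) (f : J -> completion F) r :
  cproj (\sum_(i <- l | P i) f i) r = \sum_(i <- l | P i) cproj (f i) r.
Proof. exact: (big_morph (fun X => cproj X r) (fun X Y => cprojD X Y r) (cproj0 F r)). Qed.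

Lemma cproj_le X Y r s : (r <= s)%N -> cproj X s = cproj Y s -> cproj X r = cproj Y r.
Proof. by move=> rs e; rewrite -!(cproj_repr_le _ rs) e. Qed.

Lemma cproj_le0 X r s : (r <= s)%N -> cproj X s = 0 -> cproj X r = 0.
Proof. by move=> rs e; apply: (@cproj_le _ 0 _ _ rs). Qed.

Lemma cproj_repr0 X r s : (r <= s)%N -> cproj X r = 0 -> F r (qrepr (cproj X s)).
Proof. by move=> rs e; apply/qpi_eq0; rewrite cproj_repr_le. Qed.

Lemma completion_eq X Y : (forall r, cproj (X - Y) r = 0) -> X = Y.
Proof. by move=> e; apply/completionP => r; apply/cproj_sub0. Qed.

Lemma cproj_alg k r : cproj (alg k : completion F) r = qpi (F r) (alg k).
Proof. by []. Qed.

Lemma ascaleE k X : k *~: X = k *: X. Proof. by []. Qed.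

Fact climit_compat (s : nat -> completion F) :
  (forall r, cproj (s r.+1) r = cproj (s r) r) ->
  forall r, qpi (F r) (qrepr (cproj (s r.+1) r.+1)) = cproj (s r) r.
Proof. by move=> cs r; rewrite cproj_compat. Qed.

Lemma completion_complete (s : nat -> completion F) :
  (forall r, cproj (s r.+1) r = cproj (s r) r) ->
  exists X, forall r, cproj X r = cproj (s r) r.
Proof. by move=> cs; exists (Completion (climit_compat cs)). Qed.

Definition fil_mul := forall r s x y, F r x -> F s y -> F (r + s) (x * y).

Lemma cprojM0 X Y r s : fil_mul ->
  cproj X r = 0 -> cproj Y s = 0 -> cproj (X * Y) (r + s) = 0.
Proof.
move=> FM X0 Y0; rewrite cprojM -[cproj X _]qreprK -[cproj Y _]qreprK -qpiM.
by apply/qpi_eq0; apply: FM; apply: cproj_repr0; rewrite ?leq_addr ?leq_addl.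
Qed.

Lemma cprojMl0 X Y r : cproj Y r = 0 -> cproj (X * Y) r = 0.
Proof. by move=> e; rewrite cprojM e mulr0. Qed.

End CompletionTheory.

Lemma adic_mul (C : comNzRingType) (A : pzAlgType (fps C)) (I : ideal A) :
  fil_mul (adic I).
Proof. by move=> r s x y; exact: ideal_powM. Qed.

Lemma mat_fil_mul (C : comNzRingType) (A : pzAlgType (fps C)) (F : filtration A) m :
  fil_mul F -> fil_mul (mat_fil m F).
Proof.
move=> FM r s X Y /mat_ideal_setE FX /mat_ideal_setE FY.
by apply/mat_ideal_setE => i j; rewrite mxE; apply: ideal_sum => k _; exact: FM.
Qed.

Section Extension.
Variables (C : comNzRingType) (A B : pzAlgType (fps C)).
Variables (F : filtration A) (G : filtration B) (f : A -> completion G).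
Hypothesis fB : forall x y, f (x - y) = f x - f y.
Hypothesis fF : forall r x, F r x -> cproj (f x) r = 0.

Lemma cext_cong r x y : qpi (F r) x = qpi (F r) y -> cproj (f x) r = cproj (f y) r.
Proof. by move=> /qpiP /fF; rewrite fB => /cproj_sub0. Qed.

Fact cext_compat (X : completion F) r :
  qpi (G r) (qrepr (cproj (f (qrepr (cproj X r.+1))) r.+1))
    = cproj (f (qrepr (cproj X r))) r.
Proof. by rewrite cproj_compat; apply: cext_cong; rewrite cproj_compat qreprK. Qed.

(** Unlike [cmap], this extends a map whose values already lie in a completion. The homomorphism is
    of this kind, as the image of D contains e^(n d). *)
Definition cext (X : completion F) : completion G := Completion (cext_compat X).

Lemma cextE X r x : cproj X r = qpi (F r) x -> cproj (cext X) r = cproj (f x) r.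
Proof. by move=> e; apply: cext_cong; rewrite qreprK. Qed.

Lemma cext_in x : cext (cin F x) = f x.
Proof. by apply/completionP=> r; apply: cextE. Qed.

Lemma cext0 X r : cproj X r = 0 -> cproj (cext X) r = 0.
Proof. by move=> X0; rewrite (@cextE X r 0) // -(subrr 0) fB subrr. Qed.

Lemma cext_alg_hom : alg_hom f -> alg_hom cext.
Proof.
move=> fh; split=> [k X Y|].
  apply/completionP=> r; have [x Xx] := cprojE X r; have [y Yy] := cprojE Y r.
  rewrite (@cextE _ r (k *~: x + y)); last first.
    by rewrite cprojD ascaleE cprojZ Xx Yy qpiD qpiZ.
  by rewrite fh.1 !cprojD !ascaleE !cprojZ (cextE Xx) (cextE Yy).
split=> [|X Y]; first by rewrite -[1]/(cin F 1) cext_in (alg_hom1 fh).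
apply/completionP=> r; have [x Xx] := cprojE X r; have [y Yy] := cprojE Y r.
rewrite (@cextE _ r (x * y)); last by rewrite cprojM Xx Yy qpiM.
by rewrite (alg_homM fh) !cprojM (cextE Xx) (cextE Yy).
Qed.

End Extension.

Lemma comp_nbhs_continuous (C : comNzRingType) (A B : pzAlgType (fps C))
    (F : filtration A) (G : filtration B) (f : completion F -> completion G) :
  (forall X Y, f (X - Y) = f X - f Y) ->
  (forall r X, cproj X r = 0 -> cproj (f X) r = 0) ->
  lin_continuous (@comp_nbhs _ _ F) (@comp_nbhs _ _ G) f.
Proof.
by move=> fB f0 s; exists s => X Y XY; have := f0 s _ XY; rewrite fB.
Qed.

Lemma continuous_dense_eq (C : comNzRingType) (A B : pzAlgType (fps C))
    (F : filtration A) (G : filtration B) (f g : completion F -> completion G)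
    (D : set (completion F)) :
  lin_continuous (@comp_nbhs _ _ F) (@comp_nbhs _ _ G) f ->
  lin_continuous (@comp_nbhs _ _ F) (@comp_nbhs _ _ G) g ->
  (forall X r, exists2 Y, D Y & cproj X r = cproj Y r) ->
  (forall X, D X -> f X = g X) -> f = g.
Proof.
move=> fc gc dD fg; apply/funext => X; apply/completionP => s.
have [r rP] := fc s; have [t tP] := gc s.
have [Y DY XY] := dD X (maxn r t).
have /rP fY : comp_nbhs r (X - Y).
  by apply/cproj_sub0; apply: (cproj_le (leq_maxl r t)).
have /tP gY : comp_nbhs t (X - Y).
  by apply/cproj_sub0; apply: (cproj_le (leq_maxr r t)).
by move: fY gY => /cproj_sub0 -> /cproj_sub0 ->; rewrite fg.
Qed.

(** * Powers of an ideal generated by s and hbar *)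

Section NormalForm.
Variables (C : comNzRingType) (A : pzAlgType (fps C)) (s : A).

(* nf r is the right ideal generated by the products s^i hbar^(r - i). *)
Fixpoint nf (r : nat) : set A :=
  if r is r'.+1 then
    [set x | exists y z, [/\ nf r' y, nf r' z & x = s * y + hbar *~: z]]
  else setT.

Lemma nf0 r : nf r 0.
Proof.
elim: r => [//|r IH]; exists 0, 0; split=> //.
by rewrite /ascale !mulr0 addr0.
Qed.

Lemma nfD r x y : nf r x -> nf r y -> nf r (x + y).
Proof.
elim: r x y => [//|r IH] _ _ [x [x' [nx nx' ->]]] [y [y' [ny ny' ->]]].
exists (x + y), (x' + y'); split; [exact: IH|exact: IH|].
by rewrite mulrDr ascaleDr addrACA.
Qed.

Lemma nfMr r a x : nf r x -> nf r (x * a).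
Proof.
elim: r x => [//|r IH] _ [x [y [nx ny ->]]].
exists (x * a), (y * a); split; [exact: IH|exact: IH|].
by rewrite mulrDl mulrA ascaleAl.
Qed.

Lemma nfZ r k x : nf r x -> nf r (k *~: x).
Proof. by rewrite /ascale alg_central; exact: nfMr. Qed.

Lemma nfN r x : nf r x -> nf r (- x).
Proof. by rewrite -mulrN1; exact: nfMr. Qed.

Lemma nfB r x y : nf r x -> nf r y -> nf r (x - y).
Proof. by move=> nx ny; apply: nfD => //; exact: nfN. Qed.

Lemma nf_s r x : nf r x -> nf r.+1 (s * x).
Proof.
by move=> nx; exists x, 0; split=> //; [exact: nf0|rewrite /ascale mulr0 addr0].
Qed.

Lemma nf_hbar r x : nf r x -> nf r.+1 (hbar *~: x).
Proof.
by move=> nx; exists 0, x; split=> //; [exact: nf0|rewrite mulr0 add0r].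
Qed.

Lemma nf_hbarX r x : nf r (hbar ^+ r *~: x).
Proof.
elim: r x => [//|r IH] x; rewrite exprS -ascaleA; exact/nf_hbar/IH.
Qed.

Hypothesis sC : forall b, nf 1 (b * s).

(** By [sC], an [s] can be moved to the left of any factor at the cost of a multiple of [hbar],
    which counts for the same order. This makes the right ideal two-sided. *)
Lemma nfMl r a x : nf r x -> nf r (a * x).
Proof.
elim: r a x => [//|r IH] a _ [y [z [ny nz ->]]]; rewrite mulrDr mulrA.
have [b [c [_ _ ->]]] := sC a; rewrite mulrDl -mulrA -ascaleAl -ascaleAr -addrA.
by apply: nfD; [|apply: nfD]; do [exact/nf_s/IH|exact/nf_hbar/IH].
Qed.

Lemma nf_Ms r x : nf r x -> nf r.+1 (x * s).
Proof.
elim: r x => [x _|r IH _ [y [z [ny nz ->]]]]; first exact: sC.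
by rewrite mulrDl -mulrA -ascaleAl; apply: (@nfD r.+2); [exact/nf_s/IH|exact/nf_hbar/IH].
Qed.

Definition nf_ideal r : ideal A :=
  Ideal (@nf0 r) (@nfD r) (@nfMl r) (fun a x => @nfMr r a x).

(** A product of an element of order r with s a + hbar b has order r+1, because [s] moves left
    through the first factor. Powers of a two-sided ideal thus become explicit recursive sums, on
    which linear maps can be checked by induction on the order. *)
Lemma ideal_pow_nf (I : ideal A) r x : (forall y, I y -> nf 1 y) ->
  I s -> I (alg hbar) -> ideal_pow I r x <-> nf r x.
Proof.
move=> In Is Ih; split.
  elim: r x => [//|r IH]; apply: (@gen_sub _ _ (nf_ideal r.+1)).
  move=> _ [y [z [Iy Iz ->]]]; have [a [b [_ _ ->]]] := In _ Iz.
  rewrite /= mulrDr mulrA -ascaleAr; apply: (@nfD r.+1); last exact/nf_hbar/nfMr/IH.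
  exact/nfMr/nf_Ms/IH.
elim: r x => [//|r IH] _ [y [z [/IH Iy /IH Iz ->]]].
by rewrite -add1n; apply: idealD; apply: ideal_powM => //; exact: ideal_pow1.
Qed.

End NormalForm.

(** * Passage between an algebra and its hbar-adic completion *)

Section HbarCompletion.
Variables (C : comNzRingType) (A : pzAlgType (fps C)).
Local Notation cA := (completion (hbar_fil A)).
Local Notation cin := (cin (hbar_fil A)).
Let cinH := cin_alg_hom (hbar_fil A).

(** Dividing the representatives by hbar^r level by level need not give a coherent sequence, since
    quotients by [hbar] may fail to be unique. Hence the increments are divided, and the results are
    summed again. *)
Lemma hbar_kerP (X : cA) r : cproj X r = 0 <-> exists Y, X = hbar ^+ r *~: Y.
Proof.
split=> [X0|[Y ->]]; last first.
  have [y Yy] := cprojE Y r.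
  by rewrite ascaleE cprojZ Yy -qpiZ; apply/qpi_eq0; exists y.
pose x t := qrepr (cproj X (t + r)).
have [y0 x0] : hbar_fil A r (x 0%N) by apply: cproj_repr0.
have /choice [z zP] t : exists z, x t.+1 - x t = hbar ^+ (t + r) *~: z.
  exact: (crepr_coherent X (t + r)).
pose y t := y0 + \sum_(i < t) hbar ^+ i *~: z i.
have yP t : x t = hbar ^+ r *~: y t.
  elim: t => [|t IH]; first by rewrite /y big_ord0 addr0.
  rewrite -[x t.+1](subrK (x t)) zP IH /y big_ord_recr /= !ascaleDr ascaleA.
  by rewrite -exprD addrC addrA [(r + t)%N]addnC.
have cy : coherent (hbar_fil A) y.
  move=> t; exists (z t); rewrite /y big_ord_recr /=.
  by rewrite addrA [X in X - _]addrC addrK.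
exists (cmk cy); apply/completionP => t.
rewrite ascaleE cprojZ -[cproj (cmk _) t]/(qpi _ (y t)) -qpiZ -yP.
by rewrite cproj_repr_le ?leq_addr.
Qed.

Lemma hbar_dense (X : cA) r : exists x Y, X = cin x + hbar ^+ r *~: Y.
Proof.
have /hbar_kerP [Y e] : cproj (X - cin (qrepr (cproj X r))) r = 0.
  by apply/cproj_sub0; rewrite cproj_repr.
by exists (qrepr (cproj X r)), Y; rewrite -e addrC subrK.
Qed.

Variable s : A.

Lemma nf_in r x : nf s r x -> nf (cin s) r (cin x).
Proof.
elim: r x => [//|r IH] _ [y [z [/IH ny /IH nz ->]]].
exists (cin y), (cin z); split=> //.
by rewrite (alg_homD cinH) (alg_homM cinH) (alg_homZ cinH).
Qed.

(** Only the outermost coefficients of a normal form have to be approximated. This moves questions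
    about orders to the uncompleted algebra, up to an error hbar^N that is harmless once N reaches
    the order in question. *)
Lemma nf_approx N r x : nf (cin s) r x ->
  exists x0 Y, nf s r x0 /\ x = cin x0 + hbar ^+ N *~: Y.
Proof.
elim: r x => [x _|r IH _ [y [z [/IH [y0 [Y [ny ->]]] /IH [z0 [Z [nz ->]]] ->]]]].
  by have [x0 [Y ->]] := hbar_dense x N; exists x0, Y.
exists (s * y0 + hbar *~: z0), (cin s * Y + hbar *~: Z); split.
  by exists y0, z0.
rewrite (alg_homD cinH) (alg_homM cinH) (alg_homZ cinH) !mulrDr !ascaleDr.
by rewrite addrACA -ascaleAr !ascaleA [hbar * _]mulrC.
Qed.

Lemma nf_of_in r x : nf (cin s) r (cin x) -> nf s r x.
Proof.
move=> /(nf_approx r) [x0 [Y [n0 e]]].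
have /hbar_kerP : exists Y, cin (x - x0) = hbar ^+ r *~: Y.
  by exists Y; rewrite (alg_homB cinH) e addrC addKr.
move=> /cproj_in0 [z xz]; rewrite -(subrK x0 x) xz; apply: nfD => //.
exact: nf_hbarX.
Qed.

Lemma nf_comm_in : (forall b, nf s 1 (b * s)) ->
  forall b, nf (cin s) 1 (b * cin s).
Proof.
move=> sC b; have [b0 [Y ->]] := hbar_dense b 1.
rewrite mulrDl -ascaleAl -(alg_homM cinH) expr1.
by apply: (@nfD _ _ _ 1); [exact: nf_in|exact: nf_hbar].
Qed.

End HbarCompletion.

(** * Matrices and completions *)

Section CompletionMapTheory.
Variables (C : comNzRingType) (A B D : pzAlgType (fps C)).
Variables (F : filtration A) (G : filtration B) (H : filtration D).

Lemma cmap_lin f (hf : filtered F G f) :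
  (forall k x y, f (k *~: x + y) = k *~: f x + f y) ->
  forall k X Y, cmap hf (k *~: X + Y) = k *~: cmap hf X + cmap hf Y.
Proof.
move=> fL k X Y; apply/completionP=> r.
have [x Xx] := cprojE X r; have [y Yy] := cprojE Y r.
rewrite cprojD !ascaleE cprojZ (cmapE hf (esym Xx)) (cmapE hf (esym Yy)).
by rewrite -qpiZ -qpiD -fL; apply: cmapE; rewrite cprojD cprojZ Xx Yy qpiD qpiZ.
Qed.

Lemma cmap0r f (hf : filtered F G f) r X :
  cproj X r = 0 -> cproj (cmap hf X) r = 0.
Proof.
move=> X0; rewrite (@cmapE _ _ _ _ _ f hf X r 0) ?X0 //.
by rewrite -(subrr 0) hf.1 subrr.
Qed.

Lemma cmapB f (hf : filtered F G f) X Y : cmap hf (X - Y) = cmap hf X - cmap hf Y.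
Proof.
apply/completionP=> r; have [x Xx] := cprojE X r; have [y Yy] := cprojE Y r.
rewrite cprojB (cmapE hf (esym Xx)) (cmapE hf (esym Yy)) -qpiN -qpiD -hf.1.
by apply: cmapE; rewrite cprojB Xx Yy qpiD qpiN.
Qed.

Lemma cmap0 f (hf : filtered F G f) : cmap hf 0 = 0.
Proof. by rewrite -(subrr 0) cmapB subrr. Qed.

Lemma cmapD f (hf : filtered F G f) X Y : cmap hf (X + Y) = cmap hf X + cmap hf Y.
Proof. by rewrite -{1}[Y]opprK cmapB -sub0r cmapB cmap0 sub0r opprK. Qed.

Lemma cmap_sum f (hf : filtered F G f) (J : Type) (l : seq J) (P : pred J) g :
  cmap hf (\sum_(i <- l | P i) g i) = \sum_(i <- l | P i) cmap hf (g i).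
Proof. exact: (big_morph _ (cmapD hf) (cmap0 hf)). Qed.

Lemma cmapMM f (hf : filtered F H f) g (hg : filtered F H g)
    h (hh : filtered F H h) : (forall x y, f x * g y = h (x * y)) ->
  forall X Y, cmap hf X * cmap hg Y = cmap hh (X * Y).
Proof.
move=> fg X Y; apply/completionP=> r.
have [x Xx] := cprojE X r; have [y Yy] := cprojE Y r.
rewrite cprojM (cmapE hf (esym Xx)) (cmapE hg (esym Yy)) -qpiM fg.
by apply/esym/cmapE; rewrite cprojM Xx Yy qpiM.
Qed.

Lemma cmapM0 f (hf : filtered F H f) g (hg : filtered F H g) :
  (forall x y, f x * g y = 0) -> forall X Y, cmap hf X * cmap hg Y = 0.
Proof.
move=> fg X Y; apply/completionP=> r.
have [x /esym Xx] := cprojE X r; have [y /esym Yy] := cprojE Y r.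
by rewrite cprojM (cmapE hf Xx) (cmapE hg Yy) -qpiM fg.
Qed.

End CompletionMapTheory.

Section MatrixCompletion.
Variables (C : comNzRingType) (A : pzAlgType (fps C)) (F : filtration A).
Variable n : nat.
Local Notation cM := (completion (mat_fil n F)).

Definition csingle (a b : 'I_n) : completion F -> cM := cmap (msingle_filtered F a b).

Definition mcoord (a b : 'I_n) (X : mat A n) : A := X a b.

Fact mcoord_filtered a b : filtered (mat_fil n F) F (mcoord a b).
Proof.
by split=> [X Y|r X /mat_ideal_setE]; [rewrite /mcoord !mxE|exact].
Qed.

Definition ccoord (a b : 'I_n) : cM -> completion F := cmap (mcoord_filtered a b).

Lemma msingleE (a b i j : 'I_n) (u : A) :
  msingle a b u i j = if (i == a) && (j == b) then u else 0.
Proof. by rewrite !mxE; case: ifP; rewrite ?mulr1 ?mulr0. Qed.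

Lemma msingleM (a b d : 'I_n) (u v : A) :
  msingle a b u * msingle b d v = msingle a d (u * v) :> mat A n.
Proof.
apply/matrixP=> i j; rewrite mxE (bigD1 b) //= big1 ?addr0 => [|k /negPf kb].
  by rewrite !msingleE !eqxx andbT; do 2 case: ifP => //=; rewrite ?mul0r ?mulr0.
by rewrite !msingleE kb andbF mul0r.
Qed.

Lemma msingleM0 (a b c d : 'I_n) (u v : A) : b != c ->
  msingle a b u * msingle c d v = 0 :> mat A n.
Proof.
move=> /negPf bc; apply/matrixP=> i j; rewrite !mxE big1 // => k _.
rewrite !msingleE; case: ifP => [/andP [_ /eqP ->]|_]; last by rewrite mul0r.
by rewrite bc mulr0.
Qed.

Lemma mat_scale_in k (X : mat A n) i j : (k *~: X) i j = k *~: X i j.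
Proof.
rewrite /ascale mxE (bigD1 i) //= mxE eqxx big1 ?addr0 // => l /negPf li.
by rewrite mxE eq_sym li mul0r.
Qed.

Lemma msingle_lin (a b : 'I_n) k (u v : A) :
  msingle a b (k *~: u + v) = k *~: (msingle a b u : mat A n) + msingle a b v.
Proof.
apply/matrixP=> i j; rewrite [RHS]mxE mat_scale_in !msingleE.
by case: ifP => // _; rewrite /ascale mulr0 addr0.
Qed.

Lemma csingle_lin a b k X Y :
  csingle a b (k *~: X + Y) = k *~: csingle a b X + csingle a b Y.
Proof. exact/cmap_lin/msingle_lin. Qed.

Lemma csingle0 a b : csingle a b 0 = 0.
Proof. exact: cmap0. Qed.

Lemma csingleZ a b k X : csingle a b (k *~: X) = k *~: csingle a b X.
Proof. by rewrite -[k *~: X]addr0 csingle_lin csingle0 addr0. Qed.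

Lemma csingle_in a b x : csingle a b (cin F x) = cin _ (msingle a b x : mat A n).
Proof. exact: cmap_in. Qed.

Lemma csingleM a b d X Y : csingle a b X * csingle b d Y = csingle a d (X * Y).
Proof. exact/cmapMM/msingleM. Qed.

Lemma csingleM0 a b c d X Y : b != c -> csingle a b X * csingle c d Y = 0.
Proof. by move=> bc; apply: cmapM0 => x y; exact: msingleM0. Qed.

Lemma csingle_cproj0 a b r X : cproj X r = 0 -> cproj (csingle a b X) r = 0.
Proof. exact: cmap0r. Qed.

Lemma csingle_cong a b r X Y : cproj X r = cproj Y r ->
  cproj (csingle a b X) r = cproj (csingle a b Y) r.
Proof.
move=> /cproj_sub0 XY; apply/cproj_sub0; rewrite -cmapB; exact: cmap0r.
Qed.

Lemma csingle_sum1 : \sum_(a < n) csingle a a 1 = 1.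
Proof.
rewrite (eq_bigr (fun a => cin (mat_fil n F) (msingle a a (1 : A) : mat A n))); last first.
  by move=> a _; exact: csingle_in.
rewrite -(alg_hom_sum (cin_alg_hom (mat_fil n F))); congr cin.
apply/matrixP=> i j; rewrite summxE [RHS]mxE (bigD1 i) //= msingleE eqxx /=.
rewrite big1 ?addr0 => [|k /negPf ki].
  by rewrite eq_sym; case: eqP.
by rewrite msingleE eq_sym ki.
Qed.

Lemma ccoord_single a b i j X :
  ccoord i j (csingle a b X) = if (i == a) && (j == b) then X else 0.
Proof.
apply/completionP=> r; have [x Xx] := cprojE X r.
rewrite (@cmapE _ _ _ _ _ _ (mcoord_filtered i j) _ r (msingle a b x)); last first.
  by apply/esym/cmapE; rewrite Xx.
by rewrite /mcoord msingleE; case: ifP => //; rewrite Xx.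
Qed.

Lemma ccoordK X : \sum_(a < n) \sum_(b < n) csingle a b (ccoord a b X) = X.
Proof.
apply/completionP=> r; have [x Xx] := cprojE X r; rewrite cproj_sum.
have e a b : cproj (csingle a b (ccoord a b X)) r
    = cproj (cin (mat_fil n F) (msingle a b (x a b) : mat A n)) r.
  rewrite cproj_in; apply: cmapE; apply/esym.
  by rewrite (@cmapE _ _ _ _ _ _ (mcoord_filtered a b) _ r x).
under eq_bigr => a _ do rewrite cproj_sum (eq_bigr _ (fun b _ => e a b)) -cproj_sum.
rewrite -cproj_sum.
under eq_bigr => a _ do rewrite -(alg_hom_sum (cin_alg_hom (mat_fil n F))).
rewrite -(alg_hom_sum (cin_alg_hom (mat_fil n F))) Xx; congr qpi.
by rewrite [RHS]matrix_sum_delta; do 2 apply: eq_bigr => ? _.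
Qed.

Lemma ccoord_sum a b (J : Type) (l : seq J) (P : pred J) g :
  ccoord a b (\sum_(i <- l | P i) g i) = \sum_(i <- l | P i) ccoord a b (g i).
Proof. exact: cmap_sum. Qed.

Lemma ccoord_matrix a b (X : 'I_n -> 'I_n -> completion F) :
  ccoord a b (\sum_(i < n) \sum_(j < n) csingle i j (X i j)) = X a b.
Proof.
rewrite ccoord_sum.
rewrite (eq_bigr (fun i => \sum_(j < n) if (a == i) && (b == j) then X i j else 0)).
  rewrite (bigD1 a) //= (bigD1 b) //= !eqxx [X in _ + X + _]big1 => [|j jb].
    rewrite big1 ?addr0 // => i /negPf ia; rewrite big1 // => j _.
    by rewrite eq_sym ia.
  by rewrite [b == j]eq_sym (negPf jb).
by move=> i _; rewrite ccoord_sum; apply: eq_bigr => j _; exact: ccoord_single.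
Qed.

End MatrixCompletion.

(** * The identification of Mat_m (x) Mat_n with Mat_{mn} *)

Section Kronecker.
Variables (m n : nat).

Fact krow_subproof (i : 'I_(m * n)) : (i %% m < m)%N.
Proof. by rewrite ltn_pmod //; case: m i => [[]|]. Qed.
Fact kcol_subproof (i : 'I_(m * n)) : (i %/ m < n)%N.
Proof.
have m0 : (0 < m)%N by case: m i => [[]|].
by rewrite ltn_divLR // [X in (_ < X)%N]mulnC.
Qed.
Definition krow i := Ordinal (krow_subproof i).
Definition kcol i := Ordinal (kcol_subproof i).

Lemma kronK i : kron_index (krow i) (kcol i) = i.
Proof. by apply: val_inj; rewrite /= mulnC -divn_eq. Qed.
Lemma krowK (a : 'I_m) (k : 'I_n) : krow (kron_index a k) = a.
Proof. by apply: val_inj; rewrite /= mulnC modnMDl modn_small. Qed.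
Lemma kcolK (a : 'I_m) (k : 'I_n) : kcol (kron_index a k) = k.
Proof.
have m0 : (0 < m)%N by exact: leq_ltn_trans (ltn_ord a).
by apply: val_inj; rewrite /= mulnC divnMDl // divn_small // addn0.
Qed.

Lemma kron_eq (a b : 'I_m) (k l : 'I_n) :
  (kron_index a k == kron_index b l) = (a == b) && (k == l).
Proof.
apply/eqP/andP => [e|[/eqP -> /eqP ->] //].
by rewrite -(krowK a k) e krowK -{1}(kcolK a k) e kcolK !eqxx.
Qed.

Lemma kron_sum (V : nmodType) (f : 'I_(m * n) -> V) :
  \sum_i f i = \sum_a \sum_k f (kron_index a k).
Proof.
rewrite pair_bigA /=; apply: (reindex (fun p => kron_index p.1 p.2)).
by exists (fun i => (krow i, kcol i)) => [[a k] _|i _]; rewrite /= ?krowK ?kcolK ?kronK.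
Qed.

Variables (C : comNzRingType) (A : pzAlgType (fps C)).

Lemma mblockE (a b c d : 'I_m) (k l : 'I_n) (T : mat A n) :
  mblock a b T (kron_index c k) (kron_index d l)
    = if (a == c) && (b == d) then T k l else 0.
Proof.
rewrite summxE (bigD1 k) //= summxE (bigD1 l) //= [X in _ + X + _]big1; last first.
  by move=> j /negPf jl; rewrite !mxE !kron_eq [l == j]eq_sym jl !andbF mulr0.
rewrite [X in _ + _ + X]big1 ?addr0; last first.
  move=> i /negPf ik; rewrite summxE big1 // => j _.
  by rewrite !mxE !kron_eq [k == i]eq_sym ik !andbF mulr0.
rewrite !mxE !kron_eq !eqxx !andbT [c == a]eq_sym [d == b]eq_sym.
by case: ifP => _; rewrite ?mulr1 ?mulr0.
Qed.

Lemma kron_matrixP (X Y : mat A (m * n)) :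
  (forall a b k l, X (kron_index a k) (kron_index b l)
     = Y (kron_index a k) (kron_index b l)) -> X = Y.
Proof. by move=> e; apply/matrixP=> i j; rewrite -(kronK i) -(kronK j). Qed.

Lemma mblockM (a b d : 'I_m) (T U : mat A n) :
  mblock a b T * mblock b d U = mblock a d (T * U).
Proof.
apply: kron_matrixP => i j k l; rewrite mxE kron_sum (bigD1 b) //=.
rewrite [X in _ + X]big1 ?addr0 => [|c /negPf cb]; last first.
  by rewrite big1 // => t _; rewrite mblockE [b == c]eq_sym cb andbF mul0r.
rewrite mblockE mxE; under eq_bigr => t _ do rewrite !mblockE eqxx andbT /=.
by case: (a == i); case: (d == j) => //=; rewrite big1 // => t _; rewrite ?mul0r ?mulr0.
Qed.

Lemma mblockM0 (a b c d : 'I_m) (T U : mat A n) : b != c ->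
  mblock a b T * mblock c d U = 0.
Proof.
move=> /negPf bc; apply: kron_matrixP => i j k l; rewrite !mxE kron_sum.
rewrite big1 // => t _; rewrite big1 // => s _; rewrite !mblockE.
have [<-|_] := eqVneq b t; last by rewrite andbF mul0r.
by rewrite [c == b]eq_sym bc mulr0.
Qed.

Lemma mblock_sum1 : \sum_(a < m) mblock a a 1 = 1 :> mat A (m * n).
Proof.
apply: kron_matrixP => c d k l; rewrite summxE [RHS]mxE (bigD1 c) //= mblockE.
rewrite big1 => [|a /negPf ac]; last by rewrite mblockE ac.
by rewrite eqxx addr0 kron_eq /= mxE; case: (c == d).
Qed.

Lemma mblock_lin (a b : 'I_m) k (T U : mat A n) :
  mblock a b (k *~: T + U) = k *~: mblock a b T + mblock a b U.
Proof.
apply: kron_matrixP => c d i j; rewrite [RHS]mxE mat_scale_in !mblockE.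
case: ifP => _; first by rewrite [LHS]mxE mat_scale_in.
by rewrite /ascale mulr0 addr0.
Qed.

Definition munblock (a b : 'I_m) (X : mat A (m * n)) : mat A n :=
  \matrix_(k, l) X (kron_index a k) (kron_index b l).

Lemma munblockK (a b c d : 'I_m) (T : mat A n) :
  munblock c d (mblock a b T) = if (a == c) && (b == d) then T else 0.
Proof. by apply/matrixP=> i j; rewrite mxE mblockE; case: ifP; rewrite ?mxE. Qed.

Lemma mblock_unblock (X : mat A (m * n)) :
  \sum_(a < m) \sum_(b < m) mblock a b (munblock a b X) = X.
Proof.
apply: kron_matrixP => c d k l; rewrite summxE (bigD1 c) //= summxE (bigD1 d) //=.
rewrite mblockE !eqxx mxE [X in _ + X + _]big1 => [|b /negPf bd]; last first.
  by rewrite mblockE bd andbF.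
rewrite big1 ?addr0 // => a /negPf ac.
by rewrite summxE big1 // => b _; rewrite mblockE ac.
Qed.

Fact munblock_filtered F (a b : 'I_m) :
  filtered (mat_fil (m * n) F) (mat_fil n F) (munblock a b).
Proof.
split=> [X Y|r X /mat_ideal_setE FX]; first by apply/matrixP=> k l; rewrite !mxE.
by apply/mat_ideal_setE => k l; rewrite mxE.
Qed.

Definition mlift (a b : 'I_m) (T : mat A 1) : mat A m := msingle a b (T 0 0).

Fact mlift_filtered F (a b : 'I_m) : filtered (mat_fil 1 F) (mat_fil m F) (mlift a b).
Proof.
split=> [X Y|r X /mat_ideal_setE FX]; last exact: (msingle_filtered F a b).2.
by rewrite /mlift [(X - Y) 0 0]mxE [(- Y) 0 0]mxE (msingle_filtered F a b).1.
Qed.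

Lemma mentry_lift (a b c d : 'I_m) (T : mat A 1) :
  mentry c d (mlift a b T) = if (c == a) && (d == b) then T else 0.
Proof.
apply/matrixP=> i j; rewrite mxE msingleE !ord1 /=.
by case: ifP => _; rewrite ?mxE ?mul0rn.
Qed.

Lemma mlift_entry (X : mat A m) :
  \sum_(a < m) \sum_(b < m) mlift a b (mentry a b X) = X.
Proof.
by rewrite [RHS]matrix_sum_delta; do 2 apply: eq_bigr => ? _; rewrite /mlift mxE.
Qed.

Lemma mentry_lin (a b : 'I_m) k (X Y : mat A m) :
  mentry a b (k *~: X + Y) = k *~: mentry a b X + mentry a b Y.
Proof.
apply/matrixP=> i j; rewrite [RHS]mxE mat_scale_in ![mentry _ _ _ _ _]mxE !ord1 /=.
by rewrite mxE mat_scale_in.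
Qed.

Lemma mentryM (a b : 'I_m) (X Y : mat A m) :
  mentry a b (X * Y) = \sum_c mentry a c X * mentry c b Y.
Proof.
apply/matrixP=> i j; rewrite summxE !mxE !ord1 /=; apply: eq_bigr => c _.
by rewrite mxE big_ord1 !mxE.
Qed.

Lemma mentry1 (a b : 'I_m) : mentry a b 1 = (if a == b then 1 else 0) :> mat A 1.
Proof. by apply/matrixP=> i j; rewrite !mxE !ord1 /=; case: eqP; rewrite !mxE. Qed.

End Kronecker.

Section KroneckerExtension.
Variables (C : comNzRingType) (A B : pzAlgType (fps C)).
Variables (F : filtration A) (G : filtration B) (n : nat).
Variable Y : completion (mat_fil 1 F) -> completion (mat_fil n G).
Hypothesis Yh : alg_hom Y.
Hypothesis Yc : forall r X, cproj X r = 0 -> cproj (Y X) r = 0.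
Variable m : nat.

Definition centry (a b : 'I_m) := cmap (mentry_filtered F a b).
Definition cblock (a b : 'I_m) := cmap (mblock_filtered G n a b).
Definition clift (a b : 'I_m) := cmap (mlift_filtered F a b).
Definition cunblock := fun a b : 'I_m => cmap (@munblock_filtered m n _ _ G a b).

(** This is convertible with [upsilon_mn], for an arbitrary map [Y] between completions of matrix
    algebras. *)
Definition kron_ext (X : completion (mat_fil m F)) : completion (mat_fil (m * n) G) :=
  \sum_(a < m) \sum_(b < m) cblock a b (Y (centry a b X)).

Lemma cblock_lin a b k T U :
  cblock a b (k *~: T + U) = k *~: cblock a b T + cblock a b U.
Proof. exact/cmap_lin/mblock_lin. Qed.

Lemma centry_lin a b k T U :
  centry a b (k *~: T + U) = k *~: centry a b T + centry a b U.
Proof. exact/cmap_lin/mentry_lin. Qed.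

Lemma cblockM a b d T U : cblock a b T * cblock b d U = cblock a d (T * U).
Proof. by apply: cmapMM => x y; exact: mblockM. Qed.

Lemma cblockM0 a b c d T U : b != c -> cblock a b T * cblock c d U = 0.
Proof. by move=> bc; apply: cmapM0 => x y; exact: mblockM0. Qed.

Lemma cblock_sum1 : \sum_(a < m) cblock a a 1 = 1.
Proof.
rewrite (eq_bigr (fun a => cin (mat_fil (m * n) G) (mblock a a 1))); last first.
  by move=> a _; exact: cmap_in.
by rewrite -(alg_hom_sum (cin_alg_hom (mat_fil (m * n) G))) mblock_sum1.
Qed.

Lemma centryM a b X X' : centry a b (X * X') = \sum_c centry a c X * centry c b X'.
Proof.
apply/completionP=> r; have [x Xx] := cprojE X r; have [y Xy] := cprojE X' r.
rewrite (@cmapE _ _ _ _ _ _ _ _ r (x * y)); last by rewrite cprojM Xx Xy qpiM.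
have e c : cproj (centry a c X * centry c b X') r
    = cproj (cin (mat_fil 1 F) (mentry a c x * mentry c b y)) r.
  by rewrite cprojM (cmapE _ (esym Xx)) (cmapE _ (esym Xy)) -qpiM.
rewrite cproj_sum (eq_bigr _ (fun c _ => e c)) -cproj_sum.
by rewrite -(alg_hom_sum (cin_alg_hom (mat_fil 1 F))) mentryM.
Qed.

Lemma centry1 a b : centry a b 1 = if a == b then 1 else 0.
Proof.
rewrite -[1 in LHS]/(cin _ 1) [LHS]cmap_in mentry1; case: ifP => // _.
Qed.

Lemma kron_ext_lin k X X' : kron_ext (k *~: X + X') = k *~: kron_ext X + kron_ext X'.
Proof.
rewrite /kron_ext (big_morph _ (ascaleDr k) (mulr0 _)) -big_split /=.
apply: eq_bigr => a _; rewrite (big_morph _ (ascaleDr k) (mulr0 _)) -big_split /=.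
by apply: eq_bigr => b _; rewrite centry_lin Yh.1 cblock_lin.
Qed.

Lemma kron_extM X X' : kron_ext (X * X') = kron_ext X * kron_ext X'.
Proof.
rewrite /kron_ext mulr_suml; apply: eq_bigr => a _.
transitivity (\sum_b \sum_c cblock a c (Y (centry a c X)) * cblock c b (Y (centry c b X'))).
  apply: eq_bigr => b _; rewrite centryM (alg_hom_sum Yh) [LHS]cmap_sum.
  by apply: eq_bigr => c _; rewrite cblockM (alg_homM Yh).
rewrite exchange_big mulr_suml; apply: eq_bigr => c _ /=.
rewrite mulr_sumr [RHS](bigD1 c) //= [X in _ = _ + X]big1 ?addr0; last first.
  move=> d dc; rewrite mulr_sumr big1 // => b _; apply: cblockM0.
  by rewrite eq_sym.
by rewrite mulr_sumr.
Qed.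

Lemma kron_ext_alg_hom : alg_hom kron_ext.
Proof.
split; first exact: kron_ext_lin.
split; last exact: kron_extM.
rewrite -cblock_sum1 /kron_ext; apply: eq_bigr => a _.
rewrite (bigD1 a) //= centry1 eqxx (alg_hom1 Yh) big1 ?addr0 // => b ba.
by rewrite centry1 eq_sym (negPf ba) (alg_hom0 Yh) [LHS]cmap0.
Qed.

Lemma kron_ext_cproj0 r X : cproj X r = 0 -> cproj (kron_ext X) r = 0.
Proof.
move=> X0; rewrite cproj_sum big1 // => a _; rewrite cproj_sum big1 // => b _.
exact/cmap0r/Yc/cmap0r.
Qed.

Lemma kron_ext_in X :
  kron_ext (cin _ X) = \sum_(a < m) \sum_(b < m) cblock a b (Y (cin _ (mentry a b X))).
Proof. by apply: eq_bigr => a _; apply: eq_bigr => b _; rewrite [centry _ _ _]cmap_in. Qed.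

Lemma cunblockK a b c d T :
  cunblock c d (cblock a b T) = if (a == c) && (b == d) then T else 0.
Proof.
apply/completionP=> r; have [x Xx] := cprojE T r.
rewrite (@cmapE _ _ _ _ _ _ _ _ r (mblock a b x)); last first.
  by apply/esym/cmapE; rewrite Xx.
by rewrite munblockK; case: ifP.
Qed.

Lemma centry_lift a b c d T :
  centry c d (clift a b T) = if (c == a) && (d == b) then T else 0.
Proof.
apply/completionP=> r; have [x Xx] := cprojE T r.
rewrite (@cmapE _ _ _ _ _ _ _ _ r (mlift a b x)); last first.
  by apply/esym/cmapE; rewrite Xx.
by rewrite mentry_lift; case: ifP.
Qed.

Lemma cblock_unblock X : \sum_(a < m) \sum_(b < m) cblock a b (cunblock a b X) = X.
Proof.
apply/completionP=> r; have [x Xx] := cprojE X r.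
have e a b : cproj (cblock a b (cunblock a b X)) r
    = cproj (cin (mat_fil (m * n) G) (mblock a b (munblock a b x))) r.
  by apply: cmapE; apply/esym/cmapE.
rewrite cproj_sum Xx -[in RHS](mblock_unblock x) -cproj_in.
rewrite (alg_hom_sum (cin_alg_hom (mat_fil (m * n) G))) cproj_sum; apply: eq_bigr => a _.
rewrite (alg_hom_sum (cin_alg_hom (mat_fil (m * n) G))) !cproj_sum.
by apply: eq_bigr => b _; exact: e.
Qed.

Lemma clift_entry X : \sum_(a < m) \sum_(b < m) clift a b (centry a b X) = X.
Proof.
apply/completionP=> r; have [x Xx] := cprojE X r.
have e a b : cproj (clift a b (centry a b X)) r
    = cproj (cin (mat_fil m F) (mlift a b (mentry a b x))) r.
  by apply: cmapE; apply/esym/cmapE.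
rewrite cproj_sum Xx -[in RHS](mlift_entry x) -cproj_in.
rewrite (alg_hom_sum (cin_alg_hom (mat_fil m F))) cproj_sum; apply: eq_bigr => a _.
rewrite (alg_hom_sum (cin_alg_hom (mat_fil m F))) !cproj_sum.
by apply: eq_bigr => b _; exact: e.
Qed.

Lemma cunblock_sum a b (g : 'I_m -> completion (mat_fil (m * n) G)) (P : pred 'I_m) :
  cunblock a b (\sum_(i | P i) g i) = \sum_(i | P i) cunblock a b (g i).
Proof. exact: cmap_sum. Qed.

Lemma centry_sum a b (g : 'I_m -> completion (mat_fil m F)) (P : pred 'I_m) :
  centry a b (\sum_(i | P i) g i) = \sum_(i | P i) centry a b (g i).
Proof. exact: cmap_sum. Qed.

Lemma kron_ext_bij : bijective Y -> bijective kron_ext.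
Proof.
move=> [Z YZ ZY].
exists (fun W => \sum_(a < m) \sum_(b < m) clift a b (Z (cunblock a b W))).
  move=> X; rewrite -[RHS]clift_entry; apply: eq_bigr => a _; apply: eq_bigr => b _.
  congr (clift a b _); rewrite -[RHS]YZ; congr Z.
  rewrite /kron_ext cunblock_sum (bigD1 a) //= cunblock_sum (bigD1 b) //=.
  rewrite cunblockK !eqxx /= [X in _ + X + _]big1 => [|d /negPf db]; last first.
    by rewrite cunblockK eqxx db.
  rewrite big1 ?addr0 // => c /negPf ca; rewrite cunblock_sum big1 // => d _.
  by rewrite cunblockK ca.
move=> W; rewrite -[RHS]cblock_unblock; apply: eq_bigr => a _; apply: eq_bigr => b _.
congr (cblock a b _); rewrite -[RHS]ZY; congr Y.
rewrite centry_sum (bigD1 a) //= centry_sum (bigD1 b) //=.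
rewrite centry_lift !eqxx /= [X in _ + X + _]big1 => [|d /negPf db]; last first.
  by rewrite centry_lift eqxx eq_sym db.
rewrite big1 ?addr0 // => c /negPf ca; rewrite centry_sum big1 // => d _.
by rewrite centry_lift eq_sym ca.
Qed.

End KroneckerExtension.

(** * Continuous bilinear forms *)

Section CompletionFiltration.
Variables (C : comNzRingType) (A : pzAlgType (fps C)) (F : filtration A).

Fact cker0 r : cproj (0 : completion F) r = 0. Proof. by []. Qed.
Fact ckerD r (X Y : completion F) : cproj X r = 0 -> cproj Y r = 0 -> cproj (X + Y) r = 0.
Proof. by rewrite cprojD => -> ->; rewrite addr0. Qed.
Fact ckerMl r (Z X : completion F) : cproj X r = 0 -> cproj (Z * X) r = 0.
Proof. by rewrite cprojM => ->; rewrite mulr0. Qed.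
Fact ckerMr r (Z X : completion F) : cproj X r = 0 -> cproj (X * Z) r = 0.
Proof. by rewrite cprojM => ->; rewrite mul0r. Qed.
Definition cker_ideal r : ideal (completion F) :=
  Ideal (@cker0 r) (@ckerD r) (@ckerMl r) (@ckerMr r).
Fact cker_sub r X : cker_ideal r.+1 X -> cker_ideal r X.
Proof. exact: cproj_le0. Qed.
(** It turns a completion into a filtered algebra again, so that one notion of continuity serves a
    form at every stage: on the algebra, on its hbar-adic completion, and on the adic completion of
    matrices. *)
Definition cker : filtration (completion F) := Filtration cker_sub.

End CompletionFiltration.

Section ContinuousForms.
Variable C : comNzRingType.

Definition continuous_form (A : pzAlgType (fps C)) (F : filtration A)
    (phi : A -> A -> fps C) :=
  bilinear_form phi /\ forall N, exists r, forall x y,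
    F r x -> fps_cong N (phi x y) 0 /\ fps_cong N (phi y x) 0.

Section Bilinear.
Variables (A : pzAlgType (fps C)) (phi : A -> A -> fps C).
Hypothesis phiP : bilinear_form phi.

Lemma biform0l y : phi 0 y = 0.
Proof. by rewrite -(subrr 0) bilinear_formBl // subrr. Qed.
Lemma biform0r x : phi x 0 = 0.
Proof. by rewrite -(subrr 0) bilinear_formBr // subrr. Qed.
Lemma biformDl x x' y : phi (x + x') y = phi x y + phi x' y.
Proof. by rewrite -[x]ascale1 phiP.1 mul1r ascale1. Qed.
Lemma biformDr x y y' : phi x (y + y') = phi x y + phi x y'.
Proof. by rewrite -[y]ascale1 phiP.2 mul1r ascale1. Qed.
Lemma biformZl k x y : phi (k *~: x) y = k * phi x y.
Proof. by rewrite -[k *~: x]addr0 phiP.1 biform0l addr0. Qed.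
Lemma biformZr k x y : phi x (k *~: y) = k * phi x y.
Proof. by rewrite -[k *~: y]addr0 phiP.2 biform0r addr0. Qed.
Lemma biform_suml (J : Type) (l : seq J) (P : pred J) f y :
  phi (\sum_(i <- l | P i) f i) y = \sum_(i <- l | P i) phi (f i) y.
Proof. exact: (big_morph (phi^~ y) (fun x x' => biformDl x x' y) (biform0l y)). Qed.
Lemma biform_sumr (J : Type) (l : seq J) (P : pred J) f x :
  phi x (\sum_(i <- l | P i) f i) = \sum_(i <- l | P i) phi x (f i).
Proof. exact: (big_morph (phi x) (biformDr x) (biform0r x)). Qed.

End Bilinear.

Section Extend.
Variables (A : pzAlgType (fps C)) (F : filtration A) (phi : A -> A -> fps C).

(** By continuity [B] is itself a limit of values of [phi], and limits are unique. An extended form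
    is thus identified by its properties, without computing a limit. *)
Lemma cont_extE B : continuous_form (cker F) B ->
  (forall x y, B (cin F x) (cin F y) = phi x y) ->
  forall X Y, cont_ext phi X Y = B X Y.
Proof.
move=> [Bb Bc] Bphi X Y.
have Blim : is_form_lim phi X Y (B X Y).
  move=> N; have [r rP] := Bc N; exists r => x y Xx Yy; rewrite -Bphi.
  apply/fps_congB; have -> : B (cin F x) (cin F y) - B X Y
      = B (cin F x - X) (cin F y) + B X (cin F y - Y).
    by rewrite bilinear_formBl // bilinear_formBr // addrA subrK.
  rewrite -[0]addr0; apply: fps_congD.
    by apply: (rP _ _ _).1; apply/cproj_sub0.
  by apply: (rP _ _ _).2; apply/cproj_sub0.
apply: (is_form_lim_uniq _ Blim).
exact: (xgetI 0 (Blim : [set c | is_form_lim phi X Y c] (B X Y))).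
Qed.

Hypothesis phiP : continuous_form F phi.

Lemma cont_ext_form : continuous_form (cker F) (cont_ext phi (F := F)).
Proof.
case: phiP => phib phic.
have limP (X Y : completion F) : is_form_lim phi X Y (cont_ext phi X Y).
  by apply: cont_extP; [exact: bilinear_formBl|exact: bilinear_formBr|exact: phic].
split; first split=> k X X' Y.
- apply/is_form_lim_uniq; first exact: limP.
  move=> N; have [r rP] := limP X Y N; have [s sP] := limP X' Y N.
  exists (maxn r s) => x y Xx Yy.
  (* If [x] approximates k X + X' and [u] approximates X, then x - k u approximates X'; so a single
     [x] yields approximations of both terms. *)
  have [u Xu] := cprojE X (maxn r s).
  have ru : (r <= maxn r s)%N by exact: leq_maxl.
  have su : (s <= maxn r s)%N by exact: leq_maxr.
  have lo (Z : completion F) z t : (t <= maxn r s)%N ->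
      qpi (F (maxn r s)) z = cproj Z (maxn r s) -> qpi (F t) z = cproj Z t.
    by move=> tm e; rewrite -(cproj_in F z) ; apply: (cproj_le tm).
  have -> : phi x y = k * phi u y + phi (x - k *~: u) y.
    by rewrite -phib.1 addrC subrK.
  apply: fps_congD; first apply: fps_congMM => //.
    by apply: rP; apply: lo.
  apply: sP; apply: lo => //.
  by rewrite qpiD qpiN qpiZ Xx -Xu cprojD ascaleE cprojZ addrAC subrr add0r.
- apply/is_form_lim_uniq; first exact: limP.
  move=> N; have [r rP] := limP X X' N; have [s sP] := limP X Y N.
  exists (maxn r s) => x y Xx Yy.
  have [u Xu] := cprojE X' (maxn r s).
  have ru : (r <= maxn r s)%N by exact: leq_maxl.
  have su : (s <= maxn r s)%N by exact: leq_maxr.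
  have lo (Z : completion F) z t : (t <= maxn r s)%N ->
      qpi (F (maxn r s)) z = cproj Z (maxn r s) -> qpi (F t) z = cproj Z t.
    by move=> tm e; rewrite -(cproj_in F z) ; apply: (cproj_le tm).
  have -> : phi x y = k * phi x u + phi x (y - k *~: u).
    by rewrite -phib.2 addrC subrK.
  apply: fps_congD; first apply: fps_congMM => //.
    by apply: rP; apply: lo.
  apply: sP; apply: lo => //.
  by rewrite qpiD qpiN qpiZ Yy -Xu cprojD ascaleE cprojZ addrAC subrr add0r.
move=> N; have [r rP] := phic N; exists r => X Y /= X0.
have [s sP] := limP X Y N; have [t tP] := limP Y X N.
pose M := maxn r (maxn s t).
have rM : (r <= M)%N by exact: leq_maxl.
have sM : (s <= M)%N by rewrite leq_max leq_max leqnn orbT.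
have tM : (t <= M)%N by rewrite leq_max leq_max leqnn !orbT.
have Fx : F r (qrepr (cproj X M)) by exact: cproj_repr0.
have [xy yx] := rP _ (qrepr (cproj Y M)) Fx.
split=> i iN.
  by rewrite -(sP (qrepr (cproj X M)) (qrepr (cproj Y M))) ?cproj_repr_le // xy.
by rewrite -(tP (qrepr (cproj Y M)) (qrepr (cproj X M))) ?cproj_repr_le // yx.
Qed.

Lemma cont_extI x y : cont_ext phi (cin F x) (cin F y) = phi x y.
Proof.
by case: phiP => pb pc; apply: cont_ext_in;
  [exact: bilinear_formBl|exact: bilinear_formBr|exact: pc].
Qed.

End Extend.

Lemma continuous_form_eq (A : pzAlgType (fps C)) (F : filtration A)
    (D : set (completion F)) B B' :
  continuous_form (cker F) B -> continuous_form (cker F) B' ->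
  (forall X r, exists2 Y, D Y & cproj X r = cproj Y r) ->
  (forall X Y, D X -> D Y -> B X Y = B' X Y) -> forall X Y, B X Y = B' X Y.
Proof.
move=> [Bb Bc] [Bb' Bc'] dD BB X Y; apply: fps_eq_cong => N.
have [r rP] := Bc N; have [s sP] := Bc' N.
have [X' DX XX] := dD X (maxn r s); have [Y' DY YY] := dD Y (maxn r s).
have key (E : completion F -> completion F -> fps C) t : (t <= maxn r s)%N ->
    bilinear_form E ->
    (forall x y, cker F t x -> fps_cong N (E x y) 0 /\ fps_cong N (E y x) 0) ->
    fps_cong N (E X Y) (E X' Y').
  move=> tm Eb Ec; apply/fps_congB.
  have -> : E X Y - E X' Y' = E (X - X') Y + E X' (Y - Y').
    by rewrite bilinear_formBl // bilinear_formBr // addrA subrK.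
  rewrite -[0]addr0; apply: fps_congD.
    by apply: (Ec _ _ _).1; apply/cproj_sub0; exact: cproj_le XX.
  by apply: (Ec _ _ _).2; apply/cproj_sub0; exact: cproj_le YY.
have h1 := key B r (leq_maxl _ _) Bb rP.
have h2 := key B' s (leq_maxr _ _) Bb' sP.
by move=> i iN; rewrite h1 // h2 // BB.
Qed.

Lemma continuous_form_comp (A B : pzAlgType (fps C)) (F : filtration A)
    (G : filtration B) phi (f g : A -> B) :
  (forall k x y, f (k *~: x + y) = k *~: f x + f y) ->
  (forall k x y, g (k *~: x + y) = k *~: g x + g y) ->
  (forall r x, F r x -> G r (f x)) -> (forall r x, F r x -> G r (g x)) ->
  continuous_form G phi -> continuous_form F (fun x y => phi (f x) (g y)).
Proof.
move=> fL gL fF gF [pb pc]; split.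
  by split=> k u v t; rewrite ?fL ?gL ?pb.1 ?pb.2.
move=> N; have [r rP] := pc N; exists r => x y Fx; split.
  exact: (rP _ _ (fF _ _ Fx)).1.
exact: (rP _ _ (gF _ _ Fx)).2.
Qed.

Lemma continuous_mat_form (A : pzAlgType (fps C)) (F : filtration A) phi m :
  continuous_form F phi -> continuous_form (mat_fil m F) (mat_form phi (m := m)).
Proof.
move=> [pb pc]; split.
  split=> k u v t; rewrite /mat_form mulr_sumr -big_split /=; apply: eq_bigr => i _.
    rewrite mulr_sumr -big_split /=; apply: eq_bigr => j _.
    by rewrite mxE mat_scale_in pb.1.
  rewrite mulr_sumr -big_split /=; apply: eq_bigr => j _.
  by rewrite mxE mat_scale_in pb.2.
move=> N; have [r rP] := pc N; exists r => x y /mat_ideal_setE Fx.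
have z0 : 0 = \sum_(i < m) \sum_(j < m) 0 :> fps C by rewrite big1 // => i _; rewrite big1.
split; rewrite z0; apply: fps_cong_sum => i _; apply: fps_cong_sum => j _.
  exact: (rP _ _ (Fx _ _)).1.
exact: (rP _ _ (Fx _ _)).2.
Qed.

Lemma mat_form_single (A : pzAlgType (fps C)) phi n (a b c d : 'I_n) (u v : A) :
  bilinear_form phi ->
  mat_form phi (msingle a b u) (msingle c d v)
    = if (b == c) && (d == a) then phi u v else 0.
Proof.
move=> pb; rewrite /mat_form (bigD1 a) //= (bigD1 b) //= !msingleE !eqxx /=.
rewrite [X in _ + X + _]big1 => [|j /negPf jb]; last first.
  by rewrite msingleE jb andbF biform0l.
rewrite big1 ?addr0 => [|i /negPf ia]; last first.
  by rewrite big1 // => j _; rewrite msingleE ia biform0l.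
rewrite [a == d]eq_sym; case: ifP => // _; exact: biform0r.
Qed.

Lemma mat_form_block (A : pzAlgType (fps C)) phi m n (a b c d : 'I_m) (T U : mat A n) :
  bilinear_form phi ->
  mat_form phi (mblock a b T) (mblock c d U)
    = if (b == c) && (d == a) then mat_form phi T U else 0.
Proof.
move=> pb; rewrite /mat_form kron_sum (bigD1 a) //= [X in _ + X]big1; last first.
  move=> i /negPf ia; rewrite big1 // => k _; rewrite kron_sum big1 // => j _.
  by rewrite big1 // => l _; rewrite !mblockE [a == i]eq_sym ia biform0l.
rewrite addr0; case: ifP => [/andP [/eqP bc /eqP da]|bcda].
  subst c d; apply: eq_bigr => k _; rewrite kron_sum (bigD1 b) //=.
  rewrite [X in _ + X]big1 ?addr0; last first.
    move=> j /negPf jb; rewrite big1 // => l _.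
    by rewrite !mblockE [b == j]eq_sym jb andbF biform0l.
  by apply: eq_bigr => l _; rewrite !mblockE !eqxx.
rewrite big1 // => k _; rewrite kron_sum big1 // => j _; rewrite big1 // => l _.
rewrite !mblockE eqxx /=; case: eqP => [<-|_]; last exact: biform0l.
by rewrite [c == b]eq_sym bcda biform0r.
Qed.

End ContinuousForms.

(** * Exponentials in adic completions *)

Section TruncatedSeries.
Variable C : comNzRingType.

Lemma fcoefCM (a : C) f i : fcoef (fpsC a * f) i = a * fcoef f i.
Proof.
rewrite fcoefM big_ord_recl /= subn0 big1 ?addr0 // => j _; exact: mul0r.
Qed.

Lemma fcoef_hbarX k i : fcoef (hbar ^+ k : fps C) i = (i == k)%:R.
Proof.
by elim: k i => [|k IH] [|i]; rewrite ?fcoef1 // exprS hbar_mulS //.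
Qed.

Lemma fcoef_sum (J : Type) (l : seq J) (P : pred J) (f : J -> fps C) i :
  fcoef (\sum_(j <- l | P j) f j) i = \sum_(j <- l | P j) fcoef (f j) i.
Proof. exact: (big_morph (fun f => fcoef f i) (fun f g => fcoefD f g i) (fcoef0 C i)). Qed.

Lemma fps_trunc (f : fps C) r :
  fps_cong r (\sum_(k < r) fpsC (fcoef f k) * hbar ^+ k) f.
Proof.
move=> i ir; rewrite fcoef_sum (bigD1 (Ordinal ir)) // fcoefCM fcoef_hbarX eqxx mulr1.
rewrite big1 => [|j ji]; first exact: addr0.
rewrite fcoefCM fcoef_hbarX (_ : i == j :> nat = false) ?mulr0 //.
by apply: contraNF ji => /eqP e; apply/eqP/val_inj.
Qed.

End TruncatedSeries.

Section CompletedExponential.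
Variables (C : numFieldType) (A : pzAlgType (fps C)) (I : ideal A).
Local Notation F := (adic I).

Definition iexp x (Ix : I x) : completion F :=
  @cexp C A F x (fun r => ideal_pow_expr r Ix).

(** The exponential does not depend on the proof that its exponent lies in the ideal; every
    rewriting of an exponent relies on this. *)
Lemma cexp_eq (x y : A) (hx : forall r, F r (x ^+ r)) (hy : forall r, F r (y ^+ r)) :
  x = y -> cexp hx = cexp hy.
Proof. by move=> e; apply/completionP => r; rewrite /= e. Qed.

Lemma cproj_iexp x (Ix : I x) r : cproj (iexp Ix) r = qpi (F r) (exp_sum x r).
Proof. by []. Qed.

(** Up to order r, the exponential of the sum collects the terms [g i j] with i + j < r, the product
    all those with i, j < r. The surplus terms have i + j >= r and lie in [F r]. *)
Lemma iexpD x y (Ix : I x) (Iy : I y) (Ixy : I (x + y)) : x * y = y * x ->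
  iexp Ixy = iexp Ix * iexp Iy.
Proof.
move=> xy; apply/completionP=> r; rewrite cprojM !cproj_iexp -qpiM.
pose g i j := (fpsC (i`!%:R^-1) *~: x ^+ i) * (fpsC (j`!%:R^-1) *~: y ^+ j).
have gI i j : F (i + j) (g i j).
  by apply: ideal_powM; apply: idealMl; exact: ideal_pow_expr.
have fact_neq0 k : k`!%:R != 0 :> C by rewrite pnatr_eq0 -lt0n fact_gt0.
have -> : exp_sum (x + y) r = \sum_(i < r) \sum_(0 <= j < r - i) g i j.
  transitivity (\sum_(0 <= m < r) \sum_(0 <= i < r | (i <= m)%N) g i (m - i)%N).
    rewrite /exp_sum big_mkord; apply: eq_bigr => m _.
    rewrite addrC exprDn_comm; last exact/esym.
    rewrite /ascale mulr_sumr big_mkord.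
    rewrite (big_ord_widen_cond r (fun=> true) (fun i => alg (fpsC (m`!%:R^-1))
      * ((y ^+ (m - i) * x ^+ i) *+ 'C(m, i)))) //=.
    apply: eq_big => [i|i]; rewrite ?ltnS // => im.
    rewrite /g -ascaleAl -ascaleAr ascaleA -fpsCM /ascale.
    have -> : y ^+ (m - i) * x ^+ i = x ^+ i * y ^+ (m - i).
      by apply/commrX/commr_sym/commrX.
    rewrite -[_ *+ 'C(m, i)]mulr_natl [LHS]mulrA; congr (_ * _).
    have -> : 'C(m, i)%:R = alg (fpsC 'C(m, i)%:R) :> A by rewrite fpsC_nat rmorph_nat.
    rewrite -rmorphM -fpsCM; congr (alg (fpsC _)).
    rewrite -(bin_fact im) !natrM !invfM mulrAC mulVf ?mul1r //.
    by rewrite pnatr_eq0 -lt0n bin_gt0.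
  rewrite (exchange_big_dep_nat xpredT) //= big_mkord; apply: eq_bigr => i _.
  rewrite -(@big_nat_widenl _ _ _ i 0 r xpredT) //.
  rewrite -{1}[val i]add0n big_addn.
  by apply: eq_bigr => j _; rewrite addnK.
rewrite /exp_sum big_distrl /=; apply/qpiP; rewrite -sumrB; apply: ideal_sum => i _.
rewrite big_distrr /= -(big_mkord xpredT (fun j => g i j)).
rewrite (@big_cat_nat _ _ _ (r - i) 0 r) ?leq_subr //= opprD addrA subrr sub0r.
apply: idealN; rewrite big_nat; apply: ideal_sum => j /andP [ij _].
by apply: (@fil_le _ F r (i + j)%N) => //; rewrite -leq_subLR.
Qed.

Lemma iexp0 (I0 : I 0) : iexp I0 = 1.
Proof.
apply/completionP => -[|r]; rewrite cproj_iexp /exp_sum.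
  by rewrite cproj1 -qpi1; apply/qpiP.
rewrite big_ord_recl /= expr0 fact0 invr1 ascale1 big1 ?addr0 // => i _.
by rewrite expr0n /ascale mulr0.
Qed.

Lemma iexp_conj x y z (Ix : I x) (Iy : I y) : z * x = y * z ->
  cin F z * iexp Ix = iexp Iy * cin F z.
Proof.
move=> zx; apply/completionP => r; rewrite !cprojM !cproj_iexp -!qpiM; congr qpi.
rewrite /exp_sum mulr_sumr mulr_suml; apply: eq_bigr => i _.
rewrite -ascaleAr -ascaleAl; congr (_ *~: _).
by elim: (i : nat) => [|k IH]; rewrite ?mulr1 ?mul1r // exprSr mulrA IH -mulrA zx mulrA -exprSr.
Qed.

Lemma iexp_alg c (Ih : I (alg hbar)) (Ic : I (alg (fpsC c * hbar))) :
  iexp Ic = alg (exps c).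
Proof.
apply/completionP => r; rewrite cproj_iexp cproj_alg; apply/qpiP.
have -> : exp_sum (alg (fpsC c * hbar)) r
    = alg (\sum_(k < r) fpsC (fcoef (exps c) k) * hbar ^+ k) :> A.
  rewrite rmorph_sum; apply: eq_bigr => k _; rewrite /ascale -rmorphXn -rmorphM.
  congr alg; rewrite exprMn mulrA; congr (_ * _).
  have fX m : fpsC c ^+ m = fpsC (c ^+ m).
    by elim: m => [|m IH] //; rewrite exprS IH -fpsCM -exprS.
  by rewrite fX -fpsCM mulrC.
have /fps_congB/fps_congP [g e] := @fps_trunc _ (exps c) r.
rewrite -rmorphB e rmorphM rmorphXn; apply: Defs.idealMr; exact: ideal_pow_expr.
Qed.

End CompletedExponential.

(** * Antisymmetric forms *)

Section Antisymmetry.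
Variable C : comNzRingType.

(** Both cocycles have separate formulas for the two signs of the degree; antisymmetry reduces their
    comparison to one sign. *)
Definition antisymmetric_form (A : pzAlgType (fps C)) (phi : A -> A -> fps C) :=
  forall x y, phi x y = - phi y x.

Lemma continuous_form_opp (A : pzAlgType (fps C)) (F : filtration A) phi :
  continuous_form F phi -> continuous_form F (fun x y => - phi y x).
Proof.
move=> [pb pc]; split.
  by split=> k u v t; rewrite ?pb.1 ?pb.2 opprD mulrN.
move=> N; have [r rP] := pc N; exists r => x y Fx; rewrite -oppr0.
by split; apply: fps_congN; have [] := rP _ y Fx.
Qed.

Lemma cont_ext_antisymmetric (A : pzAlgType (fps C)) (F : filtration A) phi :
  continuous_form F phi -> antisymmetric_form phi ->
  antisymmetric_form (cont_ext phi (F := F)).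
Proof.
move=> pc pa X Y; apply: (@cont_extE _ _ _ phi (fun X Y => - cont_ext phi Y X)).
  exact/continuous_form_opp/cont_ext_form.
by move=> x y; rewrite cont_extI // -pa.
Qed.

Lemma mat_form_antisymmetric (A : pzAlgType (fps C)) (phi : A -> A -> fps C) m :
  antisymmetric_form phi -> antisymmetric_form (mat_form phi (m := m)).
Proof.
move=> pa X Y; rewrite /mat_form exchange_big -sumrN /=; apply: eq_bigr => i _.
by rewrite -sumrN; apply: eq_bigr => j _; exact: pa.
Qed.

Lemma continuous_form_approx (A : pzAlgType (fps C)) (F : filtration A) B N :
  continuous_form (cker F) B -> exists r0, forall r X Y x y, (r0 <= r)%N ->
  cproj X r = qpi (F r) x -> cproj Y r = qpi (F r) y ->
  fps_cong N (B X Y) (B (cin F x) (cin F y)).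
Proof.
move=> [Bb Bc]; have [r0 rP] := Bc N; exists r0 => r X Y x y rr Xx Yy.
apply/fps_congB; have -> : B X Y - B (cin F x) (cin F y)
    = B (X - cin F x) Y + B (cin F x) (Y - cin F y).
  by rewrite bilinear_formBl // bilinear_formBr // addrA subrK.
rewrite -[0]addr0; apply: fps_congD.
  by apply: (rP _ _ _).1; apply/cproj_sub0; exact: (@cproj_le _ _ _ _ (cin F x) _ _ rr Xx).
by apply: (rP _ _ _).2; apply/cproj_sub0; exact: (@cproj_le _ _ _ _ (cin F y) _ _ rr Yy).
Qed.

Lemma galg_form_mon (B : lmodType (fps C)) (G : zmodType)
    (S : gsystem B G) (psi : G -> G -> B -> B -> fps C) g h a b :
  (forall b, psi g h 0 b = 0) -> (forall a, psi g h a 0 = 0) ->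
  galg_form psi (<< a *g g >> : galg S) << b *g h >> = psi g h a b.
Proof.
move=> p0l p0r; rewrite /galg_form !msuppU.
case: eqP => [->|_]; first by rewrite big_seq_fset0 p0l.
case: eqP => [->|_]; last by rewrite !big_seq_fset1 !mcoeffUU.
by rewrite big1 // => i _; rewrite big_seq_fset0.
Qed.

Lemma galg_form_antisymmetric (B : lmodType (fps C)) (G : zmodType)
    (S : gsystem B G) (psi : G -> G -> B -> B -> fps C) :
  bilinear_form (galg_form psi : galg S -> galg S -> fps C) ->
  (forall g h a b, galg_form psi (<< a *g g >> : galg S) << b *g h >> =
    - galg_form psi (<< b *g h >> : galg S) << a *g g >>) ->
  antisymmetric_form (galg_form psi : galg S -> galg S -> fps C).
Proof.
move=> pb pa u v; elim/(@galg_ind _ B G S): u => [|u u' Hu Hu'|a g].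
- by rewrite biform0l // biform0r // oppr0.
- by rewrite biformDl // biformDr // Hu Hu' opprD.
elim/(@galg_ind _ B G S): v => [|v v' Hv Hv'|b h].
- by rewrite biform0l // biform0r // oppr0.
- by rewrite biformDl // biformDr // Hv Hv' opprD.
exact: pa.
Qed.

End Antisymmetry.

(** * The algebra of difference operators and its cocycle *)

Section WeylAlgebra.
Variable C : numFieldType.
Local Notation K := (fps C).
Local Notation W := (weyl_alg C).
Local Notation d0 := (wmon 'X 0 : W).

Lemma wmonD (f g : {poly K}) k : wmon (f + g) k = wmon f k + wmon g k :> W.
Proof. exact: monalgUD. Qed.
Lemma wmonZ c (f : {poly K}) k : wmon (c *: f) k = c *~: (wmon f k : W).
Proof. exact/esym/galgZU. Qed.
Lemma wmonM0 (f g : {poly K}) k : wmon f 0 * wmon g k = wmon (f * g) k :> W.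
Proof. by rewrite wmon_mul mulr0z subr0 comp_polyXr add0r. Qed.

(** From x^k d = (d - k hbar) x^k: moving d to the left creates only a multiple of [hbar]. *)
Lemma weyl_alg_nf_comm (b : W) : nf d0 1 (b * d0).
Proof.
elim/(@galg_ind _ _ _ (weyl_system C)): b => [|u v Hu Hv|f k].
- by rewrite mul0r; exact: nf0.
- by rewrite mulrDl; exact: nfD.
rewrite -[<< _ *g _ >>]/(wmon f k) wmon_mul addr0 comp_polyX mulrBr wmonD.
apply: nfD; first by rewrite mulrC -wmonM0; exact: nf_s.
have -> : - (f * (hbar *~ k)%:P) = hbar *: (- (f *~ k)).
  by rewrite polyCMz mulrzAr mulrC mul_polyC scalerN scalerMzr.
by rewrite wmonZ; exact: nf_hbar.
Qed.

Lemma weyl_nf_comm (b : weyl C) : nf (weyl_d C) 1 (b * weyl_d C).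
Proof. exact/nf_comm_in/weyl_alg_nf_comm. Qed.

Lemma weyl_adicP r x : weyl_adic C r x <-> nf (weyl_d C) r x.
Proof.
apply: ideal_pow_nf.
- exact: weyl_nf_comm.
- apply: (@gen_sub _ _ (nf_ideal weyl_nf_comm 1)) => y [->|->].
    by rewrite -[X in nf_ideal _ _ X]mulr1; exact: nf_s.
  by rewrite -[X in nf_ideal _ _ X]mulr1; exact: nf_hbar.
- by apply: sub_gen; left.
- by apply: sub_gen; right.
Qed.

Lemma weyl_adic_in r (x : W) : weyl_adic C r (cin (hbar_fil W) x) <-> nf d0 r x.
Proof.
split; first by move=> /weyl_adicP /nf_of_in.
by move=> nx; apply/weyl_adicP; exact: nf_in.
Qed.

Lemma weyl_adic_hbar r x : weyl_adic C r (hbar ^+ r *~: x).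
Proof. exact/weyl_adicP/nf_hbarX. Qed.

(** At a multiple of [hbar], both generators d and [hbar] take values divisible by [hbar], so order
    r becomes divisibility by hbar^r. The cocycle consists of such values, and this gives its
    continuity. *)
Lemma weyl_nf_eval r (u : W) k c : nf d0 r u -> fps_cong r (u@_k).[c * hbar] 0.
Proof.
elim: r u => [//|r IH] _ [y [z [ny nz ->]]].
have -> : (d0 * y + hbar *~: z)@_k = 'X * y@_k + hbar *: z@_k.
  rewrite mcoeffD; congr (_ + _).
    elim/(@galg_ind _ _ _ (weyl_system C)): (y) => [|u v Hu Hv|f l].
    - by rewrite mulr0 mcoeff0 mulr0.
    - by rewrite mulrDr !mcoeffD Hu Hv mulrDr.
    rewrite -[<< _ *g _ >>]/(wmon f l) wmonM0 !mcoeffU.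
    by case: eqP => _; rewrite ?mulr1n ?mulr0n ?mulr0.
  elim/(@galg_ind _ _ _ (weyl_system C)): (z) => [|u v Hu Hv|f l].
  - by rewrite /ascale mulr0 mcoeff0 scaler0.
  - by rewrite ascaleDr !mcoeffD Hu Hv scalerDr.
  by rewrite galgZU !mcoeffU; case: eqP => _; rewrite ?mulr1n ?mulr0n ?scaler0.
rewrite hornerD hornerZ hornerM hornerX -[0]addr0 -add1n.
apply: fps_congD; apply: fps_congM; try exact: IH.
  by apply: fps_congMl; rewrite -[hbar]expr1 -[_ ^+ _]mulr1; exact: hbar_exp_cong.
by rewrite -[hbar]expr1 -[_ ^+ _]mulr1; exact: hbar_exp_cong.
Qed.

Lemma weyl_alg_form_cong r (u v : W) : nf d0 r u ->
  fps_cong r (weyl_alg_form u v) 0 /\ fps_cong r (weyl_alg_form v u) 0.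
Proof.
move=> nu; have ev k c := @weyl_nf_eval r u k c nu.
split; apply: fps_cong_sum0 => k _; apply: fps_cong_sum0 => l _; case: ifP => // _.
  case: k => p; [|rewrite -[X in fps_cong _ _ X]oppr0; apply: fps_congN];
    apply: fps_cong_sum0 => a _.
    by rewrite mulrC; exact/fps_congMl/ev.
  exact/fps_congMl/ev.
case: k => p; [|rewrite -[X in fps_cong _ _ X]oppr0; apply: fps_congN];
    apply: fps_cong_sum0 => a _.
  exact/fps_congMl/ev.
by rewrite mulrC; exact/fps_congMl/ev.
Qed.

Lemma continuous_weyl_form : continuous_form (weyl_adic C) (@weyl_form C).
Proof.
have [fb _] : continuous_form (cker (hbar_fil W)) (@weyl_form C).
  apply: cont_ext_form; split; first exact: weyl_alg_formP.
  by move=> N; apply: bilinear_form_hbar_cont; exact: weyl_alg_formP.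
(* Modulo hbar^N both arguments can be taken in the uncompleted algebra, the first still of order
   N. *)
split=> // N; exists N => x y /weyl_adicP /(nf_approx N) [x0 [X [nx ->]]].
have [y0 [Y ->]] := hbar_dense y N.
rewrite !(biformDl fb, biformDr fb, biformZl fb, biformZr fb) !weyl_form_in.
have [xy yx] := @weyl_alg_form_cong N x0 y0 nx.
have h := @hbar_exp_cong C N.
split; rewrite -[0]addr0; apply: fps_congD; rewrite -[0]addr0; apply: fps_congD => //;
  by [apply: h | apply: fps_congMl; apply: h].
Qed.

Definition weyl_sum p (f g : {poly K}) : K :=
  \sum_(a < p) f.[a%:R * hbar] * g.[(a%:R - p%:R) * hbar].

Lemma weyl_alg_form_mon k l (f g : {poly K}) :
  weyl_alg_form (wmon f k) (wmon g l) = if k == - l then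
    match k with Posz p => weyl_sum p f g | Negz p => - weyl_sum p.+1 g f end else 0.
Proof.
rewrite /weyl_alg_form galg_form_mon // => [h|h]; case: ifP => // _;
  by case: k => p; rewrite ?big1 ?oppr0 // => a _; rewrite horner0 ?mulr0 ?mul0r.
Qed.

Lemma weyl_form_antisymmetric : antisymmetric_form (@weyl_form C).
Proof.
apply: cont_ext_antisymmetric.
  split; first exact: weyl_alg_formP.
  by move=> N; apply: bilinear_form_hbar_cont; exact: weyl_alg_formP.
apply: galg_form_antisymmetric; first exact: weyl_alg_formP.
move=> k l f g; have := weyl_alg_form_mon k l f g; have := weyl_alg_form_mon l k g f.
rewrite /wmon /weyl_alg_form => -> ->; rewrite -[k == _]eqr_oppLR eq_sym.
case: eqP => [->|_]; last by rewrite oppr0.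
case: k => [[|p]|p]; rewrite ?NegzE ?opprK //= /weyl_sum ?big_ord0 ?oppr0 //.
Qed.

End WeylAlgebra.

Lemma ascale_comm (K : comNzRingType) (A : pzAlgType K) a b (x : A) :
  (a *~: x) * (b *~: x) = (b *~: x) * (a *~: x).
Proof. by rewrite -!ascaleAl -!ascaleAr !ascaleA mulrC. Qed.

(** * The exponentials e^(c d) and the cocycle on e^(c d) x^s *)

Section WeylExponential.
Variable C : numFieldType.
Local Notation K := (fps C).
Local Notation W := (weyl_alg C).
Local Notation cW := (completion (weyl_adic C)).
Local Notation inW := (cin (hbar_fil W)).
Local Notation Iw := (gen [set weyl_d C; alg (hbar : K)]).
Let inWh := cin_alg_hom (hbar_fil W).
Let inCh := cin_alg_hom (weyl_adic C).

Fact Iw_hbar k : Iw (alg (k * hbar)).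
Proof. by rewrite rmorphM; apply: idealMl; apply: sub_gen; right. Qed.

Fact Iw_d c : Iw (fpsC c *~: weyl_d C).
Proof. by apply: idealMl; apply: sub_gen; left. Qed.

Definition wexp (c : C) : cW := iexp (Iw_d c).
Definition wX (s : int) : cW := cin _ (inW (wmon 1 s)).

Lemma wexpD a b : wexp (a + b) = wexp a * wexp b.
Proof.
have I2 : Iw (fpsC a *~: weyl_d C + fpsC b *~: weyl_d C) by apply: idealD; exact: Iw_d.
rewrite /wexp -(iexpD (Iw_d a) (Iw_d b) I2); last exact: ascale_comm.
by apply: cexp_eq; rewrite fpsCD ascaleDl.
Qed.

Lemma wexp0 : wexp 0 = 1.
Proof.
have I0 : Iw 0 by exact: ideal0.
rewrite -(iexp0 I0); apply: cexp_eq.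
by rewrite (_ : fpsC 0 = 0) ?/ascale ?rmorph0 ?mul0r //; apply/fpsP => -[].
Qed.

Lemma weyl_expE n : weyl_exp C n = wexp n%:R.
Proof. by apply: cexp_eq; rewrite /ascale fpsC_nat rmorph_nat. Qed.

Lemma wXD s t : wX s * wX t = wX (s + t).
Proof. by rewrite -(alg_homM inCh) -(alg_homM inWh) wmon_mul comp_polyC mulr1. Qed.


Lemma wX0 : wX 0 = 1.
Proof. by rewrite -(alg_hom1 inCh) -(alg_hom1 inWh) galgE1. Qed.

Lemma fpsC_int (z : int) : fpsC z%:~R = z%:~R :> K.
Proof.
case: z => k; first exact: fpsC_nat.
rewrite NegzE !mulrNz -!pmulrn -[in RHS]fpsC_nat; apply/fpsP => -[|i] //=.
by rewrite oppr0.
Qed.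

(** Conjugation by x^s replaces d by d - s hbar, and the central summand -c s hbar of the new
    exponent splits off as a scalar series. *)
Lemma wX_wexp s c : wX s * wexp c = exps (- (c * s%:~R)) *~: (wexp c * wX s).
Proof.
have I1 := @Iw_hbar (fpsC (- (c * s%:~R))).
have I2 : Iw (fpsC c *~: weyl_d C + alg (fpsC (- (c * s%:~R)) * hbar)).
  by apply: idealD => //; exact: Iw_d.
rewrite [LHS](iexp_conj (Iw_d c) I2).
  rewrite (iexpD (Iw_d c) I1); last exact/esym/alg_central.
  rewrite iexp_alg; last by apply: sub_gen; right.
  by rewrite -alg_central -mulrA.
have -> : alg (fpsC (- (c * s%:~R)) * hbar) = - (fpsC c *~: inW (alg (hbar *~ s))) :> weyl C.
  rewrite (alg_hom_alg inWh) /ascale -rmorphM -rmorphN; congr alg.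
  rewrite -[hbar *~ s]mulrzr -fpsC_int [in RHS]mulrCA -fpsCM -[in RHS]mulrN mulrC; congr (_ * _).
  by apply/fpsP => -[|i] //=; rewrite oppr0.
rewrite -ascaleAr -(alg_homM inWh) wmon_mul mul1r addr0 comp_polyX.
rewrite -!(alg_homZ inWh) -(alg_homN inWh) -(alg_homD inWh) -(alg_homM inWh).
congr inW; have -> : - (fpsC c *~: alg (hbar *~ s)) = fpsC c *~: (- alg (hbar *~ s)) :> W.
  by rewrite /ascale mulrN.
rewrite -ascaleDr -ascaleAl; congr (_ *~: _).
have -> : alg (hbar *~ s) = wmon (hbar *~ s)%:P 0 :> W by rewrite -[_%:P]alg_polyC.
by rewrite -[wmon 'X 0 - _]/(wmon 'X 0 - wmon _ 0 : W) mulrBl !wmonM0 !mulr1 /wmon monalgUB.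
Qed.

Definition wpoly c r : {poly K} :=
  \sum_(k < r) fpsC (k`!%:R^-1) *: (fpsC c *: 'X) ^+ k.

Lemma exp_sum_poly c r : exp_sum (fpsC c *~: weyl_d C) r = inW (wmon (wpoly c r) 0).
Proof.
have -> : wmon (wpoly c r) 0 =
    \sum_(k < r) wmon (fpsC (k`!%:R^-1) *: (fpsC c *: 'X) ^+ k) 0 :> W.
  by apply: (big_morph (fun f => wmon f 0 : W)) => [f g|]; [exact: wmonD|exact: monalgU0].
rewrite (alg_hom_sum inWh); apply: eq_bigr => k _; rewrite wmonZ (alg_homZ inWh).
congr (_ *~: _); rewrite -[fpsC c *~: weyl_d C](alg_homZ inWh) -(alg_homX inWh).
congr inW; rewrite -wmonZ; elim: (k : nat) => [//|j IH].
by rewrite !exprS IH wmonM0.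
Qed.

Lemma wpoly_eval c t r : fps_cong r (wpoly c r).[fpsC t * hbar] (exps (c * t)).
Proof.
apply/fps_congB; rewrite horner_sum.
have -> : \sum_(k < r) (fpsC (k`!%:R^-1) *: (fpsC c *: 'X) ^+ k).[fpsC t * hbar]
    = \sum_(k < r) fpsC (fcoef (exps (c * t)) k) * hbar ^+ k.
  apply: eq_bigr => k _; rewrite hornerZ horner_exp hornerZ hornerX mulrA -fpsCM.
  have fX a m : fpsC a ^+ m = fpsC (a ^+ m) :> K.
    by elim: m => [|m IH] //; rewrite exprS IH -fpsCM -exprS.
  by rewrite exprMn fX mulrA -fpsCM; congr (fpsC _ * _); exact: mulrC.
by move/fps_congB: (@fps_trunc _ (exps (c * t)) r).
Qed.

Lemma wexp_wX_proj c s r :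
  cproj (wexp c * wX s) r = qpi (weyl_adic C r) (inW (wmon (wpoly c r) s)).
Proof.
rewrite cprojM cproj_iexp -[cproj (wX s) r]/(qpi _ (inW (wmon 1 s))) -qpiM.
by rewrite exp_sum_poly -(alg_homM inWh) wmonM0 mulr1.
Qed.

Definition cweyl_form : cW -> cW -> K := cont_ext (@weyl_form C).

(** The cocycle evaluates coefficients at d = a hbar, where e^(c d) becomes the scalar e^(c a hbar);
    truncated exponentials make this precise to every order. *)
Lemma cweyl_form_mon c s c' s' : cweyl_form (wexp c * wX s) (wexp c' * wX s') =
  if s == - s' then match s with
    | Posz p => \sum_(a < p) exps (c * a%:R) * exps (c' * (a%:R - p%:R))
    | Negz p => - \sum_(a < p.+1) exps (c' * a%:R) * exps (c * (a%:R - p.+1%:R)) end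
  else 0.
Proof.
apply: fps_eq_cong => N.
have fc := cont_ext_form (continuous_weyl_form C).
have [r0 rP] := continuous_form_approx N fc.
(* The level [r] must be large for the continuity of the form and also give the truncated
   exponentials the accuracy N. *)
pose r := maxn r0 N; have Nr : (N <= r)%N by exact: leq_maxr.
have := rP r _ _ _ _ (leq_maxl _ _) (wexp_wX_proj c s r) (wexp_wX_proj c' s' r).
rewrite cont_extI; last exact: continuous_weyl_form.
rewrite weyl_form_in weyl_alg_form_mon => e.
have ws p a a' : fps_cong N (weyl_sum p (wpoly a r) (wpoly a' r))
    (\sum_(i < p) exps (a * i%:R) * exps (a' * (i%:R - p%:R))).
  apply: fps_cong_sum => i _; apply: fps_congMM; apply: (fps_cong_le Nr).
    by rewrite -fpsC_nat; exact: wpoly_eval.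
  rewrite (_ : i%:R - p%:R = fpsC (i%:R - p%:R)); first exact: wpoly_eval.
  rewrite fpsCD fpsC_nat; congr (_ + _); rewrite -fpsC_nat.
  by apply/fpsP => -[|j] //=; rewrite oppr0.
move=> i iN; rewrite e //; case: ifP => // _.
by case: s {e} => p; [exact: ws | rewrite !fcoefN ws].
Qed.

Lemma cproj_wexp1 c : cproj (wexp c) 1 = 1.
Proof.
rewrite cproj_iexp /exp_sum big_ord1 expr0 fact0 invr1 ascale1 //.
Qed.

Lemma cproj_wexp2 c : cproj (wexp c) 2 = 1 + qpi _ (fpsC c *~: weyl_d C).
Proof.
rewrite cproj_iexp /exp_sum !big_ord_recr big_ord0 /= add0r qpiD expr0 expr1.
by rewrite fact0 (_ : 1`! = 1%N) // invr1 !ascale1.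
Qed.

End WeylExponential.

(** * The homomorphism on the basis D^k Z^l *)

Section CyclicShift.
Variables (n : nat) (hn : (0 < n)%N).

Fact scol_subproof (a : 'I_n) (l : int) : (`|((a%:Z + l) %% n%:Z)%Z| < n)%N.
Proof.
have n0 : n%:Z != 0 by rewrite eqz_nat -lt0n.
by rewrite -ltz_nat gez0_abs ?modz_ge0 // ltz_mod.
Qed.

(* Row a of the shift matrix to the power l has its entry x^(sdiv a l) in
   column scol a l. *)
Definition scol (a : 'I_n) (l : int) : 'I_n := Ordinal (scol_subproof a l).
Definition sdiv (a : 'I_n) (l : int) : int := ((a%:Z + l) %/ n%:Z)%Z.

Lemma scolE a l : (scol a l)%:Z + n%:Z * sdiv a l = a%:Z + l.
Proof.
have n0 : n%:Z != 0 by rewrite eqz_nat -lt0n.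
by rewrite /= gez0_abs ?modz_ge0 // addrC mulrC -divz_eq.
Qed.

Lemma scol_uniq (a b : 'I_n) l s : b%:Z + n%:Z * s = a%:Z + l ->
  scol a l = b /\ sdiv a l = s.
Proof.
move=> e; have n0 : n%:Z != 0 by rewrite eqz_nat -lt0n.
have bn : (0 <= b%:Z < `|n%:Z|)%R by rewrite /= ltz_nat ltn_ord.
split.
  apply: val_inj; rewrite /= -e addrC mulrC modzMDl modz_small //.
by rewrite /sdiv -e addrC mulrC divzMDl // divz_small // addr0.
Qed.

(** Shifting by l and then by l' is a division with remainder of a + l + l' in which the two
    quotients add up; uniqueness of the division concludes. *)
Lemma scolD a l l' :
  scol (scol a l) l' = scol a (l + l') /\ sdiv a l + sdiv (scol a l) l' = sdiv a (l + l').
Proof.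
have [] := @scol_uniq a (scol (scol a l) l') (l + l') (sdiv a l + sdiv (scol a l) l').
  by rewrite mulrDr [n%:Z * _ + _]addrC addrA scolE addrAC scolE addrA.
by move=> -> ->.
Qed.

Lemma scol0 a : scol a 0 = a /\ sdiv a 0 = 0.
Proof. by apply: scol_uniq; rewrite mulr0. Qed.

End CyclicShift.

Lemma ascale_mul_exchange (K : comNzRingType) (A : pzAlgType K) k k' c (e e' x x' : A) :
  x * e' = c *~: (e' * x) ->
  (k *~: (e * x)) * (k' *~: (e' * x')) = (k * k' * c) *~: ((e * e') * (x * x')).
Proof.
move=> xe; rewrite -ascaleAl -ascaleAr ascaleA -[in RHS]ascaleA; congr (_ *~: _).
by rewrite -[LHS]mulrA [x * _]mulrA xe -ascaleAl -ascaleAr !mulrA.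
Qed.

Lemma weyl_singleE (C : numFieldType) n (a b : 'I_n) X :
  weyl_single a b X = csingle a b X :> weyl_hat C n.
Proof. by []. Qed.

Lemma weyl_xE (C : numFieldType) : cin (weyl_adic C) (weyl_x C) = wX C 1.
Proof. by []. Qed.

Lemma wXE (C : numFieldType) s :
  wX C s = cin (weyl_adic C) (cin (hbar_fil (weyl_alg C)) (wmon 1 s)).
Proof. by []. Qed.

(* Otherwise unification unfolds the nested completions and does not end. *)
Opaque wexp wX csingle.

Section UpsilonBasis.
Variables (C : numFieldType) (n : nat) (w : C) (hn : (0 < n)%N) (hw : w ^+ n = 1).
Local Notation K := (fps C).
Local Notation qq := (root_times_exp hn hw).
Local Notation q := (val qq).
Local Notation cW := (completion (weyl_adic C)).
Local Notation T := (weyl_hat C n).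
Local Notation E := (@csingle _ _ (weyl_adic C) n).
Let uq : q \is a GRing.unit := valP qq.

Definition uexp (k : int) (a : 'I_n) : K := q ^ (k * (n%:Z - 1 - a%:Z)).

Definition uentry k l a : cW :=
  uexp k a *~: (wexp (k * n%:Z)%:~R * wX C (sdiv a l)).

Definition upsilon_mon (k l : int) : T :=
  \sum_(a < n) E a (scol hn a l) (uentry k l a).

Lemma mon_eq (k k' : K) c c' s s' : k = k' -> c = c' -> s = s' ->
  k *~: (wexp c * wX C s) = k' *~: (wexp c' * wX C s').
Proof. by move=> -> -> ->. Qed.

(** Let b and s be the column and the quotient for a + l. Moving x^s past the second exponential
    costs q^(-n k' s), and n-1-b - n s = n-1-a - l turns the total exponent into the one for row a,
    minus l k'. *)
Lemma uentryM k l k' l' a :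
  uentry k l a * uentry k' l' (scol hn a l)
    = q ^ (- (l * k')) *~: uentry (k + k') (l + l') a.
Proof.
rewrite /uentry (ascale_mul_exchange _ _ _ _ (wX_wexp _ _)) wXD -wexpD.
rewrite [RHS]ascaleA; apply: mon_eq; last 2 first.
- by rewrite mulrDl intrD.
- exact: (scolD hn a l l').2.
have -> : - ((k' * n%:Z)%:~R * (sdiv a l)%:~R) = n%:R *~ (- (k' * sdiv a l)) :> C.
  by rewrite -[RHS]mulrzr mulrNz mulrN -!intrM -[n%:R]/(n%:~R) -intrM mulrA [n%:Z * _]mulrC.
rewrite -(q_nmul hn hw) /uexp -!exprzDr //; congr (_ ^ _).
move: (sdiv a l) ((scol hn a l)%:Z) (scolE hn a l) => s b e.
have -> : l = b + n%:Z * s - a%:Z by rewrite e addrC addKr.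
ring.
Qed.

Lemma upsilon_monM k l k' l' : upsilon_mon k l * upsilon_mon k' l'
  = q ^ (- (l * k')) *~: upsilon_mon (k + k') (l + l').
Proof.
rewrite /upsilon_mon mulr_suml [RHS](big_morph _ (ascaleDr _) (mulr0 _)).
apply: eq_bigr => a _; rewrite mulr_sumr (bigD1 (scol hn a l)) //= big1 => [|b ba].
  by rewrite addr0 csingleM uentryM csingleZ (scolD hn a l l').1.
by rewrite csingleM0 // eq_sym.
Qed.

Lemma upsilon_mon0 : upsilon_mon 0 0 = 1.
Proof.
rewrite -csingle_sum1; apply: eq_bigr => a _; have [-> s0] := scol0 hn a.
congr csingle; rewrite /uentry /uexp s0 !mul0r expr0z ascale1 wexp0 mul1r.
by rewrite wX0.
Qed.

Lemma upsilon_mon_D : upsilon_mon 1 0 = upsilon_D qq n.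
Proof.
apply: eq_bigr => a _; have [-> s0] := scol0 hn a.
congr csingle; rewrite /uentry /uexp s0 !mul1r.
have -> : n%:Z - 1 - a%:Z = (n.-1 - a)%N%:Z.
  by have := ltn_ord a; lia.
by rewrite wX0 mulr1 -exprnP -weyl_expE.
Qed.

Lemma upsilon_mon_Z : upsilon_mon 0 1 = upsilon_Z C n.
Proof.
apply: eq_bigr => a _; rewrite /uentry /uexp !mul0r expr0z ascale1 wexp0 mul1r.
have [an|an] := eqVneq (a : nat) n.-1.
  have [-> ->] : scol hn a 1 = Ordinal hn /\ sdiv a 1 = 1.
    by apply: scol_uniq => /=; lia.
  rewrite (bigD1 (Ordinal hn)) //= big1 ?addr0 => [|b b0].
    by rewrite weyl_singleE weyl_xE.
  rewrite (_ : (b == a.+1 :> nat) = false); last by have := ltn_ord b; lia.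
  by rewrite ifN.
have a1 : (a.+1 < n)%N.
  by have := ltn_ord a; lia.
have [-> ->] : scol hn a 1 = Ordinal a1 /\ sdiv a 1 = 0.
  by apply: scol_uniq; rewrite mulr0 addr0 /= -addn1 PoszD.
rewrite (bigD1 (Ordinal a1)) //= eqxx big1 ?addr0 => [|b ba].
  by rewrite weyl_singleE wX0.
rewrite ifN //; apply: contra ba => /eqP e; exact/eqP/val_inj.
Qed.

Lemma upsilon_alg_mapP : exists Y0 : qtorus_alg qq -> T,
  alg_hom Y0 /\ forall k l, Y0 (DZ qq k l) = upsilon_mon k l.
Proof.
pose f (g : int * int) (a : K^o) : T := (a : K) *~: upsilon_mon g.1 g.2.
have fL g k a b : f g (k *: a + b) = k *~: f g a + f g b.
  by rewrite /f ascaleDl ascaleA.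
have fM g h a b : f (g + h) (gmul (qtorus_system qq) g h a b) = f g a * f h b.
  by rewrite /f -ascaleAl -ascaleAr ascaleA upsilon_monM ascaleA.
have f1 : f 0 (gone (qtorus_system qq)) = 1.
  by rewrite /f ascale1 upsilon_mon0.
exists (galg_lift f); split; first exact: galg_lift_alg_hom.
by move=> k l; rewrite /DZ galg_liftU // /f ascale1.
Qed.

End UpsilonBasis.

Section MatrixOne.
Variables (C : comNzRingType) (A : pzAlgType (fps C)).

Lemma scalar_mat_alg_hom m : alg_hom (fun x : A => x%:M : mat A m).
Proof.
split=> [k x y|].
  apply/matrixP=> i j; rewrite [RHS]mxE mat_scale_in !mxE.
  by case: eqP => _; rewrite ?mulr1n ?mulr0n // /ascale mulr0 addr0.
by split=> // x y; exact: scalar_mxM.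
Qed.

Lemma mat1_alg_hom : alg_hom (fun X : mat A 1 => X 0 0).
Proof.
split=> [k X Y|]; first by rewrite mxE mat_scale_in.
by split=> [|X Y]; rewrite mxE // big_ord1.
Qed.

Lemma alg_hom_comp (B D : pzAlgType (fps C)) (f : A -> B) (g : B -> D) :
  alg_hom f -> alg_hom g -> alg_hom (fun x => g (f x)).
Proof.
move=> fh gh; split=> [k x y|]; first by rewrite fh.1 gh.1.
by split=> [|x y]; rewrite ?(alg_hom1 fh) ?(alg_hom1 gh) // (alg_homM fh) (alg_homM gh).
Qed.

Lemma cproj_cong (F : filtration A) (X : completion F) r k k' :
  (forall x, F r (hbar ^+ r *~: x)) -> fps_cong r k k' ->
  cproj (k *~: X) r = cproj (k' *~: X) r.
Proof.
move=> Fh /fps_congB/fps_congP [g kk]; have [x Xx] := cprojE X r.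
rewrite !ascaleE !cprojZ Xx -!qpiZ; apply/qpiP.
have -> : k *~: x - k' *~: x = hbar ^+ r *~: (g *~: x).
  by rewrite ascaleA -kk /ascale rmorphB mulrBl.
exact: Fh.
Qed.

Lemma mat_fil_hbar (F : filtration A) m r :
  (forall x, F r (hbar ^+ r *~: x)) -> forall x, mat_fil m F r (hbar ^+ r *~: x).
Proof. by move=> Fh x; apply/mat_ideal_setE => i j; rewrite mat_scale_in. Qed.

Lemma adic_filtered (B : pzAlgType (fps C)) (G : filtration B) (I : ideal A)
    (f : A -> completion G) : alg_hom f -> fil_mul G ->
  (forall x, G 0%N x) -> (forall x, I x -> cproj (f x) 1 = 0) ->
  forall r x, adic I r x -> cproj (f x) r = 0.
Proof.
move=> fh GM G0 fI.
have P0 r : cproj (f 0) r = 0 by rewrite (alg_hom0 fh).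
have PD r x y : cproj (f x) r = 0 -> cproj (f y) r = 0 -> cproj (f (x + y)) r = 0.
  by move=> fx fy; rewrite (alg_homD fh) cprojD fx fy addr0.
have PMl r a x : cproj (f x) r = 0 -> cproj (f (a * x)) r = 0.
  by move=> fx; rewrite (alg_homM fh) cprojM fx mulr0.
have PMr r a x : cproj (f x) r = 0 -> cproj (f (x * a)) r = 0.
  by move=> fx; rewrite (alg_homM fh) cprojM fx mul0r.
elim=> [|r IH] x.
  by move=> _; have [b ->] := cprojE (f x) 0; apply/qpi_eq0.
apply: (@gen_sub _ _ (Ideal (P0 r.+1) (PD r.+1) (PMl r.+1) (PMr r.+1))).
move=> _ [y [z [/IH fy /fI fz ->]]] /=.
by rewrite (alg_homM fh) -addn1; apply: cprojM0.
Qed.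

End MatrixOne.

(** * Extension to the completions, and uniqueness *)

Section UpsilonExtension.
Variables (C : numFieldType) (n : nat) (w : C) (hn : (0 < n)%N) (hw : w ^+ n = 1).
Local Notation qq := (root_times_exp hn hw).
Local Notation q := (val qq).
Local Notation T := (weyl_hat C n).
Local Notation Q0 := (qtorus_alg qq).
Local Notation Q := (qtorus qq).
Local Notation inQ := (cin (hbar_fil Q0)).
Local Notation U := (@upsilon_mon C n w hn hw).
Local Notation I := (gen [set qtorus_D qq ^+ n - 1; alg (q - fpsC w)]).

Lemma qtorus_hbar : I (alg hbar).
Proof.
have [c uc qw] := q_sub_w hn hw.
have -> : alg hbar = alg c^-1 * alg (q - fpsC w) :> Q.
  by rewrite -rmorphM qw [hbar * c]mulrC mulKr.
by apply: idealMl; apply: sub_gen; right.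
Qed.

Lemma qtorus_adic_hbar r x : qtorus_adic n w qq r (hbar ^+ r *~: x).
Proof.
rewrite /ascale rmorphXn; apply: Defs.idealMr.
exact/ideal_pow_expr/qtorus_hbar.
Qed.

Lemma weyl_hat_hbar r (x : mat (weyl C) n) : mat_fil n (weyl_adic C) r (hbar ^+ r *~: x).
Proof. exact/mat_fil_hbar/weyl_adic_hbar. Qed.

Lemma weyl_hat_mul m : fil_mul (mat_fil m (weyl_adic C)).
Proof. exact/mat_fil_mul/adic_mul. Qed.

Lemma upsilon_monX k m : U k 0 ^+ m = U (k *+ m) 0.
Proof.
elim: m => [|m IH]; first by rewrite mulr0n upsilon_mon0.
by rewrite exprS IH upsilon_monM mul0r oppr0 expr0z ascale1 addr0 mulrS.
Qed.

Lemma uexp_nat (k : nat) a : uexp hn hw k a = q ^+ (k * (n.-1 - a)).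
Proof.
rewrite /uexp [RHS]exprnP PoszM; congr (_ ^ (_ * _)).
by have := ltn_ord a; lia.
Qed.

(** Modulo d and [hbar], exponentials become 1 and [q] becomes [w]; what remains is a diagonal
    matrix of roots of unity times a power of the shift. *)
Lemma upsilon_mon_cproj1 (k : nat) l :
  cproj (U k l) 1 = cproj (\sum_(a < n) csingle a (scol hn a l)
    (fpsC (w ^+ (k * (n.-1 - a))) *~: wX C (sdiv a l))) 1.
Proof.
rewrite !cproj_sum; apply: eq_bigr => a _; apply: csingle_cong.
rewrite /uentry uexp_nat; set W := wX C _.
transitivity (cproj (q ^+ (k * (n.-1 - a)) *~: W) 1).
  by rewrite !ascaleE !cprojZ cprojM cproj_wexp1 mul1r.
by apply: cproj_cong; [exact: weyl_adic_hbar|exact: q_cong].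
Qed.

(** Each diagonal entry reduces to a power of w^n = 1. Thus D^n - 1 is sent to elements of order 1,
    on which the continuity of the homomorphism rests. *)
Lemma upsilon_mon_n1 : cproj (U n 0 - 1) 1 = 0.
Proof.
apply/cproj_sub0; rewrite upsilon_mon_cproj1 -csingle_sum1 !cproj_sum.
apply: eq_bigr => a _; have [-> ->] := scol0 hn a.
by rewrite exprM hw expr1n ascale1 wX0.
Qed.

(** Linearity over C[[hbar]] extends the map to the hbar-adic completion. There the adic filtration
    is respected as soon as the two generators of the ideal have images of order 1. *)
Lemma upsilon_qtorusP : exists Y1 : Q -> T,
  [/\ alg_hom Y1, forall r x, qtorus_adic n w qq r x -> cproj (Y1 x) r = 0,
      forall r x, hbar_fil Q0 r x -> cproj (Y1 (inQ x)) r = 0 &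
      forall k l, Y1 (inQ (DZ qq k l)) = U k l].
Proof.
have [Y0 [Yh YU]] := upsilon_alg_mapP hn hw.
have Y0h r x : hbar_fil Q0 r x -> cproj (Y0 x) r = 0.
  move=> [y ->]; rewrite (alg_homZ Yh) ascaleE cprojZ.
  have [z ->] := cprojE (Y0 y) r; rewrite -qpiZ; apply/qpi_eq0; exact: weyl_hat_hbar.
have [Y1 [Y1h Y1i]] : exists Y1 : Q -> T, alg_hom Y1 /\ forall x, Y1 (inQ x) = Y0 x.
  exists (cext (alg_homB Yh) Y0h); split; first exact: cext_alg_hom.
  by move=> x; exact: cext_in.
exists Y1; split=> // [|r x /Y0h|k l]; rewrite ?Y1i //.
apply: adic_filtered => //; first exact: weyl_hat_mul.
  by move=> x; apply/mat_ideal_setE.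
have P0 : cproj (Y1 0) 1 = 0 by rewrite (alg_hom0 Y1h).
have PD x y : cproj (Y1 x) 1 = 0 -> cproj (Y1 y) 1 = 0 -> cproj (Y1 (x + y)) 1 = 0.
  by move=> fx fy; rewrite (alg_homD Y1h) cprojD fx fy addr0.
have PMl a x : cproj (Y1 x) 1 = 0 -> cproj (Y1 (a * x)) 1 = 0.
  by move=> fx; rewrite (alg_homM Y1h) cprojM fx mulr0.
have PMr a x : cproj (Y1 x) 1 = 0 -> cproj (Y1 (x * a)) 1 = 0.
  by move=> fx; rewrite (alg_homM Y1h) cprojM fx mul0r.
apply: (@gen_sub _ _ (Ideal P0 PD PMl PMr)) => x [->|->] /=.
  rewrite (alg_homB Y1h) (alg_hom1 Y1h) (alg_homX Y1h) Y1i YU upsilon_monX.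
  by rewrite natz upsilon_mon_n1.
rewrite (alg_hom_alg Y1h); have [c _ ->] := q_sub_w hn hw; rewrite rmorphM.
have h0 : cproj (alg hbar : T) 1 = 0.
  rewrite cproj_alg; apply/qpi_eq0.
  by have := @weyl_hat_hbar 1 1; rewrite expr1 /ascale mulr1.
by rewrite cprojM [X in X * _]h0 mul0r.
Qed.

End UpsilonExtension.

Section UpsilonOne.
Variables (C : numFieldType) (n : nat) (w : C) (hn : (0 < n)%N) (hw : w ^+ n = 1).
Local Notation qq := (root_times_exp hn hw).
Local Notation T := (weyl_hat C n).
Local Notation Q0 := (qtorus_alg qq).
Local Notation Q := (qtorus qq).
Local Notation inQ := (cin (hbar_fil Q0)).
Local Notation Qhat := (qtorus_hat n w qq).
Local Notation U := (@upsilon_mon C n w hn hw).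

(** On the uncompleted algebra a homomorphism is determined by the images of D and Z, so uniqueness
    is tested on this dense set. *)
Definition qtorus_dense m : set (Qhat m) :=
  [set X | exists M : mat Q0 m, X = cin _ (\matrix_(i, j) inQ (M i j) : mat Q m)].

Lemma qtorus_denseP m (X : Qhat m) r :
  exists2 Y, qtorus_dense Y & cproj X r = cproj Y r.
Proof.
have [x Xx] := cprojE X r.
have /choice [f fP] (p : 'I_m * 'I_m) : exists y,
    exists Y, x p.1 p.2 = inQ y + hbar ^+ r *~: Y.
  exact: hbar_dense.
pose M : mat Q0 m := \matrix_(i, j) f (i, j).
exists (cin _ (\matrix_(i, j) inQ (M i j) : mat Q m)); first by exists M.
rewrite Xx; apply/qpiP/mat_ideal_setE => i j; rewrite !mxE.
have [Y ->] := fP (i, j); rewrite addrC addKr; exact: qtorus_adic_hbar.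
Qed.

Lemma qtorus_scalar_alg_hom :
  alg_hom (fun x : Q0 => qtorus_in n w ((inQ x)%:M : mat Q 1)).
Proof.
apply: (alg_hom_comp _ (cin_alg_hom _)).
exact: (alg_hom_comp (cin_alg_hom _) (scalar_mat_alg_hom Q 1)).
Qed.

Lemma upsilon1P : exists Y1 : Q -> T, exists Y : Qhat 1 -> T,
  [/\ unique (@is_upsilon1 C n w qq) Y, alg_hom Y1 & alg_hom Y] /\
  [/\ forall r X, cproj X r = 0 -> cproj (Y X) r = 0,
      forall M, Y (qtorus_in n w M) = Y1 (M 0 0),
      forall r x, qtorus_adic n w qq r x -> cproj (Y1 x) r = 0,
      forall r x, hbar_fil Q0 r x -> cproj (Y1 (inQ x)) r = 0 &
      forall k l, Y1 (inQ (DZ qq k l)) = U k l].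
Proof.
have [Y1 [Y1h Y1f Y1hb Y1U]] := upsilon_qtorusP hn hw.
have fh : alg_hom (fun M : mat Q 1 => Y1 (M 0 0)).
  exact: (alg_hom_comp (mat1_alg_hom Q) Y1h).
have fF r (M : mat Q 1) : mat_fil 1 (qtorus_adic n w qq) r M -> cproj (Y1 (M 0 0)) r = 0.
  by move=> /mat_ideal_setE FM; exact: Y1f.
have [Y [Yh Y0 Yi]] : exists Y : Qhat 1 -> T, [/\ alg_hom Y,
    forall r X, cproj X r = 0 -> cproj (Y X) r = 0 &
    forall M, Y (qtorus_in n w M) = Y1 (M 0 0)].
  exists (cext (alg_homB fh) fF); split; first exact: cext_alg_hom.
    by move=> r X; exact: cext0.
  by move=> M; exact: cext_in.
exists Y1, Y; split=> //; split=> //.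
have scal (x : Q) : (x%:M : mat Q 1) 0 0 = x by rewrite mxE.
have Yup : is_upsilon1 Y.
  split=> //.
  - exact: (comp_nbhs_continuous (alg_homB Yh) Y0).
  - by rewrite Yi scal Y1U upsilon_mon_D.
  - by rewrite Yi scal Y1U upsilon_mon_Z.
split=> // Y' [Yh' Yc' YD' YZ'].
have [_ Yc YD YZ] := Yup.
apply: (continuous_dense_eq (D := @qtorus_dense 1) Yc Yc' (@qtorus_denseP 1)).
move=> _ [M ->].
have -> : (\matrix_(i, j) inQ (M i j) : mat Q 1) = (inQ (M 0 0))%:M.
  by apply/matrixP=> i j; rewrite !mxE !ord1.
(* For k l = 0 this exhibits two-sided inverses of the images of D and Z, which the universal
   property asks for. *)
have UV k l : U k l * U (- k) (- l) = (val qq) ^ (l * k) *~: 1.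
  by rewrite upsilon_monM mulrN opprK !subrr upsilon_mon0.
have z0 : (val qq) ^ (0 : int) *~: 1 = 1 :> T by rewrite expr0z ascale1.
have := UV 1 0; have := UV (-1) 0; have := UV 0 1; have := UV 0 (-1).
rewrite !mulr0 !mul0r !oppr0 !opprK z0 => zz z'z dd' d'd.
have dz : U 1 0 * U 0 1 = val qq *~: (U 0 1 * U 1 0).
  rewrite !upsilon_monM ascaleA mul0r mulr1 oppr0 expr0z !addr0 !add0r.
  by rewrite exprN1 mulrV ?ascale1 //; exact: valP.
(* Both candidates restrict to homomorphisms with the same values at D and Z, so both equal [h]. *)
have [h [_ hu]] := qtorus_alg_universal d'd dd' z'z zz dz.
have e1 := hu _ (And3 (alg_hom_comp qtorus_scalar_alg_hom Yh)
  (etrans YD (esym (upsilon_mon_D hn hw))) (etrans YZ (esym (upsilon_mon_Z hn hw)))).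
have e2 := hu _ (And3 (alg_hom_comp qtorus_scalar_alg_hom Yh')
  (etrans YD' (esym (upsilon_mon_D hn hw))) (etrans YZ' (esym (upsilon_mon_Z hn hw)))).
exact: (congr1 (fun f => f (M 0 0)) (etrans (esym e1) e2)).
Qed.

End UpsilonOne.

(** * Comparison of the cocycles *)

(** Raising p by one lengthens exactly one inner sum, the one with n dividing a + p + 1, and the
    term added there has index p. *)
Lemma sum_cyclic_shift (V : nmodType) n p (G : nat -> V) : (0 < n)%N ->
  \sum_(a < n) \sum_(j < (a + p) %/ n) G (n.-1 - a + n * j)%N = \sum_(i < p) G i.
Proof.
move=> n0; elim: p => [|p IH].
  rewrite big_ord0 big1 // => a _; rewrite addn0 divn_small ?ltn_ord //.
  by rewrite big_ord0.
rewrite big_ord_recr -IH /=.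
transitivity (\sum_(a < n) (\sum_(j < (a + p) %/ n) G (n.-1 - a + n * j)%N
    + if (n %| (a + p).+1)%N then G p else 0)).
  apply: eq_bigr => a _; rewrite addnS divnS //.
  case: ifP => [/dvdnP [t ap]|_]; last by rewrite add0n addr0.
  rewrite add1n big_ord_recr /=; congr (_ + G _).
  have [s ts] : exists s, t = s.+1 by case: t ap => // s _; exists s.
  have -> : ((a + p) %/ n)%N = s.
    have -> : (a + p = s * n + n.-1)%N by move: ap; rewrite ts; nia.
    by rewrite divnMDl // divn_small ?addn0 // prednK.
  by have := ltn_ord a; move: ap; rewrite ts; nia.
rewrite big_split /=; congr (_ + _).
(* This is the row whose inner sum grows: a + p + 1 is divisible by [n] exactly for a = n-1 - (p mod
   n). *)
have a0n : (n.-1 - p %% n < n)%N by lia.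
rewrite (bigD1 (Ordinal a0n)) //= big1 ?addr0.
  rewrite ifT //; apply/dvdnP; exists (p %/ n).+1.
  by rewrite {2}(divn_eq p n); have := ltn_pmod p n0; nia.
move=> a aa; rewrite ifN //; apply: contra aa => /dvdnP [t ap].
apply/eqP/val_inj => /=; have := ltn_pmod p n0; have := ltn_ord a.
move: ap; rewrite {1}(divn_eq p n) => ap an rn.
have e : (t = (p %/ n).+1)%N by nia.
by move: ap; rewrite e mulSn; lia.
Qed.

(** This reflects 1 - x^l = -x^l (1 - x^(-l)). It is checked on the sums themselves because 1 - x
    vanishes for x = 1, a value that does occur, at k + k' = 0. *)
Lemma geom_opp (C : comNzRingType) l (x : fps C) : x \is a GRing.unit ->
  geom l x = - (x ^ l * geom (- l) x).
Proof.
move=> ux; have pos p : geom p.+1%:Z x = - (x ^ p.+1%:Z * geom (Negz p) x).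
  rewrite /= mulrN opprK mulr_sumr (reindex_inj rev_ord_inj) /=.
  apply: eq_bigr => j _; rewrite -exprzDr // exprnP; congr (x ^ _).
  by have := ltn_ord j; lia.
case: l => [[|p]|p]; first by rewrite oppr0 /= big_ord0 mulr0 oppr0.
  exact: pos.
rewrite NegzE opprK pos mulrN opprK mulrA -exprzDr // addNr expr0z mul1r.
by rewrite NegzE.
Qed.

Section QTorusForm.
Variables (C : numFieldType) (qq : fps_unit C).
Local Notation q := (val qq).
Local Notation Q0 := (qtorus_alg qq).

Lemma qtorus_alg_form_mon k l k' l' a b :
  qtorus_alg_form (<< a *g (k, l) >> : Q0) << b *g (k', l') >> =
  if l == - l' then a * b * (q ^ (- (l * k')) * geom l (q ^ (k + k'))) else 0.
Proof.
by rewrite /qtorus_alg_form galg_form_mon //= => c; case: ifP => //; rewrite ?mulr0 ?mul0r.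
Qed.

Lemma qtorus_alg_form_antisymmetric : antisymmetric_form (@qtorus_alg_form C qq).
Proof.
apply: galg_form_antisymmetric; first exact: qtorus_alg_formP.
move=> [k l] [k' l'] a b.
have := qtorus_alg_form_mon k l k' l' a b; have := qtorus_alg_form_mon k' l' k l b a.
rewrite /qtorus_alg_form => -> ->; rewrite -[l == _]eqr_oppLR eq_sym.
case: eqP => [->|_]; last by rewrite oppr0.
have uq : q \is a GRing.unit := valP qq.
rewrite (@geom_opp _ l _ (unitrXz (k + k') uq)) exprz_exp !mulrN.
congr (- _); rewrite [b * a]mulrC [k' + k]addrC.
rewrite [q ^ _ * (q ^ _ * _)]mulrA -exprzDr //; congr (_ * (q ^ _ * _)); ring.
Qed.

End QTorusForm.

Section FormComparison.
Variables (C : numFieldType) (n : nat) (w : C) (hn : (0 < n)%N) (hw : w ^+ n = 1).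
Local Notation K := (fps C).
Local Notation qq := (root_times_exp hn hw).
Local Notation q := (val qq).
Local Notation U := (@upsilon_mon C n w hn hw).
Let uq : q \is a GRing.unit := valP qq.

Definition cweyl_mat_form m : weyl_hat C m -> weyl_hat C m -> K :=
  cont_ext (@mat_form K (weyl C) (@weyl_form C) m).

Lemma cweyl_mat_form_cont m :
  continuous_form (cker (mat_fil m (weyl_adic C))) (@cweyl_mat_form m).
Proof. exact/cont_ext_form/continuous_mat_form/continuous_weyl_form. Qed.

Lemma cweyl_form_cont : continuous_form (cker (weyl_adic C)) (@cweyl_form C).
Proof. exact/cont_ext_form/continuous_weyl_form. Qed.

Lemma cweyl_mat_form_in m (X Y : mat (weyl C) m) :
  cweyl_mat_form (cin _ X) (cin _ Y) = mat_form (@weyl_form C) X Y.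
Proof. exact/cont_extI/continuous_mat_form/continuous_weyl_form. Qed.

Lemma range_cin_dense (A : pzAlgType K) (F : filtration A) (X : completion F) r :
  exists2 Y, range (cin F) Y & cproj X r = cproj Y r.
Proof.
exists (cin F (qrepr (cproj X r))); first by exists (qrepr (cproj X r)).
by rewrite cproj_repr.
Qed.

Lemma continuous_form_if (A : pzAlgType K) (F : filtration A) (b : bool) B :
  continuous_form F B -> continuous_form F (fun x y => if b then B x y else 0).
Proof.
case: b => // _; split; first by split=> *; rewrite mulr0 addr0.
by move=> N; exists 0%N.
Qed.

Lemma cweyl_mat_form_single (a b c d : 'I_n) u v :
  cweyl_mat_form (csingle a b u) (csingle c d v)
    = if (b == c) && (d == a) then cweyl_form u v else 0.
Proof.
pose B u v := cweyl_mat_form (csingle a b u) (csingle c d v).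
pose B' u v := if (b == c) && (d == a) then cweyl_form u v else 0 : K.
apply: (@continuous_form_eq _ _ _ _ B B' _ _ (@range_cin_dense _ (weyl_adic C))).
- apply: (continuous_form_comp _ _ _ _ (cweyl_mat_form_cont n)).
  + exact: csingle_lin.
  + exact: csingle_lin.
  + exact: csingle_cproj0.
  + exact: csingle_cproj0.
- exact/continuous_form_if/cweyl_form_cont.
move=> _ _ [x _ <-] [y _ <-]; rewrite /B /B' !csingle_in cweyl_mat_form_in.
rewrite mat_form_single; last by have [] := continuous_weyl_form C.
by rewrite /cweyl_form cont_extI //; exact: continuous_weyl_form.
Qed.

Lemma cweyl_mat_form_block m (a b c d : 'I_m) (T V : weyl_hat C n) :
  cweyl_mat_form (cblock a b T) (cblock c d V)
    = if (b == c) && (d == a) then cweyl_mat_form T V else 0.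
Proof.
pose B u v := cweyl_mat_form (cblock (n := n) (G := weyl_adic C) a b u) (cblock c d v).
pose B' u v := if (b == c) && (d == a) then cweyl_mat_form (m := n) u v else 0 : K.
apply: (@continuous_form_eq _ _ _ _ B B' _ _ (@range_cin_dense _ (mat_fil n (weyl_adic C)))).
- apply: (continuous_form_comp _ _ _ _ (cweyl_mat_form_cont (m * n))).
  + exact: cblock_lin.
  + exact: cblock_lin.
  + move=> r x; exact: cmap0r.
  + move=> r x; exact: cmap0r.
- exact/continuous_form_if/cweyl_mat_form_cont.
move=> _ _ [x _ <-] [y _ <-]; rewrite /B /B' ![cblock _ _ _]cmap_in !cweyl_mat_form_in.
by rewrite mat_form_block //; have [] := continuous_weyl_form C.
Qed.

Lemma uentry_form k l k' l' (a : 'I_n) :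
  cweyl_form (uentry hn hw k l a) (uentry hn hw k' l' (scol hn a l)) =
  uexp hn hw k a * uexp hn hw k' (scol hn a l) *
  cweyl_form (wexp (k * n%:Z)%:~R * wX C (sdiv a l))
    (wexp (k' * n%:Z)%:~R * wX C (sdiv (scol hn a l) l')).
Proof.
have [fb _] := cweyl_form_cont.
by rewrite /uentry (biformZl fb) (biformZr fb) mulrA.
Qed.

(** The trace pairs row a of the first matrix with row [scol hn a l] of the second, whose only entry
    contributes when it lies in column a. *)
Lemma upsilon_form_sum k l k' l' : cweyl_mat_form (U k l) (U k' l') =
  \sum_(a < n) if scol hn (scol hn a l) l' == a then
    uexp hn hw k a * uexp hn hw k' (scol hn a l) *
    cweyl_form (wexp (k * n%:Z)%:~R * wX C (sdiv a l))
      (wexp (k' * n%:Z)%:~R * wX C (sdiv (scol hn a l) l')) else 0.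
Proof.
have [fb _] := cweyl_mat_form_cont n.
rewrite (biform_suml fb); apply: eq_bigr => a _.
rewrite (biform_sumr fb) (bigD1 (scol hn a l)) //= big1 ?addr0 => [|c ca].
  rewrite cweyl_mat_form_single eqxx /=; case: eqP => // e.
  exact: uentry_form.
by rewrite cweyl_mat_form_single eq_sym (negPf ca).
Qed.

(** A contribution requires a return to column a and opposite powers of x; the relation [scolE] for
    l + l' then forces l + l' = 0. *)
Lemma upsilon_form0 k l k' l' : l != - l' -> cweyl_mat_form (U k l) (U k' l') = 0.
Proof.
move=> ll; rewrite upsilon_form_sum big1 // => a _; case: eqP => // e.
rewrite cweyl_form_mon ifN ?mulr0 //; apply: contra ll => /eqP ss.
have [c1 c2] := scolD hn a l l'; have := scolE hn a (l + l').
by rewrite -c1 -c2 e ss addNr mulr0; lia.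
Qed.

(** Let b and s be the column and the quotient for a + p. By b + n s = a + p, the j-th term of row a
    is the power of [q] on the right with i = n-1-a + n j. *)
Lemma upsilon_form_pos k k' p :
  cweyl_mat_form (U k p%:Z) (U k' (- p%:Z)) =
  \sum_(i < p) q ^ (i%:Z * k + (i%:Z - p%:Z) * k').
Proof.
rewrite upsilon_form_sum -(sum_cyclic_shift p (fun i => q ^ (i%:Z * k + (i%:Z - p%:Z) * k')) hn).
apply: eq_bigr => a _; have [c1 c2] := scolD hn a p%:Z (- p%:Z).
have [d1 d2] := scol0 hn a; rewrite subrr d1 in c1; rewrite subrr d2 in c2.
rewrite c1 eqxx cweyl_form_mon.
have s2 : sdiv a p%:Z = - sdiv (scol hn a p%:Z) (- p%:Z) by apply/eqP; rewrite -addr_eq0 c2.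
rewrite -s2 eqxx.
have sp : sdiv a p%:Z = ((a + p) %/ n)%N%:Z by rewrite /sdiv -PoszD divz_nat.
have := scolE hn a p%:Z; rewrite sp; set s := ((a + p) %/ n)%N.
set b := scol hn a p%:Z => ab; rewrite mulr_sumr; apply: eq_bigr => j _.
have ex (k0 i : int) : exps ((k0 * n%:Z)%:~R * i%:~R : C) = q ^ (n%:Z * (k0 * i)).
  rewrite (q_nmul hn hw) -[_ *~ (k0 * i)]mulrzr -[n%:R]/(n%:~R) -!intrM.
  by congr (exps _%:~R); ring.
have -> : j%:R - s%:R = (j%:Z - s%:Z)%:~R :> C by rewrite intrB.
rewrite -[j%:R]/(j%:~R) !ex /uexp -!exprzDr //; congr (_ ^ _).
have aj : (n.-1 - a + n * j)%N%:Z = n%:Z - 1 - a%:Z + n%:Z * j%:Z :> int.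
  by have := ltn_ord a; lia.
rewrite aj; have -> : p%:Z = b%:Z + n%:Z * s%:Z - a%:Z by rewrite ab addrC addKr.
ring.
Qed.

(** For l = p >= 0 the sum over i is q^(-p k') times a geometric sum in q^(k+k'), which is the
    source cocycle; the other sign follows by antisymmetry. *)
Lemma upsilon_form_mon k l k' l' : cweyl_mat_form (U k l) (U k' l') =
  qtorus_alg_form (DZ qq k l) (DZ qq k' l').
Proof.
have pos k1 k2 p : cweyl_mat_form (U k1 p%:Z) (U k2 (- p%:Z)) =
    qtorus_alg_form (DZ qq k1 p%:Z) (DZ qq k2 (- p%:Z)).
  rewrite upsilon_form_pos /DZ qtorus_alg_form_mon opprK eqxx !mul1r mulr_sumr.
  apply: eq_bigr => i _; rewrite exprnP exprz_exp -exprzDr //; congr (_ ^ _); ring.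
have [->|ll] := eqVneq l (- l'); last first.
  by rewrite upsilon_form0 // /DZ qtorus_alg_form_mon (negPf ll).
case: l' => p; last by rewrite NegzE opprK pos.
have anti : antisymmetric_form (@cweyl_mat_form n).
  apply: cont_ext_antisymmetric; first exact/continuous_mat_form/continuous_weyl_form.
  exact/mat_form_antisymmetric/weyl_form_antisymmetric.
by rewrite anti [RHS]qtorus_alg_form_antisymmetric pos.
Qed.

End FormComparison.

(** * The homomorphism of central extensions *)

Section UpsilonBar.
Variables (C : numFieldType) (n : nat) (w : C) (hn : (0 < n)%N) (hw : w ^+ n = 1).
Local Notation K := (fps C).
Local Notation qq := (root_times_exp hn hw).
Local Notation T := (weyl_hat C n).
Local Notation Q0 := (qtorus_alg qq).
Local Notation Q := (qtorus qq).
Local Notation inQ := (cin (hbar_fil Q0)).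
Local Notation Qhat := (qtorus_hat n w qq).
Variables (Y1 : Q -> T) (Y : Qhat 1 -> T).
Hypotheses (Y1h : alg_hom Y1) (Yh : alg_hom Y).
Hypothesis Y0 : forall r X, cproj X r = 0 -> cproj (Y X) r = 0.
Hypothesis Yin : forall M, Y (qtorus_in n w M) = Y1 (M 0 0).
Hypothesis Y1hb : forall r x, hbar_fil Q0 r x -> cproj (Y1 (inQ x)) r = 0.
Hypothesis Y1U : forall k l, Y1 (inQ (DZ qq k l)) = upsilon_mon hn hw k l.

Lemma qtorus_form_cont : continuous_form (cker (hbar_fil Q0)) (@qtorus_form C qq).
Proof.
apply: cont_ext_form; split; first exact: qtorus_alg_formP.
by move=> N; apply: bilinear_form_hbar_cont; exact: qtorus_alg_formP.
Qed.

Lemma Y1_cker r X : cproj X r = 0 -> cproj (Y1 X) r = 0.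
Proof.
move=> X0; have [x Xx] := cprojE X r.
have /hbar_kerP [Z e] : cproj (X - inQ x) r = 0 by apply/cproj_sub0.
rewrite -(subrK (inQ x) X) e (alg_homD Y1h) (alg_homZ Y1h) cprojD ascaleE cprojZ.
rewrite Y1hb ?addr0; last by apply/qpi_eq0; rewrite -Xx.
have [z ->] := cprojE (Y1 Z) r; rewrite -qpiZ; apply/qpi_eq0; exact: weyl_hat_hbar.
Qed.

Lemma upsilon_form x y : cweyl_mat_form (Y1 x) (Y1 y) = qtorus_form x y.
Proof.
have Bc : continuous_form (cker (hbar_fil Q0)) (fun x y => cweyl_mat_form (Y1 x) (Y1 y)).
  apply: (continuous_form_comp Y1h.1 Y1h.1 _ _ (cweyl_mat_form_cont C n));
    exact: Y1_cker.
apply: (continuous_form_eq Bc qtorus_form_cont (@range_cin_dense C _ (hbar_fil Q0))).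
move=> _ _ [u _ <-] [v _ <-]; rewrite qtorus_form_in.
have [fb _] := cweyl_mat_form_cont C n; have gb := @qtorus_alg_formP C qq.
have inh := alg_hom_comp (cin_alg_hom (hbar_fil Q0)) Y1h.
have inZ (a : K) z : Y1 (inQ (a *~: z)) = a *~: Y1 (inQ z) by exact: (alg_homZ inh a z).
have DZE a k l : << a *g (k, l) >> = (a : K) *~: DZ qq k l.
  by rewrite galgZU; congr << _ *g _ >>; exact/esym/mulr1.
have mon (a b : K) k l k' l' : cweyl_mat_form (Y1 (inQ (a *~: DZ qq k l)))
    (Y1 (inQ (b *~: DZ qq k' l')))
    = qtorus_alg_form (a *~: DZ qq k l) (b *~: DZ qq k' l').
  apply: (etrans (f_equal2 (@cweyl_mat_form C n) (inZ a _) (inZ b _))).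
  rewrite (biformZl fb).
  rewrite (biformZr fb).
  rewrite (biformZl gb).
  rewrite (biformZr gb).
  by rewrite !Y1U upsilon_form_mon.
elim/(@galg_ind _ _ _ (qtorus_system qq)): u => [|u u' Hu Hu'|a [k l]].
- by rewrite (alg_hom0 inh) (biform0l fb) (biform0l gb).
- by rewrite (alg_homD inh) (biformDl fb) (biformDl gb) Hu Hu'.
elim/(@galg_ind _ _ _ (qtorus_system qq)): v => [|v v' Hv Hv'|b [k' l']].
- by rewrite (alg_hom0 inh) (biform0r fb) (biform0r gb).
- by rewrite (alg_homD inh) (biformDr fb) (biformDr gb) Hv Hv'.
have := mon a b k l k' l'.
by rewrite -!DZE.
Qed.

Variable m : nat.
Let Ym := kron_ext Y (m := m).

(** Blocks at (a,b) and (c,d) pair to zero unless c = b and d = a, so the form on block matrices is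
    again a trace over the outer indices. *)
Lemma kron_ext_form (X X' : Qhat m) :
  cont_ext (@mat_form K Q (@qtorus_form C qq) m) X X'
    = cweyl_mat_form (Ym X) (Ym X').
Proof.
have Ymh : alg_hom Ym by exact: kron_ext_alg_hom.
apply: (@cont_extE _ _ _ _ (fun X X' => cweyl_mat_form (Ym X) (Ym X'))).
  apply: (continuous_form_comp Ymh.1 Ymh.1 _ _ (cweyl_mat_form_cont C (m * n)));
    move=> r x; exact: kron_ext_cproj0.
move=> x y; rewrite /Ym !kron_ext_in.
have [fb _] := cweyl_mat_form_cont C (m * n).
have Ye a b (z : mat Q m) : Y (cin _ (mentry a b z)) = Y1 (z a b).
  by rewrite [LHS]Yin mxE.
rewrite (biform_suml fb); apply: eq_bigr => a _.
rewrite (biform_suml fb); apply: eq_bigr => b _.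
rewrite (biform_sumr fb) (bigD1 b) //= (biform_sumr fb) (bigD1 a) //=.
rewrite cweyl_mat_form_block !eqxx !Ye upsilon_form [X in _ + X + _]big1 => [|d /negPf da].
  rewrite big1 ?addr0 // => c cb; rewrite (biform_sumr fb) big1 // => d _.
  by rewrite cweyl_mat_form_block eq_sym (negPf cb).
by rewrite cweyl_mat_form_block da andbF.
Qed.

(** The cocycles agree exactly, not just up to a coboundary, so the central component is kept
    unchanged. *)
Definition upsilon_bar (u : qtorus_ext n w qq m) : weyl_ext C (m * n) := (Ym u.1, u.2).

Lemma upsilon_barP : unique (is_upsilon_bar Ym) upsilon_bar.
Proof.
have Ymh : alg_hom Ym by exact: kron_ext_alg_hom.
have Ym0 r X : cproj X r = 0 -> cproj (Ym X) r = 0 by exact: kron_ext_cproj0.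
split.
  split=> [|s||A]; last by [].
  - split=> [k u v|u v]; first by congr pair; exact: Ymh.1.
    congr pair; last exact: kron_ext_form.
    by rewrite /= (alg_homB Ymh) !(alg_homM Ymh).
  - exists s => u v [uv1 uv2]; split=> //.
    by rewrite -[(_ - _).1]/(Ym u.1 - Ym v.1) -(alg_homB Ymh); exact: Ym0.
  - by rewrite /upsilon_bar /central_c /= (alg_hom0 Ymh).
move=> Z [[Zl _] Zc Zcc Zin]; apply/funext => -[X k].
have ZD u v : Z (u + v) = Z u + Z v by rewrite -[u]scale1r Zl !scale1r.
have Z0 : Z 0 = 0 by apply: (addrI (Z 0)); rewrite -ZD !addr0.
have ZZ a u : Z (a *: u) = a *: Z u by rewrite -[a *: u]addr0 Zl Z0 addr0.
have e : (X, k) = central_in X + k *: central_c _ :> qtorus_ext n w qq m.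
  by congr pair; rewrite /= ?scaler0 ?addr0 // add0r; exact/esym/mulr1.
rewrite [in RHS]e ZD ZZ Zcc {e}.
have -> : Z (central_in X) = central_in (Ym X).
  have near s : central_nbhs s (Z (central_in X) - central_in (Ym X)).
    (* The map [Z] is prescribed only on matrices over the quantum torus before the adic completion.
       Agreement of X and A at level [r] controls [Z], agreement at level [s] controls [Ym]. *)
    have [r rP] := Zc s; have [A XA] := cprojE X (maxn r s).
    have XAr t : (t <= maxn r s)%N -> cproj (X - qtorus_in n w A) t = 0.
      by move=> ts; apply/cproj_sub0; exact: (cproj_le ts).
    have [n1 n2] : central_nbhs s (Z (central_in X) - Z (central_in (qtorus_in n w A))).
      by apply: rP; split; [exact/XAr/leq_maxl|rewrite /= subr0].
    split; last by move: n2; rewrite Zin.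
    have {}n1 : cproj ((Z (central_in X)).1 - Ym (qtorus_in n w A)) s = 0.
      by move: n1; rewrite Zin.
    have /Ym0 : cproj (X - qtorus_in n w A) s = 0 by exact/XAr/leq_maxr.
    rewrite (alg_homB Ymh) => /cproj_sub0 e.
    change (cproj ((Z (central_in X)).1 - Ym X) s = 0).
    by apply/cproj_sub0; rewrite e; exact/cproj_sub0.
  rewrite [LHS]surjective_pairing; congr pair.
    by apply/completion_eq => r; exact: (near r).1.
  by apply: fps_eq_cong => N; have [_] := near N; rewrite /= subr0.
rewrite /upsilon_bar; congr (_, _).
  by change (Ym X = Ym X + k *: 0); rewrite scaler0 addr0.
by change (k = 0 + k * 1); rewrite add0r mulr1.
Qed.

Lemma upsilon_bar_bij : bijective Ym -> bijective upsilon_bar.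
Proof.
by move=> [V YV VY]; exists (fun u => (V u.1, u.2)) => -[X k]; rewrite /upsilon_bar /= ?YV ?VY.
Qed.

End UpsilonBar.

(** * Bijectivity for a primitive root of unity *)

(** Successive approximation: the correction made at level r vanishes at level r, so the corrected
    preimages converge. Injectivity climbs the same levels, and an element vanishing at all of them
    is zero. *)
Lemma graded_bijective (C : comNzRingType) (A B : pzAlgType (fps C))
    (F : filtration A) (G : filtration B) (f : completion F -> completion G) :
  alg_hom f -> (forall x, F 0%N x) -> (forall x, G 0%N x) ->
  (forall r X, cproj X r = 0 -> cproj (f X) r = 0) ->
  (forall r V, cproj V r = 0 ->
    exists X, cproj X r = 0 /\ cproj (V - f X) r.+1 = 0) ->
  (forall r X, cproj X r = 0 -> cproj (f X) r.+1 = 0 -> cproj X r.+1 = 0) ->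
  bijective f.
Proof.
move=> fh F0 G0 fc surj inj.
have f_inj : injective f.
  move=> X X' e; apply: completion_eq; elim=> [|r IH].
    by have [x ->] := cprojE (X - X') 0; apply/qpi_eq0.
  by apply: inj => //; rewrite (alg_homB fh) e subrr.
have f_surj V : exists X, f X = V.
  (* The choice is made for all pairs of an element and a level, with value 0 where the element does
     not vanish at that level. *)
  have /choice [g gP] (p : completion G * nat) : exists X,
      cproj p.1 p.2 = 0 -> cproj X p.2 = 0 /\ cproj (p.1 - f X) p.2.+1 = 0.
    have [p0|p0] := EM (cproj p.1 p.2 = 0); last by exists 0.
    by have [X XP] := surj _ _ p0; exists X.
  pose fix X r := if r is r'.+1 then X r' + g (V - f (X r'), r') else 0.
  have VX r : cproj (V - f (X r)) r = 0.
    elim: r => [|r IH]; first by have [x ->] := cprojE (V - f (X 0%N)) 0; apply/qpi_eq0.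
    by rewrite /= (alg_homD fh) opprD addrA; exact: (gP (_, _) IH).2.
  have cX r : cproj (X r.+1) r = cproj (X r) r.
    by rewrite -[X r.+1]/(X r + g (V - f (X r), r)) cprojD (gP (_, _) (VX r)).1 addr0.
  have [L LP] := completion_complete cX.
  exists L; apply: completion_eq => r; rewrite -opprB cprojN; apply/eqP.
  rewrite oppr_eq0; apply/eqP; rewrite -(subrK (f (X r)) V) -addrA -(alg_homB fh).
  by apply: ckerD => //; apply: fc; apply/cproj_sub0.
have [g gP] := choice f_surj.
by exists g => [X|V] //; apply: f_inj.
Qed.

Section NormalFormShift.
Variables (C : comNzRingType) (A : pzAlgType (fps C)) (s t x : A) (k k' : fps C).
Hypotheses (kk : k' * k = 1) (st : s = k *~: t - hbar *~: x).

(** Together with [hbar], the elements [s] and [t] generate the same right ideal. This trades the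
    generator D^n - 1 of the definition for [qdelta]. *)
Lemma nf1_shift y : nf t 1 y -> nf s 1 y.
Proof.
have -> : t = k' *~: s + hbar *~: (k' *~: x).
  rewrite st ascaleDr ascaleA kk ascale1 ascaleA [hbar * k']mulrC -ascaleA.
  by rewrite {1}/ascale mulrN subrK.
move=> [a [b [_ _ ->]]]; rewrite mulrDl -ascaleAl; apply: nfD; last exact: nf_hbar.
by apply: nfD; [apply/nfZ/nf_s|rewrite -ascaleAl; exact: nf_hbar].
Qed.

Lemma nf_comm_shift : (forall b, nf t 1 (b * t)) -> forall b, nf s 1 (b * s).
Proof.
move=> tC b; rewrite {2}st mulrBr -!ascaleAr; apply: nfB; last exact: nf_hbar.
exact/nfZ/nf1_shift.
Qed.

End NormalFormShift.

(** Linearity of the lift of a family that need not be multiplicative, such as the one behind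
    [qrho]. *)
Lemma galg_lift_linear (K : comNzRingType) (B : lmodType K) (G : zmodType)
    (S : gsystem B G) (T : pzAlgType K) (f : G -> B -> T) :
  (forall g k a b, f g (k *: a + b) = k *~: f g a + f g b) ->
  forall k (u v : galg S), galg_lift f (k *~: u + v)
    = k *~: galg_lift f u + galg_lift f v.
Proof.
move=> fL; have fD g a b : f g (a + b) = f g a + f g b.
  by rewrite -[X in X + b]scale1r fL ascale1.
have f0 g : f g 0 = 0 by apply: (addrI (f g 0)); rewrite -fD !addr0.
have fZ g k a : f g (k *: a) = k *~: f g a by rewrite -[k *: a]addr0 fL f0 addr0.
have hw (d : {fset G}) (u : galg S) : (msupp u `<=` d)%fset ->
    galg_lift f u = \sum_(g <- d) f g u@_g.
  by move=> le; apply: big_fset_incl => // g _ /mcoeff_outdom ->.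
have hD (u v : galg S) : galg_lift f (u + v) = galg_lift f u + galg_lift f v.
  rewrite (hw _ _ (msuppD_le _ _)) (hw _ _ (fsubsetUl _ (msupp v))).
  rewrite (hw _ _ (fsubsetUr (msupp u) _)) -big_split /=.
  by apply: eq_bigr => g _; rewrite mcoeffD fD.
have h0 : galg_lift f (0 : galg S) = 0 by rewrite /galg_lift msupp0 big_seq_fset0.
move=> k u v; rewrite hD; congr (_ + _).
elim/(@galg_ind K B G S): u => [|u u' Hu Hu'|a g].
- by rewrite /ascale mulr0 h0 mulr0.
- by rewrite ascaleDr !hD ascaleDr Hu Hu'.
by rewrite galgZU !galg_liftU // fZ.
Qed.

(** A geometric sum with ratio z = w^(i-j): one has z^n = 1, and by primitivity z = 1 only for i =
    j. *)
Lemma prim_root_orthogonal (R : fieldType) n (w : R) i j : n.-primitive_root w ->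
  (i < n)%N -> (j < n)%N ->
  \sum_(k < n) w ^+ (k * i) * w^-1 ^+ (k * j) = if i == j then n%:R else 0.
Proof.
move=> wp ni nj; have w0 : w != 0.
  apply: contra_eq_neq (prim_expr_order wp) => ->.
  rewrite expr0n gtn_eqF; last exact: leq_ltn_trans ni.
  by rewrite eq_sym oner_eq0.
pose z := w ^+ i * w^-1 ^+ j.
have -> : \sum_(k < n) w ^+ (k * i) * w^-1 ^+ (k * j) = \sum_(k < n) z ^+ k.
  by apply: eq_bigr => k _; rewrite exprMn -!exprM mulnC [(k * j)%N]mulnC.
case: eqP => [ij|/eqP ij].
  have -> : z = 1 by rewrite /z ij -exprMn mulfV // expr1n.
  by under eq_bigr do rewrite expr1n; rewrite sumr_const card_ord.
have : (z - 1) * \sum_(k < n) z ^+ k = 0.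
  rewrite -subrX1 /z exprMn -!exprM mulnC exprM (prim_expr_order wp) expr1n mul1r.
  by rewrite mulnC exprM exprVn (prim_expr_order wp) invr1 expr1n subrr.
move=> /eqP; rewrite mulf_eq0 => /orP [z1|/eqP //].
case/negP: ij; rewrite subr_eq0 /z exprVn in z1.
have : w ^+ i == w ^+ j.
  by rewrite -(mulr1 (w ^+ j)) -(eqP z1) mulrCA mulfV ?mulr1 // expf_neq0.
by rewrite (eq_prim_root_expr wp) !modn_small.
Qed.

(** One has b (d - 1) = (d - 1) b + (c - 1) d b, and c - 1 is a multiple of [hbar]. *)
Lemma nf1_subr1 (C : comNzRingType) (A : pzAlgType (fps C)) (b d : A) c :
  b * d = c *~: (d * b) -> fps_cong 1 c 1 -> nf (d - 1) 1 (b * (d - 1)).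
Proof.
move=> bd /fps_congB/fps_congP [g cg].
exists b, (g *~: (d * b)); split=> //; rewrite ascaleA -[hbar]expr1 -cg.
rewrite mulrBr mulr1 bd mulrBl mul1r /ascale rmorphB rmorph1 mulrBl mul1r.
by rewrite [RHS]addrC addrA subrK.
Qed.

Lemma ideal_alg_hom_shift (C : comNzRingType) (A B : pzAlgType (fps C)) (I : ideal B)
    (f : A -> B) k s x :
  alg_hom f -> I (f s) -> I (alg hbar) -> I (f (k *~: s - hbar *~: x)).
Proof.
move=> fh Is Ih; rewrite (alg_homB fh) !(alg_homZ fh).
by apply: idealB; [exact: idealMl|exact: Defs.idealMr].
Qed.

Lemma hbar_level (C : comNzRingType) (A : pzAlgType (fps C)) (F : filtration A)
    (X Y : completion F) r :
  fil_mul F -> F 1%N (alg hbar) -> cproj X r = cproj Y r ->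
  cproj (hbar *~: X) r.+1 = cproj (hbar *~: Y) r.+1.
Proof.
move=> FM Fh /cproj_sub0 XY; apply/cproj_sub0.
rewrite -mulrBr -add1n; apply: cprojM0 => //; exact/qpi_eq0.
Qed.

(** The cross term c hbar D of the product (1 + c hbar) (1 + D) has order 2. *)
Lemma first_order_level2 (C : comNzRingType) (A : pzAlgType (fps C)) (F : filtration A)
    (X D : completion F) k c :
  fil_mul F -> (forall r x, F r (hbar ^+ r *~: x)) -> cproj D 1 = 0 ->
  fps_cong 2 k (1 + c * hbar) -> cproj X 2 = cproj (1 + D) 2 ->
  cproj (k *~: X - 1) 2 = cproj (D + (c * hbar) *~: 1) 2.
Proof.
move=> FM Fh D0 kc XD.
have -> : cproj (k *~: X - 1) 2 = cproj ((1 + c * hbar) *~: (1 + D) - 1) 2.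
  by rewrite !cprojB (cproj_cong X (Fh 2) kc) !ascaleE !cprojZ XD.
have e : (1 + c * hbar) *~: (1 + D) - 1 = D + (c * hbar) *~: 1 + (c * hbar) *~: D.
  by rewrite ascaleDl ascale1 ascaleDr addrAC [1 + D]addrC addrK addrA.
rewrite e cprojD -[RHS]addr0; congr (_ + _).
rewrite -ascaleA; apply: cprojMl0; apply: (@cprojM0 _ _ _ _ _ 1 1) => //.
apply/qpi_eq0; have := Fh 1%N 1; by rewrite /ascale mulr1 expr1.
Qed.

Lemma alg_hom_shift (K : comNzRingType) (A B : pzAlgType K) (f : A -> B) k l s x :
  alg_hom f -> f (k *~: s - l *~: x) = k *~: f s - l *~: f x.
Proof. by move=> fh; rewrite (alg_homB fh) !(alg_homZ fh). Qed.

Section ScaleSums.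
Variables (C : numFieldType) (A : pzAlgType (fps C)).

Lemma ascale0l (x : A) : 0 *~: x = 0.
Proof. by rewrite /ascale rmorph0 mul0r. Qed.

Lemma ascale_sumr k (J : Type) (l : seq J) (P : pred J) (f : J -> A) :
  k *~: (\sum_(i <- l | P i) f i) = \sum_(i <- l | P i) k *~: f i.
Proof. exact: mulr_sumr. Qed.

Lemma ascale_suml (x : A) (J : Type) (l : seq J) (P : pred J) (f : J -> fps C) :
  (\sum_(i <- l | P i) f i) *~: x = \sum_(i <- l | P i) f i *~: x.
Proof. exact: (big_morph (fun k => k *~: x) (ascaleDl x) (ascale0l x)). Qed.

Lemma fpsC_sum (J : Type) (l : seq J) (P : pred J) (f : J -> C) :
  fpsC (\sum_(i <- l | P i) f i) = \sum_(i <- l | P i) fpsC (f i) :> fps C.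
Proof.
apply: (big_morph (@fpsC C) (@fpsCD C)).
by apply/fpsP => -[].
Qed.

(** Inversion of a change of basis: it recovers the powers D^k from the idempotents. *)
Lemma dual_basis (I : finType) (p c : I -> I -> C) (v : I -> A) k :
  (forall k', \sum_a p k a * c k' a = (k == k')%:R) ->
  \sum_a fpsC (p k a) *~: (\sum_k' fpsC (c k' a) *~: v k') = v k.
Proof.
move=> pc.
transitivity (\sum_a \sum_k' fpsC (p k a * c k' a) *~: v k').
  apply: eq_bigr => a _; rewrite ascale_sumr; apply: eq_bigr => k' _.
  by rewrite ascaleA -fpsCM.
rewrite exchange_big /=.
transitivity (\sum_k' fpsC (k == k')%:R *~: v k').
  by apply: eq_bigr => k' _; rewrite -ascale_suml -fpsC_sum pc.
rewrite (bigD1 k) //= eqxx ascale1 big1 ?addr0 // => k' /negPf kk.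
rewrite eq_sym kk (_ : fpsC 0%:R = 0) ?ascale0l //.
by apply/fpsP => -[].
Qed.

End ScaleSums.

(** * The idempotents and the element delta *)

Section Bijectivity.
Variables (C : numFieldType) (n : nat) (w : C) (hn : (0 < n)%N) (hw : w ^+ n = 1).
Local Notation K := (fps C).
Local Notation qq := (root_times_exp hn hw).
Local Notation q := (val qq).
Local Notation cW := (completion (weyl_adic C)).
Local Notation T := (weyl_hat C n).
Local Notation Q0 := (qtorus_alg qq).
Local Notation U := (@upsilon_mon C n w hn hw).

Definition qsigma : Q0 := DZ qq n%:Z 0 - 1.

(** Fourier coefficients on Z/n: [qidem a] is the projector on the eigenvalue w^(n-1-a) of D, the
    value taken by D in row a modulo d and [hbar]. *)
Definition qcoef (k : nat) (a : 'I_n) : C := n%:R^-1 * w^-1 ^+ (k * (n.-1 - a)).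

Definition qidem (a : 'I_n) : Q0 := \sum_(k < n) fpsC (qcoef k a) *~: DZ qq k%:Z 0.

Definition qxi : Q0 :=
  \sum_(a < n) fpsC (n%:R^-1 * (n.-1 - a)%:R) *~: qidem a.

(** In row a, D^n becomes e^(n (n-1-a) hbar) e^(n^2 d), so D^n - 1 is n^2 d + n (n-1-a) hbar to
    first order. Division by n^2 and subtraction of hbar [qxi] leave d. *)
Definition qdelta : Q0 := fpsC (n%:R ^- 2) *~: qsigma - hbar *~: qxi.

Lemma qtorus_monE a k l : << a *g (k, l) >> = (a : K) *~: DZ qq k l :> Q0.
Proof. by rewrite galgZU; congr << _ *g _ >>; exact/esym/mulr1. Qed.

Lemma DZ_X k m : DZ qq k 0 ^+ m = DZ qq (k *+ m) 0.
Proof.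
elim: m => [|m IH]; first by rewrite mulr0n.
by rewrite exprS IH DZ_mul mul0r oppr0 expr0z ascale1 addr0 mulrS.
Qed.

Let nC0 : n%:R != 0 :> C. Proof. by rewrite pnatr_eq0 -lt0n. Qed.

Lemma qsigma_comm b : nf qsigma 1 (b * qsigma).
Proof.
elim/(@galg_ind _ _ _ (qtorus_system qq)): b => [|u v Hu Hv|a [k l]].
- by rewrite mul0r; exact: nf0.
- by rewrite mulrDl; exact: nfD.
rewrite (qtorus_monE a k l) -ascaleAl; apply: nfZ.
apply: (@nf1_subr1 _ _ _ _ (q ^ (- (l * n%:Z)))).
  by rewrite !DZ_mul mul0r oppr0 expr0z ascale1 [n%:Z + k]addrC addr0 add0r.
(* The commutation factor q^(-l n) equals e^(-l n hbar), hence 1 modulo [hbar]. *)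
rewrite mulrC -mulrN (q_nmul hn hw) => -[|//] _.
by rewrite fcoef1 /= fact0 divr1.
Qed.

Let kk : fpsC (n%:R ^+ 2) * fpsC (n%:R ^- 2) = 1 :> K.
Proof. by rewrite -fpsCM mulfV // expf_neq0. Qed.

Lemma qdelta_comm b : nf qdelta 1 (b * qdelta).
Proof. exact: (nf_comm_shift kk (erefl _) qsigma_comm). Qed.

Lemma qsigma_delta y : nf qsigma 1 y -> nf qdelta 1 y.
Proof. exact: (nf1_shift kk (erefl _)). Qed.

Local Notation inQ := (cin (hbar_fil Q0)).
Let inQh := cin_alg_hom (hbar_fil Q0).

Lemma qtorus_nf_comm (b : qtorus qq) : nf (inQ qdelta) 1 (b * inQ qdelta).
Proof. exact/nf_comm_in/qdelta_comm. Qed.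

Lemma qtorus_sigmaE : qtorus_D qq ^+ n - 1 = inQ qsigma.
Proof.
rewrite -(alg_homX inQh) DZ_X (alg_homB inQh) (alg_hom1 inQh).
by rewrite natz.
Qed.

Lemma qtorus_adicP r x : qtorus_adic n w qq r x <-> nf (inQ qdelta) r x.
Proof.
apply: ideal_pow_nf.
- exact: qtorus_nf_comm.
- apply: (@gen_sub _ _ (nf_ideal qtorus_nf_comm 1)) => y [->|->].
    rewrite qtorus_sigmaE; apply: nf_in; apply: qsigma_delta.
    by rewrite -[X in nf _ _ X]mulr1; exact: nf_s.
  have [c _ ->] := q_sub_w hn hw; rewrite rmorphM; exact: nf_hbar.
- have := @ideal_alg_hom_shift _ _ _
    (gen [set qtorus_D qq ^+ n - 1; alg (q - fpsC w)])
    inQ (fpsC (n%:R ^- 2)) qsigma qxi inQh.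
  apply; last exact: qtorus_hbar.
  by apply: sub_gen; left; rewrite /= qtorus_sigmaE.
- exact: qtorus_hbar.
Qed.

Lemma qtorus_adic_in r x : nf qdelta r x -> qtorus_adic n w qq r (inQ x).
Proof. by move=> nx; apply/qtorus_adicP; exact: nf_in. Qed.

Hypothesis wp : n.-primitive_root w.

Let ltr (a : 'I_n) : (n.-1 - a < n)%N.
Proof. by have := ltn_ord a; lia. Qed.

Lemma qcoef_dual (a c : 'I_n) :
  \sum_(k < n) qcoef k a * w ^+ (k * (n.-1 - c)) = (a == c)%:R.
Proof.
under eq_bigr => k _ do rewrite /qcoef -mulrA [_ * w ^+ _]mulrC.
rewrite -mulr_sumr (prim_root_orthogonal wp (ltr c) (ltr a)).
have -> : (n.-1 - c == n.-1 - a)%N = (a == c).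
  apply/eqP/eqP => [e|-> //]; apply: val_inj => /=.
  by have := ltn_ord a; have := ltn_ord c; lia.
by case: eqP => _; rewrite ?mulVf ?mulr0.
Qed.

Lemma qcoef_dual2 (k k' : 'I_n) :
  \sum_(a < n) w ^+ (k * (n.-1 - a)) * qcoef k' a = (k == k')%:R.
Proof.
rewrite (reindex_inj rev_ord_inj) /=.
rewrite (eq_bigr (fun i : 'I_n => n%:R^-1 * (w ^+ (i * k) * w^-1 ^+ (i * k')))).
  rewrite -mulr_sumr (prim_root_orthogonal wp) //.
  by rewrite -[k == k' :> nat]/(k == k'); case: eqP => _; rewrite ?mulVf ?mulr0.
move=> i _; rewrite /qcoef mulrCA (_ : n.-1 - (n - i.+1) = i)%N; last first.
  by have := ltn_ord i; lia.
by rewrite [(k * i)%N]mulnC [(k' * i)%N]mulnC.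
Qed.

Lemma qidem_spec (k : 'I_n) :
  DZ qq k%:Z 0 = \sum_(a < n) fpsC (w ^+ (k * (n.-1 - a))) *~: qidem a.
Proof.
exact/esym/(@dual_basis C Q0 'I_n (fun k a : 'I_n => w ^+ (k * (n.-1 - a)))
  (fun k a : 'I_n => qcoef k a) (fun k : 'I_n => DZ qq k%:Z 0) k (qcoef_dual2 k)).
Qed.

Section Levels.
Variable f : Q0 -> T.
Hypotheses (fh : alg_hom f) (fU : forall k l, f (DZ qq k l) = U k l).

Lemma cproj_sum_eq (J : finType) (r : nat) (F G : J -> T) :
  (forall i, cproj (F i) r = cproj (G i) r) ->
  cproj (\sum_i F i) r = cproj (\sum_i G i) r.
Proof. by move=> FG; rewrite !cproj_sum; apply: eq_bigr => i _. Qed.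

(** Modulo d and [hbar], D^k has the diagonal entries w^(k (n-1-c)), and orthogonality leaves only c
    = a. *)
Lemma qidem_level1 a : cproj (f (qidem a)) 1 = cproj (csingle a a 1 : T) 1.
Proof.
rewrite (alg_hom_sum fh).
transitivity (cproj (\sum_(k < n) \sum_(c < n)
    csingle c c (fpsC (qcoef k a * w ^+ (k * (n.-1 - c))) *~: (1 : cW)) : T) 1).
  apply: cproj_sum_eq => k; rewrite (alg_homZ fh) fU ascaleE cprojZ.
  rewrite upsilon_mon_cproj1 -cprojZ -ascaleE ascale_sumr; apply: cproj_sum_eq => c.
  have [-> ->] := scol0 hn c.
  by rewrite -csingleZ ascaleA -fpsCM wX0.
apply: (congr1 (fun Z : T => cproj Z 1)); rewrite exchange_big /=.
transitivity (\sum_(c < n) csingle c c (fpsC (a == c)%:R *~: 1) : T).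
  apply: eq_bigr => c _; rewrite -qcoef_dual fpsC_sum ascale_suml.
  by rewrite [RHS]cmap_sum.
rewrite (bigD1 a) //= eqxx ascale1 big1 ?addr0 // => c /negPf ca.
by rewrite eq_sym ca (fpsC_nat _ 0) ascale0l csingle0.
Qed.

Lemma qsigma_level2 : cproj (f qsigma) 2 = cproj (\sum_(a < n) csingle a a
   (fpsC (n%:R ^+ 2) *~: cin (weyl_adic C) (weyl_d C)
     + (fpsC (n%:R * (n.-1 - a)%:R) * hbar) *~: 1) : T) 2.
Proof.
rewrite (alg_homB fh) (alg_hom1 fh) fU -csingle_sum1 -sumrB.
apply: cproj_sum_eq => a; have [-> s0] := scol0 hn a.
rewrite -cmapB; apply: csingle_cong; rewrite /uentry s0 wX0 mulr1.
apply: (first_order_level2 (@adic_mul _ _ _) (@weyl_adic_hbar C)).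
- by apply: cprojMl0; apply/cproj_in0; apply: ideal_pow1; apply: sub_gen; left.
- rewrite /uexp (q_nmul hn hw) -[n%:R *~ _]mulrzr.
  have -> : (n%:Z - 1 - a%:Z)%:~R = (n.-1 - a)%:R :> C.
    by rewrite -[RHS]/((n.-1 - a)%N%:~R); congr (_%:~R); have := ltn_ord a; lia.
  exact: exps_cong2.
- by rewrite cproj_wexp2 intrM -expr2 cprojD ascaleE cprojZ -qpiZ.
Qed.

Definition diag_d : T := \sum_(a < n) csingle a a (cin (weyl_adic C) (weyl_d C)).

(** The factor [hbar] raises the order, so [qxi] has to be known only to order 1, where its
    idempotents are the diagonal matrix units; the row-dependent terms then cancel. *)
Lemma qdelta_level2 : cproj (f qdelta) 2 = cproj diag_d 2.
Proof.
have xi1 : cproj (f qxi) 1 = cproj (\sum_(a < n)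
    fpsC (n%:R^-1 * (n.-1 - a)%:R) *~: csingle a a 1 : T) 1.
  rewrite (alg_hom_sum fh); apply: cproj_sum_eq => a.
  by rewrite (alg_homZ fh) !ascaleE !cprojZ qidem_level1.
have Fh : mat_fil n (weyl_adic C) 1 (alg hbar).
  by have := @weyl_hat_hbar C n 1 1; rewrite expr1 /ascale mulr1.
have := hbar_level (@weyl_hat_mul C n) Fh xi1.
rewrite [f qdelta](alg_hom_shift _ _ _ _ fh) !cprojB => ->.
rewrite [X in X - _]cprojZ qsigma_level2 -[X in X - _]cprojZ -cprojB.
apply: (congr1 (fun Z : T => cproj Z 2)).
rewrite -ascaleE !ascale_sumr -sumrB; apply: eq_bigr => a _.
rewrite -!csingleZ -cmapB; congr (csingle a a _).
rewrite ascaleDr !ascaleA mulrA -fpsCM mulrA -!fpsCM.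
have -> : n%:R ^- 2 * n%:R * n%:R = 1 :> C.
  by rewrite -mulrA -expr2 mulVf // expf_neq0.
have -> : n%:R ^- 2 * (n%:R * (n.-1 - a)%:R) = n%:R^-1 * (n.-1 - a)%:R :> C.
  by rewrite expr2 invfM -mulrA mulKf.
by rewrite ascale1 [hbar * _]mulrC addrK.
Qed.

End Levels.
End Bijectivity.

Section LinearMaps.
Variables (K : comNzRingType) (A B : pzAlgType K) (f : A -> B).
Hypothesis fL : forall k x y, f (k *~: x + y) = k *~: f x + f y.

Lemma linear_mapD x y : f (x + y) = f x + f y.
Proof. by rewrite -[x]ascale1 fL !ascale1. Qed.
Lemma linear_map0 : f 0 = 0.
Proof. by apply: (addrI (f 0)); rewrite -linear_mapD !addr0. Qed.
Lemma linear_mapZ k x : f (k *~: x) = k *~: f x.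
Proof. by rewrite -[k *~: x]addr0 fL linear_map0 addr0. Qed.

End LinearMaps.

Lemma peval_MXaddC (C : comNzRingType) (A : pzAlgType (fps C)) (d x : A) g c :
  peval d (g * 'X + c%:P) * x = c *~: x + peval d g * (d * x).
Proof.
rewrite -[g * 'X]scale1r pevalL ascale1 pevalC pevalMX mulrDl addrC.
by rewrite mulrA.
Qed.

Lemma alg_hom_level1 (C : comNzRingType) (A B : pzAlgType (fps C)) (F : filtration B)
    (f : A -> completion F) (c : fps C) (d x p : A) :
  alg_hom f -> cproj (f d) 1 = 0 ->
  cproj (f (c *~: x + p * (d * x))) 1 = cproj (c *~: f x) 1.
Proof.
move=> fh fd; rewrite (alg_homD fh) (alg_homZ fh) !(alg_homM fh) cprojD.
by rewrite [X in _ + X]cprojM [X in _ + _ * X]cprojM fd mul0r mulr0 addr0.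
Qed.

Lemma cprojZ_eq (C : comNzRingType) (A : pzAlgType (fps C)) (F : filtration A)
    (X Y : completion F) c r : cproj X r = cproj Y r -> cproj (c *~: X) r = cproj (c *~: Y) r.
Proof. by rewrite !ascaleE !cprojZ => ->. Qed.

(** The error is (D - D') X + D' (X - X'), of orders 2 + r and 1 + (r+1). Hence agreement of D and
    D' to order 2 suffices because X has order r. *)
Lemma level_step (C : comNzRingType) (A : pzAlgType (fps C)) (F : filtration A)
    (D D' X X' Y Y' : completion F) r :
  fil_mul F -> F 1%N (alg hbar) -> cproj D 2 = cproj D' 2 -> cproj D' 1 = 0 ->
  cproj X r.+1 = cproj X' r.+1 -> cproj X' r = 0 -> cproj Y r.+1 = cproj Y' r.+1 ->
  cproj (D * X + hbar *~: Y) r.+2 = cproj (D' * X' + hbar *~: Y') r.+2.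
Proof.
move=> FM Fh DD D0 XX X0 YY; rewrite !cprojD (hbar_level FM Fh YY); congr (_ + _).
apply/cproj_sub0; have -> : D * X - D' * X' = (D - D') * X + D' * (X - X').
  by rewrite mulrBl mulrBr addrA subrK.
apply: ckerD.
  apply: (@cprojM0 _ _ _ _ _ 2 r) => //; first exact/cproj_sub0.
  by rewrite (cproj_le (leqnSn r) XX).
by apply: (@cprojM0 _ _ _ _ _ 1 r.+1) => //; exact/cproj_sub0.
Qed.

(** * The linear inverse on leading terms *)

Section Rho.
Variables (C : numFieldType) (n : nat) (w : C) (hn : (0 < n)%N) (hw : w ^+ n = 1).
Local Notation K := (fps C).
Local Notation qq := (root_times_exp hn hw).
Local Notation T := (weyl_hat C n).
Local Notation Q0 := (qtorus_alg qq).
Local Notation W := (weyl_alg C).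
Local Notation U := (@upsilon_mon C n w hn hw).
Local Notation d0 := (wmon 'X 0 : W).
Local Notation delta := (qdelta hn hw).
Local Notation idem := (qidem hn hw).
Let inWh := cin_alg_hom (hbar_fil W).

(** The polynomial in [delta] stands on the left, so that left multiplication by d becomes left
    multiplication by [delta]. This matches the normal forms of both sides, which are right
    ideals. *)
Definition qrho_mon (a b : 'I_n) (s : int) (g : {poly K}) : Q0 :=
  peval delta g * (idem a * DZ qq 0 (b%:Z - a%:Z + n%:Z * s)).

Lemma qrho_monL a b s k g h :
  qrho_mon a b s (k *: g + h) = k *~: qrho_mon a b s g + qrho_mon a b s h.
Proof. by rewrite /qrho_mon pevalL mulrDl ascaleAl. Qed.

Definition qrho (a b : 'I_n) (u : W) : Q0 :=
  galg_lift (S := weyl_system C) (qrho_mon a b) u.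

Lemma qrho_lin a b k u v : qrho a b (k *~: u + v) = k *~: qrho a b u + qrho a b v.
Proof. exact/galg_lift_linear/qrho_monL. Qed.

Lemma qrho_wmon a b g s : qrho a b (wmon g s) = qrho_mon a b s g.
Proof. by apply: galg_liftU => *; exact: qrho_monL. Qed.

Lemma qrho_delta a b u : qrho a b (d0 * u) = delta * qrho a b u.
Proof.
have rD := linear_mapD (qrho_lin a b); have r0 := linear_map0 (qrho_lin a b).
elim/(@galg_ind _ _ _ (weyl_system C)): u => [|u v Hu Hv|g s].
- by rewrite mulr0 r0 mulr0.
- by rewrite mulrDr !rD mulrDr Hu Hv.
rewrite -[<< g *g s >>]/(wmon g s) wmonM0 !qrho_wmon /qrho_mon pevalM pevalX.
by rewrite -mulrA.
Qed.

Lemma qrho_nf a b r u : nf d0 r u -> nf delta r (qrho a b u).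
Proof.
elim: r u => [//|r IH] _ [y [z [/IH ny /IH nz ->]]].
rewrite (linear_mapD (qrho_lin a b)) qrho_delta (linear_mapZ (qrho_lin a b)).
by apply: nfD; [exact: nf_s|exact: nf_hbar].
Qed.

Definition wemb (a b : 'I_n) (u : W) : T :=
  csingle a b (cin (weyl_adic C) (cin (hbar_fil W) u)).

Lemma wemb_lin a b k u v : wemb a b (k *~: u + v) = k *~: wemb a b u + wemb a b v.
Proof.
by rewrite /wemb (cin_alg_hom (hbar_fil W)).1 (cin_alg_hom (weyl_adic C)).1 csingle_lin.
Qed.

Lemma wemb_d a b u : wemb a b (d0 * u) = diag_d C n * wemb a b u.
Proof.
rewrite /diag_d mulr_suml (bigD1 a) //= big1 ?addr0 => [|c ca]; last exact: csingleM0.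
by rewrite /wemb csingleM (alg_homM inWh) (alg_homM (cin_alg_hom (weyl_adic C))).
Qed.

Lemma wemb_nf a b r u : nf d0 r u -> cproj (wemb a b u) r = 0.
Proof. by move=> nu; apply: csingle_cproj0; apply/cproj_in0/weyl_adic_in. Qed.

Lemma diag_d_level1 : cproj (diag_d C n) 1 = 0.
Proof.
rewrite cproj_sum big1 // => a _; apply: csingle_cproj0; apply/cproj_in0.
by apply: ideal_pow1; apply: sub_gen; left.
Qed.

Hypothesis wp : n.-primitive_root w.
Variable f : Q0 -> T.
Hypotheses (fh : alg_hom f) (fU : forall k l, f (DZ qq k l) = U k l).

Lemma scol_entry (a b : 'I_n) s :
  scol hn a (b%:Z - a%:Z + n%:Z * s) = b /\ sdiv a (b%:Z - a%:Z + n%:Z * s) = s.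
Proof. apply: scol_uniq; ring. Qed.

Lemma upsilon_idem_level1 (a b : 'I_n) s :
  cproj (f (idem a * DZ qq 0 (b%:Z - a%:Z + n%:Z * s))) 1 = cproj (wemb a b (wmon 1 s)) 1.
Proof.
set l := b%:Z - a%:Z + n%:Z * s; rewrite (alg_homM fh) cprojM.
rewrite (fU 0 l) (qidem_level1 wp fh fU) (upsilon_mon_cproj1 hn hw 0) -cprojM.
rewrite mulr_sumr (bigD1 a) // big1 ?addr0 => [|c ca]; last first.
  by apply: csingleM0; rewrite eq_sym.
rewrite csingleM mul1r mul0n expr0 ascale1.
rewrite /l; have [-> ->] := scol_entry a b s; rewrite wXE.
exact: (congr1 (fun Z : T => cproj Z 1) (addr0 _)).
Qed.

Lemma wemb_poly_level1 a b g c s :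
  cproj (wemb a b (wmon (g * 'X + c%:P) s)) 1 = cproj (c *~: wemb a b (wmon 1 s)) 1.
Proof.
have -> : wmon (g * 'X + c%:P) s = c *~: wmon 1 s + d0 * wmon g s :> W.
  by rewrite wmonM0 -wmonZ -wmonD addrC mulrC -mul_polyC mulr1.
rewrite wemb_lin wemb_d cprojD [X in _ + X]cprojM diag_d_level1 mul0r addr0 //.
Qed.

Lemma qrho_poly_level1 a b g c s :
  cproj (f (qrho a b (wmon (g * 'X + c%:P) s))) 1 = cproj (c *~: wemb a b (wmon 1 s)) 1.
Proof.
have fd : cproj (f delta) 1 = 0.
  rewrite (cproj_le (leqnSn 1) (qdelta_level2 wp fh fU)); exact: diag_d_level1.
rewrite qrho_wmon /qrho_mon; set M := idem a * _.
rewrite (peval_MXaddC delta M g c) (alg_hom_level1 c M _ fh fd).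
exact/cprojZ_eq/upsilon_idem_level1.
Qed.

(** Induction on the order: at order 0 only the constant terms of the polynomials matter, and
    [level_step] handles left multiplication by d and by [hbar]. *)
Lemma qrho_level a b r u : nf d0 r u ->
  cproj (f (qrho a b u)) r.+1 = cproj (wemb a b u) r.+1.
Proof.
(* From here on, only linearity, the effect of left multiplication by d and, for the embedding, the
   preservation of orders are used. *)
have [h [hE hL hd]] : exists h : W -> T, [/\ forall u, f (qrho a b u) = h u,
    forall k u v, h (k *~: u + v) = k *~: h u + h v &
    forall u, h (d0 * u) = f delta * h u].
  exists (fun u => f (qrho a b u)); split=> // [k x y|x].
    by rewrite qrho_lin fh.1.
  by rewrite qrho_delta (alg_homM fh).
have [e [eE eL ed en]] : exists e : W -> T, [/\ forall u, wemb a b u = e u,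
    forall k u v, e (k *~: u + v) = k *~: e u + e v,
    forall u, e (d0 * u) = diag_d C n * e u &
    forall r u, nf d0 r u -> cproj (e u) r = 0].
  exists (wemb a b); split=> //; [exact: wemb_lin|exact: wemb_d|exact: wemb_nf].
rewrite hE eE; elim: r u => [u _|r IH _ [y [z [ny nz ->]]]].
  elim/(@galg_ind _ _ _ (weyl_system C)): u => [|u v Hu Hv|g s].
  - by rewrite (linear_map0 hL) (linear_map0 eL).
  - by rewrite (linear_mapD hL) (linear_mapD eL) !cprojD Hu Hv.
  (* A case distinction that isolates the constant term of the polynomial; the rest carries a factor
     d and vanishes at level 1. *)
  rewrite -[<< g *g s >>]/(wmon g s); elim/poly_ind: g => [|g c _].
    have -> : wmon 0 s = 0 :> W by exact: monalgU0.
    by rewrite (linear_map0 hL) (linear_map0 eL).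
  by rewrite -hE -eE qrho_poly_level1 wemb_poly_level1.
rewrite (linear_mapD hL) (linear_mapD eL) hd ed (linear_mapZ hL) (linear_mapZ eL).
apply: level_step (@weyl_hat_mul C n) _ (qdelta_level2 wp fh fU) diag_d_level1
  (IH _ ny) (en _ _ ny) (IH _ nz).
by have := @weyl_hat_hbar C n 1 1; rewrite expr1 /ascale mulr1.
Qed.

End Rho.

Section NormalFormDifferences.
Variables (C : comNzRingType) (A : pzAlgType (fps C)) (s : A) (r : nat).
Implicit Types x y u v : A.

Lemma nf_sub_trans x y u : nf s r (x - y) -> nf s r (y - u) -> nf s r (x - u).
Proof. by move=> xy yu; rewrite -(subrKA y); exact: nfD. Qed.

Lemma nf_subD x y u v :
  nf s r (x - u) -> nf s r (y - v) -> nf s r (x + y - (u + v)).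
Proof. by move=> xu yv; rewrite opprD addrACA; exact: nfD. Qed.

Lemma nf_sub_step x y u v : nf s r (x - u) -> nf s r (y - v) ->
  nf s r.+1 (s * x + hbar *~: y - (hbar *~: v + s * u)).
Proof.
move=> xu yv; rewrite [hbar *~: v + _]addrC opprD addrACA -mulrBr.
by apply: nfD; [exact: nf_s|rewrite /ascale -mulrBr; exact: nf_hbar].
Qed.

Lemma nf_subZ k x u : nf s r (x - u) -> nf s r (k *~: x - k *~: u).
Proof. by rewrite /ascale -mulrBr; exact: nfZ. Qed.

Lemma nf_subN x u : nf s r (x - u) -> nf s r (u - x).
Proof. by move=> xu; rewrite -opprB; exact: nfN. Qed.

Lemma nf_Msub1 x u v : x = u * v -> nf (u - 1) 1 (x - v).
Proof. by move=> ->; rewrite -{2}[v]mul1r -mulrBl; exact: nf_s. Qed.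

End NormalFormDifferences.

(** * Generation of the graded pieces *)

Section Spanning.
Variables (C : numFieldType) (n : nat) (w : C) (hn : (0 < n)%N) (hw : w ^+ n = 1).
Local Notation K := (fps C).
Local Notation qq := (root_times_exp hn hw).
Local Notation Q0 := (qtorus_alg qq).
Local Notation W := (weyl_alg C).
Local Notation d0 := (wmon 'X 0 : W).
Local Notation delta := (qdelta hn hw).
Local Notation idem := (qidem hn hw).
Hypothesis wp : n.-primitive_root w.

Definition qrho_sum (b : 'I_n -> 'I_n -> W) : Q0 :=
  \sum_(a < n) \sum_(c < n) qrho hn hw a c (b a c).

Lemma qrho_sumL k b b' : qrho_sum (fun a c => k *~: b a c + b' a c)
  = k *~: qrho_sum b + qrho_sum b'.
Proof.
rewrite /qrho_sum ascale_sumr -big_split; apply: eq_bigr => a _.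
rewrite [X in _ = Algebra.add X _]ascale_sumr -big_split; apply: eq_bigr => c _.
exact: qrho_lin.
Qed.

Lemma qrho_sum_delta b : qrho_sum (fun a c => d0 * b a c) = delta * qrho_sum b.
Proof.
rewrite /qrho_sum mulr_sumr; apply: eq_bigr => a _.
by rewrite mulr_sumr; apply: eq_bigr => c _; exact: qrho_delta.
Qed.

Lemma qrho_sum_nf r b : (forall a c, nf d0 r (b a c)) -> nf delta r (qrho_sum b).
Proof.
have nfS (J : finType) (F : J -> Q0) : (forall i, nf delta r (F i)) -> nf delta r (\sum_i F i).
  move=> nF; apply: (big_ind (fun x => nf delta r x)) => //; first exact: nf0.
  by move=> x y; exact: nfD.
by move=> nb; apply: (nfS _ _) => a; apply: (nfS _ _) => c; exact: qrho_nf.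
Qed.

Lemma DZ_shift k l t : nf (qsigma hn hw) 1 (DZ qq (k + n%:Z * t) l - DZ qq k l).
Proof.
have pos m (p : nat) : nf (qsigma hn hw) 1 (DZ qq (m + n%:Z * p%:Z) l - DZ qq m l).
  elim: p => [|p IH]; first by rewrite mulr0 addr0 subrr; exact: nf0.
  apply: nf_sub_trans IH; apply: nf_Msub1.
  rewrite DZ_mul mul0r oppr0 expr0z ascale1 add0r; congr (DZ _ _ _).
  by rewrite -addn1 PoszD mulrDr mulr1; ring.
case: t => p; first exact: pos.
(* A negative shift is the reverse of a positive shift from the other end. *)
have := pos (k + n%:Z * Negz p) p.+1; rewrite NegzE mulrN subrK => np.
exact: nf_subN.
Qed.

Lemma qrho_sum_mon l (p : 'I_n -> K) :
  qrho_sum (fun a c => if c == scol hn a l then p a *~: wmon 1 (sdiv a l) else 0)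
    = (\sum_a p a *~: idem a) * DZ qq 0 l.
Proof.
rewrite /qrho_sum mulr_suml; apply: eq_bigr => a _.
rewrite (bigD1 (scol hn a l)) //= eqxx big1 => [|c /negPf ca]; last first.
  by rewrite ca; exact: (linear_map0 (qrho_lin hn hw a c)).
rewrite (linear_mapZ (qrho_lin hn hw a (scol hn a l))) qrho_wmon /qrho_mon.
have -> : (scol hn a l)%:Z - a%:Z + n%:Z * sdiv a l = l.
  by rewrite addrAC scolE addrC addKr.
rewrite -[1 : {poly K}]/(1%:P) pevalC rmorph1 mul1r ascaleAl.
exact: addr0.
Qed.

(** Modulo D^n - 1 the exponent of D reduces to a residue below n. The power of D then expands in
    the idempotents, and each e_a Z^l is the value of [qrho] at the entry of the shifted row a. *)
Lemma qrho_span x : exists b, nf delta 1 (x - qrho_sum b).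
Proof.
have sumL := qrho_sumL.
have sum0 : qrho_sum (fun _ _ => 0) = 0.
  rewrite /qrho_sum big1 // => a _; rewrite big1 // => c _.
  exact: (linear_map0 (qrho_lin hn hw a c)).
elim/(@galg_ind _ _ _ (qtorus_system qq)): x => [|x y [b nb] [b' nb']|c [k l]].
- by exists (fun _ _ => 0); rewrite sum0 subrr; exact: nf0.
- exists (fun i j => 1 *~: b i j + b' i j); rewrite (sumL 1 b b').
  by rewrite -[qrho_sum b]ascale1 in nb; exact: nf_subD.
(* The division of [k] by [n] with remainder is borrowed from the shift of row 0. *)
pose k' := scol hn (Ordinal hn) k; pose t := sdiv (Ordinal hn) k.
have kk : k = k'%:Z + n%:Z * t by rewrite scolE add0r.
exists (fun a j => if j == scol hn a l
  then (c * fpsC (w ^+ (k' * (n.-1 - a)))) *~: wmon 1 (sdiv a l) else 0).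
rewrite (qrho_sum_mon l (fun a => c * fpsC (w ^+ (k' * (n.-1 - a))))).
have -> : \sum_(a < n) (c * fpsC (w ^+ (k' * (n.-1 - a)))) *~: idem a = (c : K) *~: DZ qq k'%:Z 0.
  rewrite (qidem_spec hn hw wp k') ascale_sumr; apply: eq_bigr => a _.
  exact/esym/ascaleA.
rewrite -ascaleAl DZ_mul mul0r oppr0 expr0z ascale1 addr0 add0r (qtorus_monE hn hw c k l).
apply: nf_subZ; apply: qsigma_delta.
by rewrite {1}kk; exact: DZ_shift.
Qed.

(** Left multiplications by d and [hbar] correspond to those by [delta] and [hbar] and raise the
    order by one, so the case of order 0 propagates along the normal form. *)
Lemma qrho_graded r x : nf delta r x ->
  exists b, (forall a c, nf d0 r (b a c)) /\ nf delta r.+1 (x - qrho_sum b).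
Proof.
elim: r x => [x _|r IH _ [y [z [/IH [b [nb yb]] /IH [b' [nb' zb]] ->]]]].
  by have [b xb] := qrho_span x; exists b.
exists (fun a c => hbar *~: b' a c + d0 * b a c); split=> [a c|].
  by apply: nfD; [exact: nf_hbar|exact: nf_s].
rewrite qrho_sumL qrho_sum_delta.
exact (nf_sub_step yb zb).
Qed.

End Spanning.

(** * Lifting bijectivity from leading terms to the completions *)

Section UpsilonBijective.
Variables (C : numFieldType) (n : nat) (w : C) (hn : (0 < n)%N) (hw : w ^+ n = 1).
Local Notation qq := (root_times_exp hn hw).
Local Notation T := (weyl_hat C n).
Local Notation Q0 := (qtorus_alg qq).
Local Notation Q := (qtorus qq).
Local Notation W := (weyl_alg C).
Local Notation d0 := (wmon 'X 0 : W).
Local Notation delta := (qdelta hn hw).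
Local Notation inQ := (cin (hbar_fil Q0)).
Local Notation Qhat := (qtorus_hat n w qq).
Variables (Y1 : Q -> T) (Y : Qhat 1 -> T).
Hypotheses (Y1h : alg_hom Y1) (Yh : alg_hom Y).
Hypothesis Y0 : forall r X, cproj X r = 0 -> cproj (Y X) r = 0.
Hypothesis Yin : forall M, Y (qtorus_in n w M) = Y1 (M 0 0).
Hypothesis Y1f : forall r x, qtorus_adic n w qq r x -> cproj (Y1 x) r = 0.
Hypothesis Y1U : forall k l, Y1 (inQ (DZ qq k l)) = upsilon_mon hn hw k l.
Hypothesis wp : n.-primitive_root w.

Let fh : alg_hom (fun x => Y1 (inQ x)).
Proof. exact: (alg_hom_comp (cin_alg_hom _) Y1h). Qed.

Lemma qrho_sum_level r b : (forall a c, nf d0 r (b a c)) ->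
  cproj (Y1 (inQ (qrho_sum hn hw b))) r.+1
    = cproj (\sum_(a < n) \sum_(c < n) wemb a c (b a c)) r.+1.
Proof.
move=> nb; rewrite (alg_hom_sum fh); apply: cproj_sum_eq => a.
rewrite (alg_hom_sum fh); apply: cproj_sum_eq => c.
exact: (qrho_level wp fh Y1U).
Qed.

(** The entries of V are approximated modulo order r+1 by uncompleted elements of order r.
    Assembling their values under [qrho] gives a preimage with the right leading term. *)
Lemma upsilon_surj_step r (V : T) : cproj V r = 0 ->
  exists X, cproj X r = 0 /\ cproj (V - Y X) r.+1 = 0.
Proof.
move=> V0; have /choice [u uP] (p : 'I_n * 'I_n) : exists u : W, nf d0 r u /\
    cproj (ccoord p.1 p.2 V) r.+1
    = cproj (cin (weyl_adic C) (cin (hbar_fil W) u)) r.+1.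
  set v := ccoord _ _ V; have v0 : cproj v r = 0 by exact: cmap0r.
  have /weyl_adicP /(nf_approx r.+1) [u [Z [nu e]]] :
      weyl_adic C r (qrepr (cproj v r.+1)) by apply: cproj_repr0.
  exists u; split=> //; rewrite -cproj_repr; apply/qpiP.
  by rewrite e addrC addKr; exact: weyl_adic_hbar.
pose b a c := u (a, c); pose x := qrho_sum hn hw b.
have nb a c : nf d0 r (b a c) by exact: (uP (a, c)).1.
exists (qtorus_in n w (inQ x)%:M); split.
  apply/cproj_in0/mat_ideal_setE => i j; rewrite mxE !ord1.
  by apply: qtorus_adic_in; exact: qrho_sum_nf.
apply/cproj_sub0; rewrite Yin mxE eqxx (qrho_sum_level nb) -[in LHS](ccoordK V).
apply: cproj_sum_eq => a; apply: cproj_sum_eq => c.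
by apply: csingle_cong; exact: (uP (a, c)).2.
Qed.

(** A representative of X is a value of [qrho] modulo order r+1, with coefficients of order r. Up to
    order r+1 these coefficients are the matrix entries of the image, so they gain an order when the
    image does, and with them X. *)
Lemma upsilon_inj_step r X : cproj X r = 0 -> cproj (Y X) r.+1 = 0 -> cproj X r.+1 = 0.
Proof.
move=> X0 YX0; have [M XM] := cprojE X r.+1.
have : mat_fil 1 (qtorus_adic n w qq) r M.
  by apply/qpi_eq0; rewrite -cproj_in; apply: etrans X0; apply/esym/(cproj_le (leqnSn r)).
move=> /mat_ideal_setE /(_ 0 0) /qtorus_adicP /(nf_approx r.+1) [x0 [Z [nx e]]].
have [b [nb xb]] := qrho_graded wp nx.
have g1 : cproj (Y1 (M 0 0)) r.+1 = 0.
  rewrite -Yin -YX0; apply/cproj_sub0; rewrite -(alg_homB Yh); apply: Y0.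
  by apply/cproj_sub0; rewrite XM.
have g2 : cproj (Y1 (inQ x0)) r.+1 = 0.
  move: g1; rewrite e (alg_homD Y1h) cprojD [X in _ + X]Y1f ?addr0 //.
  exact: qtorus_adic_hbar.
have g3 : cproj (Y1 (inQ (qrho_sum hn hw b))) r.+1 = 0.
  rewrite -g2; apply/esym/cproj_sub0; rewrite -(alg_homB fh).
  by apply: Y1f; exact: qtorus_adic_in.
(* Each coefficient is recovered as a matrix entry of an element that vanishes at level r+1. *)
have nb1 a c : nf d0 r.+1 (b a c).
  apply/weyl_adic_in/cproj_in0.
  have <- : ccoord a c (\sum_(i < n) \sum_(j < n) wemb i j (b i j))
      = cin (weyl_adic C) (cin (hbar_fil W) (b a c)).
    exact: (ccoord_matrix a c (fun i j => cin (weyl_adic C) (cin (hbar_fil W) (b i j)))).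
  by apply: cmap0r; rewrite -(qrho_sum_level nb).
have nx1 : nf delta r.+1 x0.
  by rewrite -(subrK (qrho_sum hn hw b) x0); apply: nfD => //; exact: qrho_sum_nf.
rewrite XM; apply/qpi_eq0/mat_ideal_setE => i j; rewrite !ord1 e.
by apply: idealD; [exact: qtorus_adic_in|exact: qtorus_adic_hbar].
Qed.


Lemma upsilon_bijective : bijective Y.
Proof.
apply: (graded_bijective Yh) => //.
- by move=> x; apply/mat_ideal_setE.
- by move=> x; apply/mat_ideal_setE.
- exact: upsilon_surj_step.
- exact: upsilon_inj_step.
Qed.

End UpsilonBijective.

Theorem theorem2p2 (R : realType) (n : nat) (w : R[i]) (hn : (0 < n)%N)
    (hw : w ^+ n = 1) :
  let q := root_times_exp hn hw in
  exists Upsilon : qtorus_hat n w q 1 -> weyl_hat R[i] n,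
    unique (@is_upsilon1 R[i] n w q) Upsilon /\
    forall m : nat, (0 < m)%N ->
      let Upsilon_m := @upsilon_mn R[i] n w q Upsilon m in
      alg_hom Upsilon_m /\
      exists Upsilon_bar : qtorus_ext n w q m -> weyl_ext R[i] (m * n),
        unique (is_upsilon_bar Upsilon_m) Upsilon_bar /\
        (n.-primitive_root w -> bijective Upsilon_m /\ bijective Upsilon_bar).
Proof.
move=> q; have [Y1 [Y [[Yu Y1h Yh] [Y0 Yin Y1f Y1hb Y1U]]]] := upsilon1P hn hw.
exists Y; split=> // m _; split; first exact: kron_ext_alg_hom Yh m.
exists (upsilon_bar Y (m := m)); split.
  exact (upsilon_barP Y1h Yh Y0 Yin Y1hb Y1U m).
move=> wp; have Yb : bijective Y := upsilon_bijective Y1h Yh Y0 Yin Y1f Y1U wp.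
have Ymb := kron_ext_bij m Yb.
by split; [exact: Ymb | exact: upsilon_bar_bij].
Qed.
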